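(* Let $\Omega$ be a bounded domain in $\mathbb{C}^d$, let $E$ be a good zero variety of $\Omega$, and let $F:\Omega\to\mathbb{C}^d$ be holomorphic on $\overline{\Omega}$ such that the image of $F$ contains an interior point. Then $F^{-1}(F(\overline{E}))=\{z\in\Omega: F(z)\in F(\overline{E})\}$ is $L^2_a$-removable in $\Omega$, and $F(\overline{E})$ is $L^2_a$-removable in the sense that for every domain $D\subseteq\mathbb{C}^d$ containing $F(\Omega)$, the set $F(\overline E)\cap D$ is $L^2_a$-removable in $D$.
   Context: ''Holomorphic on $\overline{\Omega}$'' means holomorphic on an open neighborhood of $\overline{\Omega}$; $\overline E$ denotes the closure of $E$ in $\overline{\Omega}$. A zero variety of $\Omega$ is a set $\{z\in\Omega: f(z)=0\}$ with $f$ a nonconstant holomorphic function on $\Omega$. A zero variety $E$ is good if for each $\lambda\in\overline\Omega$ there is an open ball $U$ centered at $\lambda$ and a holomorphic function $h$ on $U$ with $U\cap\overline E=\{z\in U\cap\overline\Omega: h(z)=0\}$. For a domain $D$, $L^2_a(D)$ is the Bergman space of holomorphic functions on $D$ square integrable w.r.t. Lebesgue measure. A relatively closed subset $\mathcal{E}$ of a domain $D$ is $L^2_a$-removable in $D$ if every function in $L^2_a(D\setminus\mathcal{E})$ extends analytically to a function in $L^2_a(D)$. *)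

(* Defs.v *)
From HB Require Import structures.
From mathcomp Require Import all_boot all_order all_algebra.
From mathcomp Require Import all_classical all_reals all_analysis.
From mathcomp.real_closed Require Import complex.
Import Order.TTheory GRing.Theory Num.Theory.
Import numFieldNormedType.Exports.

Set Implicit Arguments.
Unset Strict Implicit.
Unset Printing Implicit Defensive.

Local Open Scope ring_scope.
Local Open Scope classical_set_scope.

(* C^d, as row vectors over the complex numbers R[i], with its canonical
   (product / max-norm) topology and normed C-module structure. *)
Definition Cd (R : realType) (d : nat) : normedModType R[i] := 'rV[R[i]]_d.

Definition Cs (R : realType) : normedModType R[i] := (R[i])^o.

Definition sqmod (R : realType) (w : R[i]) : R :=
  (complex.Re w) ^+ 2 + (complex.Im w) ^+ 2.

Definition eball (R : realType) (d : nat) (c : Cd R d) (r : R) : set (Cd R d) :=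
  [set z | \sum_(j < d) sqmod ((z : 'rV[R[i]]_d) 0 j - (c : 'rV[R[i]]_d) 0 j) < r ^+ 2].

(* f holomorphic on the open set U: complex (Frechet) differentiable at
   every point of U (differentiability is w.r.t. R[i]-linear maps). *)
Definition holo_on (R : realType) (d : nat) (W : normedModType R[i])
  (U : set (Cd R d)) (f : Cd R d -> W) : Prop :=
  open U /\ forall z, U z -> differentiable f z.

Definition holo_on_closure (R : realType) (d : nat) (W : normedModType R[i])
  (Om : set (Cd R d)) (f : Cd R d -> W) : Prop :=
  exists V : set (Cd R d), closure Om `<=` V /\ holo_on V f.

Definition domain (R : realType) (d : nat) (D : set (Cd R d)) : Prop :=
  open D /\ connected D /\ D !=set0.

(* Lebesgue measure on C^d = R^(2d), via the iterated Lebesgue integral over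
   the real coordinates (for nonnegative measurable integrands this is the
   integral for the product (Lebesgue) measure, by Tonelli). *)
Fixpoint iter_int (R : realType) (n : nat) (g : seq R -> \bar R) : \bar R :=
  match n with
  | 0 => g [::]
  | n'.+1 => (\int[@lebesgue_measure R]_(x in [set: R])
                 iter_int n' (fun s => g (x :: s)))%E
  end.

Definition ptC (R : realType) (d : nat) (s : seq R) : Cd R d :=
  \row_(j < d) (s`_(2 * j) +i* s`_(2 * j).+1)%C.

Definition sq_integral (R : realType) (d : nat) (A : set (Cd R d))
  (g : Cd R d -> Cs R) : \bar R :=
  iter_int (2 * d) (fun s => if `[< A (ptC d s) >] then (sqmod (g (ptC d s)))%:E
                             else 0%E).

Definition bergman (R : realType) (d : nat) (U : set (Cd R d))
  (g : Cd R d -> Cs R) : Prop :=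
  holo_on U g /\ (sq_integral U g < +oo)%E.

Definition zero_variety (R : realType) (d : nat) (Om E : set (Cd R d)) : Prop :=
  exists f : Cd R d -> Cs R,
    holo_on Om f /\ (exists z w, Om z /\ Om w /\ f z <> f w) /\
    E = [set z | Om z /\ f z = 0].

Definition good_zero_variety (R : realType) (d : nat) (Om E : set (Cd R d)) : Prop :=
  zero_variety Om E /\
  forall lam, closure Om lam ->
    exists r : R, 0 < r /\ exists h : Cd R d -> Cs R,
      holo_on (eball lam r) h /\
      eball lam r `&` closure E = [set z | eball lam r z /\ closure Om z /\ h z = 0].

Definition rel_closed (R : realType) (d : nat) (D Ec : set (Cd R d)) : Prop :=
  exists C : set (Cd R d), closed C /\ Ec = C `&` D.

Definition L2a_removable (R : realType) (d : nat) (D Ec : set (Cd R d)) : Prop :=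
  rel_closed D Ec /\
  forall g : Cd R d -> Cs R, bergman (D `\` Ec) g ->
    exists G : Cd R d -> Cs R, bergman D G /\ forall z, (D `\` Ec) z -> G z = g z.

(* Main.v *)
(** The compact set [K = F(closure E)] and its preimage [F^-1(K)] are thin: countable
    unions of sets that, for all small [e], are covered by [O(e^(2-2d))] balls of radius
    [e]. For [closure E] this follows from goodness, since a zero set is stratified by the
    order of vanishing into pieces of Lipschitz graphs over hyperplanes; Lipschitz images
    inherit it. The Jacobian determinant of [F] does not vanish identically, because
    otherwise [F(Om)] would be null; off its zero set [F] is locally bi-Lipschitz, so
    [F^-1(K)] is thin too.

    A thin relatively closed set [S] is removable. Counting the covering balls met by each
    complex line of a fixed direction, Fatou's lemma shows that almost every such line meets
    [S] in a countable set, and the same count over directions gives a line through a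
    prescribed point [p] with this property. On that line some square around [p] has
    boundary disjoint from [S], and the Cauchy integral of [g] over translates of the square
    is holomorphic near [p]. It equals [g] on almost every parallel line: Cauchy's theorem
    holds there in the presence of countably many exceptional points, as square
    integrability provides arbitrarily small rectangles around each of them along which the
    integral of [|g|] is arbitrarily small. As [S] is null, the extension is square
    integrable. *)

Require Import Defs.
From HB Require Import structures.
From mathcomp Require Import all_boot all_order all_algebra.
From mathcomp Require Import all_classical all_reals all_analysis.
From mathcomp Require Import measurable_realfun.
From mathcomp.real_closed Require Import complex.
From mathcomp Require Import ring lra.
Import Order.TTheory GRing.Theory Num.Theory.
Import numFieldNormedType.Exports.

Set Implicit Arguments.
Unset Strict Implicit.
Unset Printing Implicit Defensive.

Local Open Scope ring_scope.
Local Open Scope classical_set_scope.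

(** * Complex differentiability *)

(** The image of [closure E] carries no analytic structure to work with: [closure E] may reach the
    boundary of [Om] and [F] need not be proper. Thinness is therefore a pure covering condition,
    stable under Lipschitz maps and countable unions, and exceptional points on a line may
    accumulate, so isolated singularities are not enough. The exponent is the one that balances:
    [e^(2-2d)] balls of radius [e] project to total volume of order 1 in [C^(d-1)], so the mean
    number of balls over a slice stays bounded as [e] tends to 0. Volume is an iterated integral, so
    integrands are kept lower semicontinuous: squared moduli cut off outside open sets, and counts
    of open boxes. This class survives slicing and partial integration, and yields Fatou and Tonelli
    one variable at a time. Statements about almost every line take the form that each box of
    parameters contains a good one, which suffices because the conclusions pass to limits. Contours
    are boundaries of squares, hence one-dimensional integrals; the kernel integral [W] stands for 2
    pi i, and its lower bound 8/9 is the origin of the factor 9/4 in the estimates. *)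

Section Norm1.
Variable R : realType.
Local Notation C := R[i].
Implicit Types z w : C.

(** The sum norm has values in [R], whereas the norm of [R[i]] takes values in [R[i]]. It is
    submultiplicative and agrees with the modulus up to the factor in [cn_sqmod], which is all that
    the estimates need. *)
Definition cn z : R := `|complex.Re z| + `|complex.Im z|.

Lemma cn_ge0 z : 0 <= cn z. Proof. exact: addr_ge0. Qed.

Lemma cn0 : cn 0 = 0. Proof. by rewrite /cn /= !normr0 addr0. Qed.

Lemma cnN z : cn (- z) = cn z.
Proof. by case: z => a b; rewrite /cn /= !normrN. Qed.

Lemma cnD z w : cn (z + w) <= cn z + cn w.
Proof.
case: z w => [a b] [c d]; rewrite /cn /=.
by have := ler_normD a c; have := ler_normD b d; lra.
Qed.

Lemma cnB z w : cn (z - w) <= cn z + cn w.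
Proof. by rewrite -(cnN w) cnD. Qed.

Lemma cn_sym z w : cn (z - w) = cn (w - z).
Proof. by rewrite -opprB cnN. Qed.

Lemma cnM z w : cn (z * w) <= cn z * cn w.
Proof.
case: z w => [a b] [c d]; rewrite /cn /= mulrDl !mulrDr -!normrM.
by have := ler_normB (a * c) (b * d); have := ler_normD (a * d) (b * c); lra.
Qed.

Lemma cn_eq0 z : cn z = 0 -> z = 0.
Proof.
case: z => a b /eqP; rewrite /cn /= paddr_eq0// !normr_eq0.
by case/andP=> /eqP -> /eqP ->.
Qed.

Lemma cn_gt0 z : z != 0 -> 0 < cn z.
Proof.
by move=> z0; rewrite lt0r cn_ge0 andbT; apply: contra_neq z0; exact: cn_eq0.
Qed.

Lemma cn_real (x : R) : cn x%:C%C = `|x|.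
Proof. by rewrite /cn /= normr0 addr0. Qed.

Lemma Re_cn z : `|complex.Re z| <= cn z.
Proof. by rewrite lerDl. Qed.

Lemma Im_cn z : `|complex.Im z| <= cn z.
Proof. by rewrite lerDr. Qed.

Lemma sqmod_ge0 z : 0 <= sqmod z.
Proof. by rewrite addr_ge0// sqr_ge0. Qed.

Lemma cn_sqmod z : cn z ^+ 2 <= 2 * sqmod z.
Proof.
case: z => a b; rewrite /cn /sqmod /= -(real_normK (num_real a)).
rewrite -(real_normK (num_real b)).
by have := sqr_ge0 (`|a| - `|b|); rewrite sqrrB sqrrD; lra.
Qed.

Lemma sqmod_cn z : sqmod z <= cn z ^+ 2.
Proof.
case: z => a b; rewrite /cn /sqmod /= -(real_normK (num_real a)).
rewrite -(real_normK (num_real b)) sqrrD.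
have : 0 <= `|a| * `|b| by exact: mulr_ge0.
by lra.
Qed.

(** The inverse is the conjugate over [sqmod z], so its norm is [cn z / sqmod z]; the 2 comes from
    [cn_sqmod], as [cn] is only submultiplicative. *)
Lemma cnV z : z != 0 -> cn z^-1 <= 2 / cn z.
Proof.
move=> z0; rewrite ler_pdivlMr ?cn_gt0//.
have s0 : 0 < sqmod z.
  have := cn_sqmod z; have := exprn_gt0 2 (cn_gt0 z0); lra.
have -> : cn z^-1 = cn z / sqmod z.
  case: z z0 s0 => a b _ s0; rewrite /cn /=.
  rewrite -/(sqmod (a +i* b)%C) normrN !normrM.
  have -> : `|(a ^+ 2 + b ^+ 2)^-1| = (sqmod (a +i* b)%C)^-1.
    by rewrite ger0_norm// invr_ge0 addr_ge0// sqr_ge0.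
  by rewrite -mulrDl.
by rewrite mulrAC -expr2 ler_pdivrMr//; exact: cn_sqmod.
Qed.

Lemma cn1 : cn 1 = 1. Proof. by rewrite /cn /= normr1 normr0 addr0. Qed.

Lemma cnX z m : cn (z ^+ m) <= cn z ^+ m.
Proof.
elim: m => [|m IH]; first by rewrite !expr0 cn1.
by rewrite !exprS (le_trans (cnM _ _))// ler_wpM2l// cn_ge0.
Qed.

Lemma cn_sum (I : Type) (s : seq I) (F : I -> C) :
  cn (\sum_(i <- s) F i) <= \sum_(i <- s) cn (F i).
Proof.
elim: s => [|i s IH]; first by rewrite !big_nil cn0.
by rewrite !big_cons (le_trans (cnD _ _))// lerD2l.
Qed.

End Norm1.

Section Dif.
Variable R : realType.
Local Notation C := R[i].

Section Def.
Variables (V : lmodType C) (N : V -> R).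
Implicit Types (f g : V -> C) (L : V -> C) (z w : V).

(** Frechet differentiability with a bounded complex-linear [L], relative to a gauge [N]: one
    definition serves [C] with [cn] and row vectors with [vn]. The derivative is an argument so that
    it can be exhibited explicitly, later as an integral. *)
Definition isd f z L :=
  [/\ forall (a : C) u v, L (a *: u + v) = a * L u + L v,
      exists K, 0 <= K /\ forall u, cn (L u) <= K * N u &
      forall e : R, 0 < e -> exists2 r : R, 0 < r &
        forall w, N (w - z) < r -> cn (f w - f z - L (w - z)) <= e * N (w - z)].

Definition dif f z := exists L, isd f z L.

Definition cnt f z := forall e : R, 0 < e -> exists2 r : R, 0 < r &
  forall w, N (w - z) < r -> cn (f w - f z) < e.

Hypothesis N_ge0 : forall z, 0 <= N z.

Lemma isd_lip f z L : isd f z L -> exists K, 0 < K /\ exists2 r : R, 0 < r &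
  forall w, N (w - z) < r -> cn (f w - f z) <= K * N (w - z).
Proof.
case=> _ [K [K0 HK]] /(_ 1 ltr01) [r r0 H]; exists (K + 1); split; first lra.
exists r => // w /H; rewrite mul1r => h.
have := cnD (f w - f z - L (w - z)) (L (w - z)); rewrite subrK.
by have := HK (w - z); lra.
Qed.

Lemma dif_cnt f z : dif f z -> cnt f z.
Proof.
case=> L /isd_lip[K [K0 [r r0 H]]] e e0.
exists (Num.min r (e / K)) => [|w]; first by rewrite lt_min r0 divr_gt0.
rewrite lt_min ltr_pdivlMr// => /andP[/H h1 h2].
by apply: le_lt_trans h1 _; rewrite mulrC.
Qed.

Lemma dif_cst c z : dif (fun=> c) z.
Proof.
exists (fun=> 0); split => [a u v||e e0]; first by rewrite mulr0 addr0.
  by exists 0; split=> // u; rewrite cn0 mul0r.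
by exists 1 => // w _; rewrite subrr subr0 cn0 mulr_ge0// ltW.
Qed.

Lemma isdD f g z L M :
  isd f z L -> isd g z M -> isd (fun w => f w + g w) z (fun w => L w + M w).
Proof.
case=> Ll [K [K0 HK]] HL [Ml [K' [K'0 HK']]] HM; split.
- by move=> a u v; rewrite Ll Ml mulrDr addrACA.
- exists (K + K'); split=> [|u]; first lra.
  by rewrite mulrDl (le_trans (cnD _ _))// lerD.
move=> e e0; have e20 : 0 < e / 2 by lra.
have [r r0 H] := HL _ e20; have [s s0 H'] := HM _ e20.
exists (Num.min r s) => [|w]; first by rewrite lt_min r0.
rewrite lt_min => /andP[/H h /H' h'].
have -> : f w + g w - (f z + g z) - (L (w - z) + M (w - z)) =
  (f w - f z - L (w - z)) + (g w - g z - M (w - z)) by ring.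
by rewrite (le_trans (cnD _ _))//; lra.
Qed.

Lemma isd_ext f g z L : (exists2 r : R, 0 < r & forall w, N (w - z) < r -> f w = g w) ->
  f z = g z -> isd f z L -> isd g z L.
Proof.
move=> [r r0 fg] fgz [? ? H]; split=> // e /H[s s0 Hs].
exists (Num.min r s) => [|w]; first by rewrite lt_min r0.
by rewrite lt_min => /andP[/fg <- /Hs]; rewrite fgz.
Qed.

End Def.

(** Restrictions to lines, translations and slides along a direction are all instances. [A] is a
    bare function, so its affinity is given by identities on differences, and [A w - A 0] is its
    linear part. *)
Lemma isd_aff (V V' : lmodType C) (N : V -> R) (N' : V' -> R) (A : V' -> V) K f z L :
  (forall z, 0 <= N' z) -> 0 <= K ->
  (forall w z (a : C), A (a *: w + z) - A z = a *: (A w - A 0)) ->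
  (forall w z, A w - A z = A (w - z) - A 0) ->
  (forall w, N (A w - A 0) <= K * N' w) ->
  isd N f (A z) L -> isd N' (fun w => f (A w)) z (fun w => L (A w - A 0)).
Proof.
move=> N'0 K0 AZ AB AN [Ll [K' [K'0 HK']] HL]; split.
- move=> a u v; rewrite -Ll; congr L.
  by rewrite -(AZ u v a) [RHS]addrA subrK.
- exists (K' * K); split=> [|u]; first exact: mulr_ge0.
  by rewrite (le_trans (HK' _))// -mulrA ler_wpM2l.
move=> e e0; have e10 : 0 < e / (K + 1) by rewrite divr_gt0//; lra.
have [r r0 H] := HL _ e10; exists (r / (K + 1)) => [|w wr].
  by rewrite divr_gt0//; lra.
rewrite -AB.
have NA : N (A w - A z) <= (K + 1) * N' (w - z).
  by have := AN (w - z); rewrite -AB; have := N'0 (w - z); lra.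
have /H h : N (A w - A z) < r.
  by rewrite (le_lt_trans NA)// mulrC -ltr_pdivlMr//; lra.
rewrite (le_trans h)// mulrAC ler_pdivrMr; last by lra.
by rewrite mulrAC -mulrA ler_wpM2l// ltW.
Qed.

Lemma isd_comp (V : lmodType C) (N : V -> R) (f : V -> C) (g : C -> C) z L M :
  (forall z, 0 <= N z) ->
  isd N f z L -> isd (@cn R : R[i]^o -> R) (g : R[i]^o -> C) (f z) M ->
  isd N (fun w => g (f w)) z (fun w => M (L w)).
Proof.
move=> N0 Hf [Ml [K' [K'0 HK']] HM].
have [K1 [K10 [r1 r10 lf]]] := isd_lip Hf.
case: Hf => [Ll [K [K0 HK]] HL].
have MB u v : M (u - v) = M u - M v.
  by have := Ml (-1) v u; rewrite scaleN1r mulN1r addrC => ->; rewrite addrC.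
split.
- by move=> a u v; rewrite Ll -Ml.
- exists (K' * K); split=> [|u]; first exact: mulr_ge0.
  by rewrite (le_trans (HK' _))// -mulrA ler_wpM2l.
move=> e e0.
have e10 : 0 < e / 2 / K1 by rewrite !divr_gt0//.
have e20 : 0 < e / 2 / (K' + 1) by rewrite !divr_gt0//; lra.
have [r r0 H] := HM _ e10; have [s s0 H'] := HL _ e20.
exists (Num.min r1 (Num.min s (r / K1))) => [|w].
  by rewrite !lt_min r10 s0 divr_gt0.
rewrite !lt_min => /and3P[/lf h1 /H' h2]; rewrite ltr_pdivlMr// mulrC => h3.
have /H h4 : cn (f w - f z) < r by exact: le_lt_trans h3.
have -> : g (f w) - g (f z) - M (L (w - z)) =
   (g (f w) - g (f z) - M (f w - f z)) + M (f w - f z - L (w - z)).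
  by rewrite (MB (f w - f z) (L (w - z))); ring.
rewrite (le_trans (cnD _ _))//.
have : e / 2 / K1 * cn (f w - f z) <= e / 2 * N (w - z).
  rewrite -mulrA ler_wpM2l//; first lra.
  by rewrite mulrC ler_pdivrMr// mulrC.
have : cn (M (f w - f z - L (w - z))) <= e / 2 * N (w - z).
  rewrite (le_trans (HK' _))// (le_trans (ler_wpM2l K'0 h2))//.
  rewrite mulrA ler_wpM2r// mulrCA ler_piMr//; [lra|].
  by rewrite ler_pdivrMr; lra.
by lra.
Qed.

End Dif.

Section Closure.
Variable R : realType.
Local Notation C := R[i].

Definition cdif (f : C -> C) z := dif (V := R[i]^o) (@cn R) f z.

Lemma isd_lin1 (f : C -> C) z L u :
  isd (V := R[i]^o) (@cn R) f z L -> L u = u * L 1.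
Proof.
case=> Ll _ _; have L0 : L 0 = 0.
  have := Ll 0 0 0; rewrite scaler0 add0r mul0r add0r => h.
  by have := Ll 1 0 0; rewrite scaler0 addr0 mul1r => /eqP; rewrite eq_sym -subr_eq0 addrK => /eqP.
by have := Ll u 1 0; rewrite L0 !addr0 => <-; congr L; exact/esym/mulr1.
Qed.

Lemma cdif_id z : cdif id z.
Proof.
exists id; split=> //; first by exists 1; split=> // u; rewrite mul1r.
by move=> e e0; exists 1 => // w _; rewrite subrr cn0 mulr_ge0 ?cn_ge0// ltW.
Qed.

Lemma cdif_sq z : cdif (fun w => w ^+ 2) z.
Proof.
exists (fun u => 2 * z * u); split=> [a u v||e e0].
- by rewrite mulrDr; congr (_ + _); rewrite mulrCA.
- by exists (cn (2 * z)); split=> [|u]; [exact: cn_ge0|exact: cnM].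
exists e => // w we.
have -> : w ^+ 2 - z ^+ 2 - 2 * z * (w - z) = (w - z) * (w - z) by ring.
by rewrite (le_trans (cnM _ _))// ler_wpM2r ?cn_ge0// ltW.
Qed.

Lemma cdif_inv z : z != 0 -> cdif (fun w => w^-1) z.
Proof.
move=> z0; exists (fun u => - (z ^- 2) * u); split=> [a u v||e e0].
- by rewrite mulrDr; congr (_ + _); rewrite mulrCA.
- by exists (cn (- z ^- 2)); split=> [|u]; [exact: cn_ge0|exact: cnM].
pose B := cn (z ^- 2) * (4 / cn z) + 1.
have nz : 0 < cn z by exact: cn_gt0.
have B0 : 0 < B.
  by rewrite ltr_wpDl// mulr_ge0 ?cn_ge0// divr_ge0// ltW.
exists (Num.min (cn z / 2) (e / B)) => [|w].
  by rewrite lt_min !divr_gt0.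
rewrite lt_min !ltr_pdivlMr// => /andP[w1 w2].
have wz : cn z / 2 < cn w.
  by have := cnB w (w - z); rewrite opprB addrC subrK; lra.
have w0 : w != 0 by apply: contraTneq wz => ->; rewrite cn0 -leNgt; lra.
have -> : w^-1 - z^-1 - - z ^- 2 * (w - z) = z ^- 2 * w^-1 * (w - z) * (w - z).
  by field; apply/andP.
rewrite (le_trans (cnM _ _))// ler_wpM2r ?cn_ge0//.
rewrite (le_trans (cnM _ _))// (le_trans _ (ltW w2))// [leRHS]mulrC ler_wpM2r ?cn_ge0//.
rewrite (le_trans (cnM _ _))// /B ler_wpDr// ler_wpM2l ?cn_ge0//.
rewrite (le_trans (cnV w0))// ler_pdivrMr; last lra.
by rewrite mulrAC ler_pdivlMr//; lra.
Qed.

Section Vec.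
Variables (V : lmodType C) (N : V -> R).
Hypothesis N_ge0 : forall z, 0 <= N z.
Implicit Types f g : V -> C.

Lemma difD f g z : dif N f z -> dif N g z -> dif N (fun w => f w + g w) z.
Proof. by move=> [L HL] [M HM]; exists (fun w => L w + M w); exact: isdD. Qed.

Lemma dif_comp (h : C -> C) f z :
  dif N f z -> cdif h (f z) -> dif N (fun w => h (f w)) z.
Proof. by move=> [L HL] [M HM]; exists (fun w => M (L w)); exact: isd_comp. Qed.

Lemma dif_scale c f z : dif N f z -> dif N (fun w => c * f w) z.
Proof.
move=> fz; apply: (dif_comp (h := fun w => c * w)) => //.
exists (fun u => c * u); split=> [a u v||e e0].
- by rewrite mulrDr; congr (_ + _); rewrite mulrCA.
- by exists (cn c); split=> [|u]; [exact: cn_ge0|exact: cnM].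
exists 1 => // w _; rewrite mulrBr subrr cn0 mulr_ge0 ?cn_ge0// ltW//.
Qed.

Lemma difB f g z : dif N f z -> dif N g z -> dif N (fun w => f w - g w) z.
Proof.
move=> fz gz; have -> : (fun w => f w - g w) = (fun w => f w + (-1) * g w).
  by apply/funext => w; rewrite mulN1r.
by apply: difD => //; exact: dif_scale.
Qed.

(** Polarization writes the product as a combination of two squares, so the chain rule with the
    square function is enough. *)
Lemma difM f g z : dif N f z -> dif N g z -> dif N (fun w => f w * g w) z.
Proof.
move=> fz gz.
have -> : (fun w => f w * g w) =
    (fun w => 4^-1 * ((f w + g w) ^+ 2 - (f w - g w) ^+ 2)).
  by apply/funext => w; field.
apply/dif_scale/difB.
  by apply: (dif_comp (h := fun w => w ^+ 2)); [exact: difD|exact: cdif_sq].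
by apply: (dif_comp (h := fun w => w ^+ 2)); [exact: difB|exact: cdif_sq].
Qed.

Lemma difV f z : f z != 0 -> dif N f z -> dif N (fun w => (f w)^-1) z.
Proof. by move=> f0 fz; apply: (dif_comp (h := fun w => w^-1)) fz _; exact: cdif_inv. Qed.

Lemma dif_div f g z : g z != 0 -> dif N f z -> dif N g z ->
  dif N (fun w => f w / g w) z.
Proof. by move=> g0 fz gz; apply: difM => //; exact: difV. Qed.

Lemma difX f m z : dif N f z -> dif N (fun w => f w ^+ m) z.
Proof.
move=> fz; elim: m => [|m IH].
  rewrite (_ : (fun _ => _) = (fun=> 1)); first exact: dif_cst.
  by apply/funext => w; rewrite expr0.
rewrite (_ : (fun _ => _) = (fun w => f w * f w ^+ m)); first exact: difM.
by apply/funext => w; rewrite exprS.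
Qed.

Lemma dif_sum (I : Type) (s : seq I) (F : I -> V -> C) z :
  (forall i, dif N (F i) z) -> dif N (fun w => \sum_(i <- s) F i w) z.
Proof.
move=> H; elim: s => [|i s IH].
  rewrite (_ : (fun _ => _) = (fun=> 0)); first exact: dif_cst.
  by apply/funext => w; rewrite big_nil.
rewrite (_ : (fun _ => _) = (fun w => F i w + \sum_(j <- s) F j w)).
  exact: difD.
by apply/funext => w; rewrite big_cons.
Qed.

Lemma dif_prod (I : Type) (s : seq I) (F : I -> V -> C) z :
  (forall i, dif N (F i) z) -> dif N (fun w => \prod_(i <- s) F i w) z.
Proof.
move=> H; elim: s => [|i s IH].
  rewrite (_ : (fun _ => _) = (fun=> 1)); first exact: dif_cst.
  by apply/funext => w; rewrite big_nil.
rewrite (_ : (fun _ => _) = (fun w => F i w * \prod_(j <- s) F j w)).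
  exact: difM.
by apply/funext => w; rewrite big_cons.
Qed.

Lemma dif_ext f g z : (exists2 r : R, 0 < r & forall w, N (w - z) < r -> f w = g w) ->
  f z = g z -> dif N f z -> dif N g z.
Proof. by move=> H h [L HL]; exists L; exact: isd_ext HL. Qed.

End Vec.

Section OneVar.
Implicit Types (f g : C -> C) (z k : C).
Let c0 : forall z : R[i]^o, 0 <= cn z := @cn_ge0 R.

Lemma cdif_cst k z : cdif (fun=> k) z. Proof. exact: dif_cst. Qed.

Lemma cdifD f g z : cdif f z -> cdif g z -> cdif (fun w => f w + g w) z.
Proof. exact: difD. Qed.

Lemma cdifB f g z : cdif f z -> cdif g z -> cdif (fun w => f w - g w) z.
Proof. exact: difB. Qed.

Lemma cdifM f g z : cdif f z -> cdif g z -> cdif (fun w => f w * g w) z.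
Proof. exact: difM. Qed.

Lemma cdif_scale k f z : cdif f z -> cdif (fun w => k * f w) z.
Proof. exact: dif_scale. Qed.

Lemma cdifX f m z : cdif f z -> cdif (fun w => f w ^+ m) z.
Proof. exact: difX. Qed.

Lemma cdif_div f g z : g z != 0 -> cdif f z -> cdif g z -> cdif (fun w => f w / g w) z.
Proof. exact: dif_div. Qed.

End OneVar.
End Closure.

(** * Integrals of complex functions over segments *)

Section Cint.
Variable R : realType.
Local Notation C := R[i].
Local Notation mu := (@lebesgue_measure R).
Implicit Types (a b m t s : R) (phi psi : R -> C).

Definition ctn a b phi := forall t, a <= t <= b -> forall e : R, 0 < e ->
  exists2 r : R, 0 < r & forall s, a <= s <= b -> `|s - t| < r ->
    cn (phi s - phi t) < e.

Lemma ctn_ext a b phi psi : (forall t, a <= t <= b -> phi t = psi t) ->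
  ctn a b phi -> ctn a b psi.
Proof.
move=> E H t tab e e0; have [r r0 h] := H t tab e e0.
by exists r => // s sab; rewrite -!E//; exact: h.
Qed.

Lemma ctn_cst a b c : ctn a b (fun=> c).
Proof. by move=> t _ e e0; exists 1 => // s _ _; rewrite subrr cn0. Qed.

Lemma ctnD a b phi psi : ctn a b phi -> ctn a b psi ->
  ctn a b (fun t => phi t + psi t).
Proof.
move=> H K t tab e e0; have e2 : 0 < e / 2 by lra.
have [r r0 h] := H t tab _ e2; have [q q0 k] := K t tab _ e2.
exists (Num.min r q) => [|s sab]; first by rewrite lt_min r0.
rewrite lt_min => /andP[/(h _ sab) h1 /(k _ sab) h2].
by rewrite opprD addrACA (le_lt_trans (cnD _ _))//; lra.
Qed.

Lemma ctnZ a b c phi : ctn a b phi -> ctn a b (fun t => c * phi t).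
Proof.
move=> H t tab e e0; have c0 := cn_ge0 c.
have e2 : 0 < e / (cn c + 1) by rewrite divr_gt0//; lra.
have [r r0 h] := H t tab _ e2; exists r => // s sab /(h _ sab).
rewrite -mulrBr ltr_pdivlMr ?ltr_wpDl// => h1.
rewrite (le_lt_trans (cnM _ _))//.
by have := cn_ge0 (phi s - phi t); lra.
Qed.

Lemma ctnB a b phi psi : ctn a b phi -> ctn a b psi ->
  ctn a b (fun t => phi t - psi t).
Proof.
move=> H K; apply: (@ctn_ext _ _ (fun t => phi t + (-1) * psi t)).
  by move=> t _; rewrite mulN1r.
by apply: ctnD => //; exact: ctnZ.
Qed.

Lemma ctn_dif_h (f : C -> C) a b c :
  (forall t, a <= t <= b -> cdif f (t +i* c)%C) ->
  ctn a b (fun t => f (t +i* c)%C).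
Proof.
move=> H t /H /dif_cnt h e /h [r r0 k]; exists r => // s _ st.
by apply: k; rewrite /cn /= subrr normr0 addr0.
Qed.

Lemma ctn_dif_v (f : C -> C) a b c :
  (forall t, a <= t <= b -> cdif f (c +i* t)%C) ->
  ctn a b (fun t => f (c +i* t)%C).
Proof.
move=> H t /H /dif_cnt h e /h [r r0 k]; exists r => // s _ st.
by apply: k; rewrite /cn /= subrr normr0 add0r.
Qed.

Lemma ctn_within a b phi (g : C -> R) :
  (forall z w, `|g z - g w| <= cn (z - w)) -> ctn a b phi ->
  {within `[a, b], continuous (fun t => g (phi t))}.
Proof.
move=> gL H; apply/subspace_continuousP => t; rewrite /= in_itv /= => tab.
apply/cvgrPdist_lt => e e0; have [r r0 h] := H t tab e e0.
rewrite near_withinE; apply/nbhs_ballP; exists r => //= s; rewrite /ball /= => ts.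
rewrite in_itv /= => sab; rewrite distrC (le_lt_trans (gL _ _))//.
by apply: h => //; rewrite distrC.
Qed.

Lemma Re_lip (z w : C) : `|complex.Re z - complex.Re w| <= cn (z - w).
Proof. by case: z w => [? ?] [? ?]; rewrite (le_trans _ (Re_cn _)). Qed.

Lemma Im_lip (z w : C) : `|complex.Im z - complex.Im w| <= cn (z - w).
Proof. by case: z w => [? ?] [? ?]; rewrite (le_trans _ (Im_cn _)). Qed.

Lemma cn_lip (z w : C) : `|cn z - cn w| <= cn (z - w).
Proof.
rewrite ler_norml; have := cnD (z - w) w; have := cnD (w - z) z.
by rewrite !subrK (cn_sym w z); lra.
Qed.

Lemma ctn_integrable a b phi (g : C -> R) :
  (forall z w, `|g z - g w| <= cn (z - w)) -> ctn a b phi ->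
  mu.-integrable `[a, b] (EFin \o (fun t => g (phi t))).
Proof.
move=> gL H; apply: continuous_compact_integrable; first exact: segment_compact.
exact: ctn_within.
Qed.

Definition cint a b phi : C :=
  ((\int[mu]_(t in `[a, b]) complex.Re (phi t)) +i*
   (\int[mu]_(t in `[a, b]) complex.Im (phi t)))%C.

Lemma cint_ext a b phi psi : (forall t, a <= t <= b -> phi t = psi t) ->
  cint a b phi = cint a b psi.
Proof.
move=> E; congr (_ +i* _)%C; apply: eq_Rintegral => t;
  by rewrite inE /= in_itv /= => /E ->.
Qed.

Lemma cintD a b phi psi : ctn a b phi -> ctn a b psi ->
  cint a b (fun t => phi t + psi t) = cint a b phi + cint a b psi.
Proof.
move=> H K; rewrite /cint.
under eq_Rintegral do rewrite raddfD/=.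
rewrite RintegralD//=; [|exact: (ctn_integrable Re_lip)..].
under [X in (_ +i* X)%C]eq_Rintegral do rewrite raddfD/=.
by rewrite RintegralD//=; exact: (ctn_integrable Im_lip).
Qed.

Lemma cintZ a b c phi : ctn a b phi ->
  cint a b (fun t => c * phi t) = c * cint a b phi.
Proof.
move=> H; rewrite /cint; case: c => x y.
have IR := ctn_integrable Re_lip H; have II := ctn_integrable Im_lip H.
have IZ z (g : R -> R) : mu.-integrable `[a, b] (EFin \o g) ->
    mu.-integrable `[a, b] (EFin \o (fun t => z * g t)).
  move=> I.
  have I2 := @integrableZl _ _ R mu _ (measurable_itv _) z _ I.
  apply: eq_integrable I2 => //.
congr (_ +i* _)%C.
  rewrite -!RintegralZl// -RintegralB//; [|exact: IZ..].
  by apply: eq_Rintegral => t _; case: (phi t).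
rewrite -!RintegralZl// -RintegralD//; [|exact: IZ..].
by apply: eq_Rintegral => t _; case: (phi t).
Qed.

Lemma cintB a b phi psi : ctn a b phi -> ctn a b psi ->
  cint a b (fun t => phi t - psi t) = cint a b phi - cint a b psi.
Proof.
move=> H K; rewrite -mulN1r -(cintZ _ K) -cintD//; last exact: ctnZ.
by apply: cint_ext => t _; rewrite mulN1r.
Qed.

Lemma cint_cst a b c : a <= b -> cint a b (fun=> c) = (b - a)%:C%C * c.
Proof.
move=> ab; case: c => x y; rewrite /cint /=.
have E z : \int[mu]_(t in `[a, b]) z = (b - a) * z.
  rewrite Rintegral_cst//=; rewrite lebesgue_measure_itv/= lte_fin mulrC.
  case: ltP => // ba; congr (_ * _); apply/eqP; rewrite eq_sym subr_eq0.
  by rewrite eq_le ab ba.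
have -> : (b - a)%:C%C * (x +i* y)%C = ((b - a) * x +i* ((b - a) * y))%C.
  by congr (_ +i* _)%C; rewrite mul0r ?subr0 ?addr0.
by congr (_ +i* _)%C; exact: E.
Qed.

Lemma cint_split a b m phi : a <= m -> m <= b -> ctn a b phi ->
  cint a b phi = cint a m phi + cint m b phi.
Proof.
move=> am mb H.
have E (g : C -> R) : (forall z w, `|g z - g w| <= cn (z - w)) ->
    \int[mu]_(t in `[a, b]) g (phi t) =
    \int[mu]_(t in `[a, m]) g (phi t) + \int[mu]_(t in `[m, b]) g (phi t).
  move=> gL; have I := ctn_integrable gL H.
  have /esym/eqP := @Rintegral_itvB R _ (BLeft a) (BRight b) m I am mb.
  rewrite eq_sym subr_eq => /eqP ->; rewrite addrC; congr (_ + _).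
  rewrite Rintegral_itv_obnd_cbnd//.
  apply: (@integrableS _ _ _ mu `[a, b]) => //.
  by move=> t /=; rewrite !in_itv /= => /andP[? ->]; rewrite (le_trans am)// ltW.
by rewrite /cint (E _ Re_lip) (E _ Im_lip).
Qed.

(** For the sum norm the real and imaginary parts are estimated separately and the two bounds add
    up; no rotation of the integral is involved. *)
Lemma cint_le a b phi : ctn a b phi ->
  cn (cint a b phi) <= \int[mu]_(t in `[a, b]) cn (phi t).
Proof.
move=> H; rewrite {1}/cn /=.
have A (g : C -> R) : (forall z w, `|g z - g w| <= cn (z - w)) ->
    mu.-integrable `[a, b] (EFin \o (fun t => `|g (phi t)|)).
  move=> gL; apply: (ctn_integrable (g := fun z => `|g z|)) => // z w.
  by rewrite (le_trans (ler_dist_dist _ _)).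
rewrite RintegralD//; [|exact: (A _ Re_lip)|exact: (A _ Im_lip)].
by rewrite lerD// le_normr_Rintegral//;
  [exact: (ctn_integrable Re_lip)|exact: (ctn_integrable Im_lip)].
Qed.

Lemma cint_bound a b phi M : a <= b -> ctn a b phi ->
  (forall t, a <= t <= b -> cn (phi t) <= M) -> cn (cint a b phi) <= (b - a) * M.
Proof.
move=> ab H B; rewrite (le_trans (cint_le H))//.
have -> : (b - a) * M = \int[mu]_(t in `[a, b]) M.
  rewrite Rintegral_cst//=; rewrite lebesgue_measure_itv/= lte_fin mulrC.
  case: ltP => // ba; congr (_ * _); apply/eqP; rewrite subr_eq0.
  by rewrite eq_le ab ba.
apply: le_Rintegral => //; first exact: (ctn_integrable cn_lip).
  apply: (@ctn_integrable a b (fun=> M%:C%C) (@complex.Re R)); first exact: Re_lip.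
  exact: ctn_cst.
Qed.

End Cint.

(** * Cauchy's theorem with countably many exceptional points *)

Section Rect.
Variable R : realType.
Local Notation C := R[i].
Local Notation mu := (@lebesgue_measure R).
Local Notation Re := (@complex.Re R).
Local Notation Im := (@complex.Im R).
Implicit Types (a b c d m s t : R) (f g : C -> C) (z w p q : C).

Lemma avoid_countable l r (X : nat -> R) : l < r ->
  exists2 m, l < m < r & forall k, m != X k.
Proof.
move=> lr; apply: contrapT => H.
have /subset_card_le/sub_countable : `]l, r[%classic `<=` range X.
  move=> m /=; rewrite in_itv /= => lmr; apply: contrapT => mX; apply: H.
  by exists m => // k; apply/eqP => mk; apply: mX; exists k.
move=> /(_ (sub_countable (card_image_le _ _) (countableP _))) /countable_lebesgue_measure0.
by rewrite lebesgue_measure_itv/= lte_fin lr -EFinD => -[]; lra.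
Qed.

(** The contour integral of [f dz] around the rectangle, counterclockwise: bottom minus top, then
    [i] times right minus left. *)
Definition rint f a b c d : C :=
  cint a b (fun t => f (t +i* c)%C - f (t +i* d)%C) +
  (0 +i* 1)%C * cint c d (fun t => f (b +i* t)%C - f (a +i* t)%C).

Definition inr a b c d z := [&& a <= Re z, Re z <= b, c <= Im z & Im z <= d].

Definition onb a b c d z :=
  inr a b c d z && [|| Re z == a, Re z == b, Im z == c | Im z == d].

Definition bdif f a b c d := forall z, onb a b c d z -> cdif f z.

Lemma bdif_ctn f a b c d : a <= b -> c <= d -> bdif f a b c d ->
  [/\ ctn a b (fun t => f (t +i* c)%C), ctn a b (fun t => f (t +i* d)%C),
      ctn c d (fun t => f (a +i* t)%C) & ctn c d (fun t => f (b +i* t)%C)].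
Proof.
move=> ab cd H; split; (apply: ctn_dif_h || apply: ctn_dif_v) => t /andP[t1 t2];
  by apply: H; rewrite /onb /inr /= ?t1 ?t2 ?lexx ?ab ?cd ?eqxx ?orbT.
Qed.

Lemma bdif_ctnB f a b c d : a <= b -> c <= d -> bdif f a b c d ->
  ctn a b (fun t => f (t +i* c)%C - f (t +i* d)%C) /\
  ctn c d (fun t => f (b +i* t)%C - f (a +i* t)%C).
Proof. by move=> ab cd /bdif_ctn[]// *; split; exact: ctnB. Qed.

Lemma rintB f g a b c d : a <= b -> c <= d -> bdif f a b c d -> bdif g a b c d ->
  rint (fun z => f z - g z) a b c d = rint f a b c d - rint g a b c d.
Proof.
move=> ab cd F G; have [F1 F2] := bdif_ctnB ab cd F.
have [G1 G2] := bdif_ctnB ab cd G.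
rewrite /rint opprD addrACA -mulrBr -!cintB//; congr (_ + _ * _);
  by apply: cint_ext => t _; ring.
Qed.

Lemma rintZ k f a b c d : a <= b -> c <= d -> bdif f a b c d ->
  rint (fun z => k * f z) a b c d = k * rint f a b c d.
Proof.
move=> ab cd F; have [F1 F2] := bdif_ctnB ab cd F.
rewrite /rint mulrDr mulrCA -(cintZ _ F1) -(cintZ _ F2).
by congr (_ + _ * _); apply: cint_ext => t _; rewrite mulrBr.
Qed.

Lemma rint_ext f g a b c d : a <= b -> c <= d ->
  (forall z, onb a b c d z -> f z = g z) -> rint f a b c d = rint g a b c d.
Proof.
move=> ab cd H; congr (_ + _ * _); apply: cint_ext => t /andP[t1 t2];
  by rewrite !H// /onb /inr /= ?t1 ?t2 ?lexx ?ab ?cd ?eqxx ?orbT.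
Qed.

Lemma rint_aff (l k : C) a b c d : a <= b -> c <= d ->
  rint (fun z => l * z + k) a b c d = 0.
Proof.
move=> ab cd; rewrite /rint.
rewrite (@cint_ext _ _ _ _ (fun=> l * (0 +i* (c - d))%C)); last first.
  move=> t _; rewrite opprD addrACA subrr addr0 -mulrBr; congr (_ * _).
  by congr (_ +i* _)%C; rewrite /= ?subrr.
rewrite (@cint_ext _ c d _ (fun=> l * (b - a)%:C%C)); last first.
  move=> t _; rewrite opprD addrACA subrr addr0 -mulrBr; congr (_ * _).
  by congr (_ +i* _)%C; rewrite /= ?subrr.
rewrite !cint_cst// !(mulrCA _ l) -mulrDr.
rewrite (_ : _ + _ = 0) ?mulr0//; apply/eqP; rewrite eq_complex /=.
by apply/andP; split; apply/eqP; ring.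
Qed.

Lemma cint_pt a (phi : R -> C) : ctn a a phi -> cint a a phi = 0.
Proof.
move=> /(cint_split (lexx a) (lexx a)) /eqP.
by rewrite -subr_eq0 opprD addNKr oppr_eq0 => /eqP.
Qed.

(** On a degenerate rectangle opposite edges cancel. A nonzero integral thus guarantees room for the
    cuts chosen later inside the rectangle. *)
Lemma rint_flat f a b c d : a <= b -> c <= d -> bdif f a b c d ->
  rint f a b c d != 0 -> a < b /\ c < d.
Proof.
move=> ab cd F r0; have [F1 F2] := bdif_ctnB ab cd F.
split; rewrite lt_neqAle; apply/andP; split=> //; apply: contra_neq r0 => E;
  rewrite /rint; subst.
- rewrite cint_pt// (@cint_ext _ c d _ (fun=> 0)) ?cint_cst ?mulr0 ?addr0//.
  by move=> t _; rewrite subrr.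
- rewrite [X in _ * X]cint_pt// (@cint_ext _ a b _ (fun=> 0)) ?cint_cst ?mulr0 ?addr0//.
  by move=> t _; rewrite subrr.
Qed.

Lemma bdif_h f a m b c d : a <= m -> m <= b ->
  bdif f a m c d -> bdif f m b c d -> bdif f a b c d.
Proof.
move=> am mb F G z /andP[/and4P[z1 z2 z3 z4] zz]; have [zm|zm] := leP (Re z) m.
  apply: F; rewrite /onb /inr z1 zm z3 z4 /=.
  move: zz => /or4P[->|/eqP zb|->|->]; rewrite ?orbT//.
  have -> : Re z == m by rewrite eq_le zm zb mb.
  by rewrite ?orbT.
apply: G; rewrite /onb /inr (ltW zm) z2 z3 z4 /=.
move: zz => /or4P[/eqP za|->|->|->]; rewrite ?orbT//.
by move: zm; rewrite za ltNge am.
Qed.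

Lemma bdif_v f a b c m d : c <= m -> m <= d ->
  bdif f a b c m -> bdif f a b m d -> bdif f a b c d.
Proof.
move=> cm md F G z /andP[/and4P[z1 z2 z3 z4] zz]; have [zm|zm] := leP (Im z) m.
  apply: F; rewrite /onb /inr z1 z2 z3 zm /=.
  move: zz => /or4P[->|->|->|/eqP zd]; rewrite ?orbT//.
  have -> : Im z == m by rewrite eq_le zm zd md.
  by rewrite ?orbT.
apply: G; rewrite /onb /inr (ltW zm) z1 z2 z4 /=.
move: zz => /or4P[->|->|/eqP zc|->]; rewrite ?orbT//.
by move: zm; rewrite zc ltNge cm.
Qed.

Lemma rint_split_h f a m b c d : a <= m -> m <= b -> c <= d ->
  bdif f a m c d -> bdif f m b c d ->
  rint f a b c d = rint f a m c d + rint f m b c d.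
Proof.
move=> am mb cd F G.
have [F1 F2 F3 F4] := bdif_ctn am cd F; have [G1 G2 G3 G4] := bdif_ctn mb cd G.
have [H1 H2] := bdif_ctnB (le_trans am mb) cd (bdif_h am mb F G).
rewrite /rint (cint_split am mb H1) addrACA -mulrDr; congr (_ + _ * _).
rewrite -cintD; [|exact: ctnB..].
by apply: cint_ext => t _; ring.
Qed.

Lemma rint_split_v f a b c m d : a <= b -> c <= m -> m <= d ->
  bdif f a b c m -> bdif f a b m d ->
  rint f a b c d = rint f a b c m + rint f a b m d.
Proof.
move=> ab cm md F G.
have [F1 F2 F3 F4] := bdif_ctn ab cm F; have [G1 G2 G3 G4] := bdif_ctn ab md G.
have [H1 H2] := bdif_ctnB ab (le_trans cm md) (bdif_v cm md F G).
rewrite /rint (cint_split cm md H2) mulrDr [RHS]addrACA; congr (_ + _).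
rewrite -cintD; [|exact: ctnB..].
by apply: cint_ext => t _; ring.
Qed.

Lemma rint_quarter f a x b c y d : a <= x -> x <= b -> c <= y -> y <= d ->
  bdif f a x c y -> bdif f a x y d -> bdif f x b c y -> bdif f x b y d ->
  rint f a b c d = rint f a x c y + rint f a x y d + (rint f x b c y + rint f x b y d).
Proof.
move=> ax xb cy yd F1 F2 F3 F4; have cd := le_trans cy yd.
rewrite (rint_split_h ax xb cd (bdif_v cy yd F1 F2) (bdif_v cy yd F3 F4)).
by rewrite (rint_split_v ax cy yd F1 F2) (rint_split_v xb cy yd F3 F4).
Qed.

Lemma rint_center f a x1 x2 b c y1 y2 d :
  a <= x1 -> x1 <= x2 -> x2 <= b -> c <= y1 -> y1 <= y2 -> y2 <= d ->
  bdif f a x1 c d -> bdif f x1 x2 c y1 -> bdif f x1 x2 y1 y2 -> bdif f x1 x2 y2 d ->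
  bdif f x2 b c d ->
  rint f a b c d = rint f a x1 c d + rint f x2 b c d + rint f x1 x2 c y1 +
     rint f x1 x2 y2 d + rint f x1 x2 y1 y2.
Proof.
move=> h1 h2 h3 h4 h5 h6 F1 F2 F3 F4 F5.
have c2 := le_trans h5 h6; have c1 := le_trans h4 c2; have c3 := le_trans h2 h3.
have G1 := bdif_v h5 h6 F3 F4; have G2 := bdif_v h4 c2 F2 G1.
rewrite (rint_split_h h1 c3 c1 F1 (bdif_h h2 h3 G2 F5)) (rint_split_h h2 h3 c1 G2 F5).
by rewrite (rint_split_v h2 h4 c2 F2 G1) (rint_split_v h2 h5 h6 F3 F4); ring.
Qed.

Definition per f a b c d : R :=
  \int[mu]_(t in `[a, b]) cn (f (t +i* c)%C) +
  \int[mu]_(t in `[a, b]) cn (f (t +i* d)%C) +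
  (\int[mu]_(t in `[c, d]) cn (f (a +i* t)%C) +
   \int[mu]_(t in `[c, d]) cn (f (b +i* t)%C)).

Lemma cn_i : cn (0 +i* 1 : C)%C = 1.
Proof. by rewrite /cn /= normr0 normr1 add0r. Qed.

Lemma rint_per f a b c d : a <= b -> c <= d -> bdif f a b c d ->
  cn (rint f a b c d) <= per f a b c d.
Proof.
move=> ab cd /bdif_ctn[]// h1 h2 h3 h4.
rewrite /rint !cintB// (le_trans (cnD _ _))// /per.
have := cnB (cint a b (fun t => f (t +i* c)%C)) (cint a b (fun t => f (t +i* d)%C)).
have := cnM (0 +i* 1)%C (cint c d (fun t => f (b +i* t)%C) - cint c d (fun t => f (a +i* t)%C)).
have := cnB (cint c d (fun t => f (b +i* t)%C)) (cint c d (fun t => f (a +i* t)%C)).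
rewrite cn_i mul1r.
by have := cint_le h1; have := cint_le h2; have := cint_le h3; have := cint_le h4; lra.
Qed.

Lemma rint_bound f a b c d M : a <= b -> c <= d -> bdif f a b c d ->
  (forall z, onb a b c d z -> cn (f z) <= M) ->
  cn (rint f a b c d) <= 2 * M * ((b - a) + (d - c)).
Proof.
move=> ab cd F B; have [h1 h2] := bdif_ctnB ab cd F.
rewrite /rint (le_trans (cnD _ _))// mulrDr lerD//.
  rewrite mulrC; apply: cint_bound => // t /andP[t1 t2].
  rewrite (le_trans (cnB _ _))// mulrDl !mul1r lerD// B// /onb /inr /=;
  by rewrite ?t1 ?t2 ?lexx ?ab ?cd ?eqxx ?orbT.
rewrite (le_trans (cnM _ _))// cn_i mul1r mulrC; apply: cint_bound => // t /andP[t1 t2].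
rewrite (le_trans (cnB _ _))// mulrDl !mul1r lerD// B// /onb /inr /=;
by rewrite ?t1 ?t2 ?lexx ?ab ?cd ?eqxx ?orbT.
Qed.

Lemma shrink_lt (q w e : R) : 0 < e -> 0 <= q < 1 -> exists k : nat, q ^+ k * w < e.
Proof.
move=> e0 /andP[q0 q1].
have /cvgrPdist_lt /(_ e e0) [k _ /(_ k (leqnn k))] : geometric w q @ \oo --> (0 : R).
  by apply: cvg_geometric; rewrite ger0_norm.
rewrite /= sub0r normrN => h; exists k; rewrite mulrC.
exact: le_lt_trans (ler_norm _) h.
Qed.

(** The ratio is 2/3 rather than 1/2 so that a cut may be moved off countably many forbidden
    coordinates. The property [B] depends on the stage because the [k]-th step may have to deal with
    the [k]-th exceptional point. *)
Lemma nested_rects (B : nat -> R -> R -> R -> R -> Prop) a b c d :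
  a <= b -> c <= d -> B 0%N a b c d ->
  (forall k a b c d, a <= b -> c <= d -> B k a b c d ->
    exists a' b' c' d', [/\ [/\ a <= a', a' <= b', b' <= b & b' - a' <= 2/3 * (b - a)],
      [/\ c <= c', c' <= d', d' <= d & d' - c' <= 2/3 * (d - c)] & B k.+1 a' b' c' d']) ->
  exists p, forall k, exists a' b' c' d', [/\ B k a' b' c' d', inr a' b' c' d' p,
     b' - a' <= (2/3) ^+ k * (b - a) & d' - c' <= (2/3) ^+ k * (d - c)].
Proof.
move=> ab cd B0 HB.
pose T : Type := (R * R * R * R)%type.
pose ok (k : nat) (x : T) := [/\ x.1.1.1 <= x.1.1.2, x.1.2 <= x.2 & B k x.1.1.1 x.1.1.2 x.1.2 x.2].
pose nx (x y : T) := [/\ x.1.1.1 <= y.1.1.1, y.1.1.2 <= x.1.1.2 &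
   y.1.1.2 - y.1.1.1 <= 2/3 * (x.1.1.2 - x.1.1.1)] /\
   [/\ x.1.2 <= y.1.2, y.2 <= x.2 & y.2 - y.1.2 <= 2/3 * (x.2 - x.1.2)].
(* A total step function for the recursion; on data violating [ok] it stands still. *)
have /choice[F HF] : forall kx : nat * T, exists y : T, ok kx.1 kx.2 -> ok kx.1.+1 y /\ nx kx.2 y.
  move=> [k x]; have [okx|] := pselect (ok k x); last by exists x.
  case: (okx) => x1 x2 x3.
  have [a' [b' [c' [d' [[h1 h2 h3 h4] [h5 h6 h7 h8] h9]]]]] := HB k _ _ _ _ x1 x2 x3.
  by exists (a', b', c', d') => _; split; split=> //; split.
pose S := fix S (k : nat) : T := if k is k'.+1 then F (k', S k') else (a, b, c, d).
have okS k : ok k (S k).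
  by elim: k => [|k IH] //=; have [] := HF (k, S k) IH.
have nxS k : nx (S k) (S k.+1) by have [] := HF (k, S k) (okS k).
pose A k := (S k).1.1.1; pose A' k := (S k).1.1.2.
pose D k := (S k).1.2; pose D' k := (S k).2.
have mono (u v : nat -> R) : (forall k, u k <= u k.+1) -> (forall k, v k.+1 <= v k) ->
    (forall k, u k <= v k) -> forall k, u k <= sup (range u) <= v k.
  move=> u1 v1 uv k.
  have ui : {homo u : m n / (m <= n)%N >-> m <= n}.
    by apply: homo_leq => //; exact: le_trans.
  have vi : {homo v : m n / (m <= n)%N >-> n <= m}.
    by apply: homo_leq => // x y z; exact: (fun h1 h2 => le_trans h2 h1).
  have ub j : ubound (range u) (v j).
    move=> _ [i _ <-]; have [ij|/ltnW ji] := leqP i j.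
      by rewrite (le_trans (ui _ _ ij)).
    by rewrite (le_trans (uv i))// vi.
  apply/andP; split; first by apply: ub_le_sup; [exists (v 0%N)|exists k].
  by apply: ge_sup => //; exists (u 0%N), 0%N.
have wid : forall k, A' k - A k <= (2/3) ^+ k * (b - a) /\ D' k - D k <= (2/3) ^+ k * (d - c).
  elim=> [|k [IH1 IH2]]; first by rewrite !expr0 !mul1r.
  have [[_ _ h1] [_ _ h2]] := nxS k; split.
    by rewrite exprS -mulrA (le_trans h1)// ler_wpM2l.
  by rewrite exprS -mulrA (le_trans h2)// ler_wpM2l.
exists (sup (range A) +i* sup (range D))%C => k.
exists (A k), (A' k), (D k), (D' k); split; [by case: (okS k)| |by case: (wid k)|by case: (wid k)].
have /andP[? ?] : A k <= sup (range A) <= A' k.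
  by apply: mono => j; [case: (nxS j) => -[]|case: (nxS j) => -[]|case: (okS j)].
have /andP[? ?] : D k <= sup (range D) <= D' k.
  by apply: mono => j; [case: (nxS j) => _ []|case: (nxS j) => _ []|case: (okS j)].
by apply/and4P; split.
Qed.

Lemma inr_cn a b c d p w : inr a b c d p -> inr a b c d w ->
  cn (w - p) <= (b - a) + (d - c).
Proof.
case: p w => [p1 p2] [w1 w2] /and4P[/= ? ? ? ?] /and4P[/= ? ? ? ?].
by rewrite /cn /= lerD// ler_norml; apply/andP; split; lra.
Qed.

Lemma goursat f a b c d : a <= b -> c <= d ->
  (forall z, inr a b c d z -> cdif f z) -> rint f a b c d = 0.
Proof.
move=> ab cd F; apply/eqP/negPn/negP => I0.
have sub a' b' c' d' : a <= a' -> b' <= b -> c <= c' -> d' <= d ->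
    forall z, inr a' b' c' d' z -> cdif f z.
  move=> ? ? ? ? z /and4P[? ? ? ?]; apply: F.
  by apply/and4P; split; lra.
have bsub a' b' c' d' : a <= a' -> b' <= b -> c <= c' -> d' <= d ->
    bdif f a' b' c' d'.
  by move=> h1 h2 h3 h4 z /andP[+ _]; exact: sub.
have [ab' cd'] := rint_flat ab cd (bsub a b c d (lexx _) (lexx _) (lexx _) (lexx _)) I0.
pose m := cn (rint f a b c d); pose s := (b - a) + (d - c).
have m0 : 0 < m by exact: cn_gt0.
have s0 : 0 < s by rewrite /s; lra.
(* The final 1/2 makes the inequality of [B] strict for the full rectangle. It is inherited by some
   quarter: the half perimeter halves, its square shrinks by 4, and the four integrals add up. *)
pose e1 := m / s ^+ 2 / 2.
have e10 : 0 < e1 by rewrite !divr_gt0// exprn_gt0.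
pose B (k : nat) a' b' c' d' := [/\ a <= a', b' <= b, c <= c', d' <= d &
  e1 * ((b' - a') + (d' - c')) ^+ 2 < cn (rint f a' b' c' d')].
have [|k a' b' c' d' h1 h2 [h3 h4 h5 h6 h7]|p Hp] := @nested_rects B a b c d ab cd.
- split=> //; rewrite -/s -/m (_ : e1 * s ^+ 2 = m / 2); first by lra.
  by rewrite /e1; field; rewrite gt_eqF.
- pose x := (a' + b') / 2; pose y := (c' + d') / 2.
  have xa : a' <= x by rewrite /x; lra.
  have xb : x <= b' by rewrite /x; lra.
  have yc : c' <= y by rewrite /y; lra.
  have yd : y <= d' by rewrite /y; lra.
  have bd a1 b1 c1 d1 : a' <= a1 -> b1 <= b' -> c' <= c1 -> d1 <= d' -> bdif f a1 b1 c1 d1.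
    by move=> ? ? ? ?; apply: bsub; lra.
  apply: contrapT => H.
  have sm a1 b1 c1 d1 : a' <= a1 -> a1 <= b1 -> b1 <= b' -> c' <= c1 -> c1 <= d1 -> d1 <= d' ->
     b1 - a1 = (b' - a') / 2 -> d1 - c1 = (d' - c') / 2 ->
     cn (rint f a1 b1 c1 d1) <= e1 * ((b' - a') + (d' - c')) ^+ 2 / 4.
    move=> *; rewrite leNgt; apply/negP => K; apply: H; exists a1, b1, c1, d1.
    split; [by split=> //; lra|by split=> //; lra|split; [lra..|]].
    apply: le_lt_trans K; rewrite (_ : b1 - a1 + (d1 - c1) = ((b' - a') + (d' - c')) / 2); last lra.
    by rewrite le_eqVlt; apply/orP; left; apply/eqP; field.
  move: h7; rewrite (@rint_quarter f a' x b' c' y d')//; [|exact: bd..].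
  set i1 := rint _ _ _ _ _; set i2 := rint _ _ _ _ _; set i3 := rint _ _ _ _ _.
  set i4 := rint _ _ _ _ _.
  have := cnD (i1 + i2) (i3 + i4); have := cnD i1 i2; have := cnD i3 i4.
  have : cn i1 <= e1 * ((b' - a') + (d' - c')) ^+ 2 / 4 by apply: sm => //; rewrite /x /y; lra.
  have : cn i2 <= e1 * ((b' - a') + (d' - c')) ^+ 2 / 4 by apply: sm => //; rewrite /x /y; lra.
  have : cn i3 <= e1 * ((b' - a') + (d' - c')) ^+ 2 / 4 by apply: sm => //; rewrite /x /y; lra.
  have : cn i4 <= e1 * ((b' - a') + (d' - c')) ^+ 2 / 4 by apply: sm => //; rewrite /x /y; lra.
  by set E := e1 * _; lra.
have pR : inr a b c d p.
  have [a' [b' [c' [d' [[? ? ? ? ?] /and4P[? ? ? ?] _ _]]]]] := Hp 0%N.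
  by apply/and4P; split; lra.
have [L Lp] := F p pR; have LE := fun u => isd_lin1 u Lp.
have [_ _ /(_ (e1 / 2))[|r r0 Hr]] := Lp; first by rewrite divr_gt0.
have [k hk] := @shrink_lt (2/3) s r r0 ltac:(lra).
have [a' [b' [c' [d' [[h1 h2 h3 h4 h5] pk w1 w2]]]]] := Hp k.
have [h6 h7] : a' <= b' /\ c' <= d' by case/and4P: pk => *; split; lra.
have sk : (b' - a') + (d' - c') < r.
  by apply: le_lt_trans hk; rewrite /s mulrDr lerD.
(* Subtracting the tangent function at [p] does not change the integral, by [rint_aff]. The
   remainder on the boundary is at most [e1 / 2] times half the perimeter, which contradicts the
   lower bound in [B]. *)
pose g w := L 1 * w + (f p - L 1 * p).
have gd w : cdif g w.
  by apply: cdifD; [exact/cdif_scale/cdif_id|exact: cdif_cst].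
have fb : bdif f a' b' c' d' by exact: bsub.
move: h5; rewrite -[rint f _ _ _ _]subr0 -(rint_aff (L 1) (f p - L 1 * p) h6 h7).
rewrite -/g -rintB// => h5.
suff : cn (rint (fun z => f z - g z) a' b' c' d') <=
    2 * (e1 / 2 * ((b' - a') + (d' - c'))) * ((b' - a') + (d' - c')).
  rewrite (_ : 2 * _ * _ = e1 * (b' - a' + (d' - c')) ^+ 2); last by field.
  by rewrite leNgt h5.
apply: rint_bound => // [w wb|w /andP[wr _]].
  by apply: cdifB; [exact: fb|exact: gd].
have wp := inr_cn pk wr.
have := Hr w (le_lt_trans wp sk); rewrite LE.
have -> : f w - f p - (w - p) * L 1 = f w - g w by rewrite /g; ring.
by move=> h; rewrite (le_trans h)// ler_wpM2l//; lra.
Qed.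

(** The sense in which an exceptional point is harmless. The sequences [X] and [Y] let the edges
    dodge the coordinates of all other exceptional points, so that the pieces around the small
    rectangle again have clean boundaries. *)
Definition vanish f p := forall (e dl : R) (X Y : nat -> R), 0 < e -> 0 < dl ->
  exists x1 x2 y1 y2, [/\ [/\ Re p - dl < x1, x1 < Re p, Re p < x2 & x2 < Re p + dl],
    [/\ Im p - dl < y1, y1 < Im p, Im p < y2 & y2 < Im p + dl],
    (forall k, [/\ x1 != X k, x2 != X k, y1 != Y k & y2 != Y k]) &
    bdif f x1 x2 y1 y2 /\ per f x1 x2 y1 y2 < e].

Definition opn (O : set C) := forall z, O z -> exists2 r : R, 0 < r &
  forall w, cn (w - z) < r -> O w.

Lemma inr_sub a b c d a' b' c' d' z : a <= a' -> b' <= b -> c <= c' -> d' <= d ->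
  inr a' b' c' d' z -> inr a b c d z.
Proof. by move=> ? ? ? ? /and4P[? ? ? ?]; apply/and4P; split; lra. Qed.

(** Each side of the inner rectangle lies either on a side of the outer one, whose points are in
    [O], or on a line whose coordinate belongs to no exceptional point. *)
Lemma onb_sub (O : set C) (sing : nat -> C) a b c d a' b' c' d' :
  (forall z, inr a b c d z -> O z \/ exists k, z = sing k) ->
  (forall z, onb a b c d z -> O z) ->
  a <= a' -> b' <= b -> c <= c' -> d' <= d ->
  a' = a \/ (forall k, a' != Re (sing k)) -> b' = b \/ (forall k, b' != Re (sing k)) ->
  c' = c \/ (forall k, c' != Im (sing k)) -> d' = d \/ (forall k, d' != Im (sing k)) ->
  forall z, onb a' b' c' d' z -> O z.
Proof.
move=> HO Hb h1 h2 h3 h4 ha hb hc hd z /andP[zr zb].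
have zR := inr_sub h1 h2 h3 h4 zr.
have key (P : C -> R) v v' : (P z == v -> onb a b c d z) -> P z == v' ->
    v' = v \/ (forall k, v' != P (sing k)) -> O z.
  move=> K /eqP zv [vv|vk]; first by apply: Hb; apply: K; rewrite zv vv.
  have [//|[k zk]] := HO z zR; have := vk k.
  by rewrite -zv zk eqxx.
case/or4P: zb => E.
- by apply: (key _ _ _ _ E ha) => E'; rewrite /onb zR E' ?orbT.
- by apply: (key _ _ _ _ E hb) => E'; rewrite /onb zR E' ?orbT.
- by apply: (key _ _ _ _ E hc) => E'; rewrite /onb zR E' ?orbT.
- by apply: (key _ _ _ _ E hd) => E'; rewrite /onb zR E' ?orbT.
Qed.

Section Exceptional.
Variables (f : C -> C) (O : set C) (sing : nat -> C) (a b c d : R).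
Hypothesis fO : forall z, O z -> cdif f z.
Hypothesis HO : forall z, inr a b c d z -> O z \/ exists k, z = sing k.
Hypothesis Hb : forall z, onb a b c d z -> O z.
Hypothesis I0 : rint f a b c d != 0.

Let side (P : C -> R) e0 e := e = e0 \/ (forall k, e != P (sing k)).

Let piece a' b' c' d' := a <= a' -> b' <= b -> c <= c' -> d' <= d ->
  side Re a a' -> side Re b b' -> side Im c c' -> side Im d d' ->
  (forall z, onb a' b' c' d' z -> O z) /\ bdif f a' b' c' d'.

Let pieceP a' b' c' d' : piece a' b' c' d'.
Proof.
move=> h1 h2 h3 h4 h5 h6 h7 h8.
have H := onb_sub HO Hb h1 h2 h3 h4 h5 h6 h7 h8.
by split=> // z /H; exact: fO.
Qed.

(** The two cuts run through the middle thirds, at coordinates of no exceptional point. By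
    additivity one of the four pieces keeps a nonzero integral. *)
Lemma rint_halve : a <= b -> c <= d -> exists a' b' c' d',
  [/\ [/\ a <= a', a' <= b', b' <= b & b' - a' <= 2/3 * (b - a)],
      [/\ c <= c', c' <= d', d' <= d & d' - c' <= 2/3 * (d - c)],
      rint f a' b' c' d' != 0 & forall z, onb a' b' c' d' z -> O z].
Proof.
move=> ab0 cd0.
have [ab cd] := rint_flat ab0 cd0 (fun z h => fO (Hb h)) I0.
have [x /andP[x1 x2] xS] := @avoid_countable (a + (b - a) / 3) (b - (b - a) / 3)
  (fun k => Re (sing k)) ltac:(lra).
have [y /andP[y1 y2] yS] := @avoid_countable (c + (d - c) / 3) (d - (d - c) / 3)
  (fun k => Im (sing k)) ltac:(lra).
have ax : a <= x by lra. have xb : x <= b by lra.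
have cy : c <= y by lra. have yd : y <= d by lra.
have wa : x - a <= 2/3 * (b - a) by lra. have wb : b - x <= 2/3 * (b - a) by lra.
have wc : y - c <= 2/3 * (d - c) by lra. have wd : d - y <= 2/3 * (d - c) by lra.
move: ab0 cd0 {x1 x2 y1 y2 ab cd} => ab cd.
have Lx P e : side P e e by left.
have Sx e : side Re e x by right. have Sy e : side Im e y by right.
have [p1 q1] := @pieceP a x c y (lexx _) xb (lexx _) yd (Lx _ _) (Sx _) (Lx _ _) (Sy _).
have [p2 q2] := @pieceP a x y d (lexx _) xb cy (lexx _) (Lx _ _) (Sx _) (Sy _) (Lx _ _).
have [p3 q3] := @pieceP x b c y ax (lexx _) (lexx _) yd (Sx _) (Lx _ _) (Lx _ _) (Sy _).
have [p4 q4] := @pieceP x b y d ax (lexx _) cy (lexx _) (Sx _) (Lx _ _) (Sy _) (Lx _ _).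
apply: contrapT => H; move: I0; rewrite (rint_quarter ax xb cy yd q1 q2 q3 q4).
have -> : rint f a x c y = 0.
  by apply: contrapT => /eqP K; apply: H; exists a, x, c, y; split.
have -> : rint f a x y d = 0.
  by apply: contrapT => /eqP K; apply: H; exists a, x, y, d; split.
have -> : rint f x b c y = 0.
  by apply: contrapT => /eqP K; apply: H; exists x, b, c, y; split.
have -> : rint f x b y d = 0.
  by apply: contrapT => /eqP K; apply: H; exists x, b, y, d; split.
by rewrite !addr0 eqxx.
Qed.

(** A small rectangle around [q] is chosen whose boundary integral of [cn f] is below the norm of
    the whole integral. The rest splits into four rectangles missing [q]; if all their integrals
    were zero, the small rectangle would carry the whole integral. *)
Lemma rint_excise q : inr a b c d q -> ~ O q -> vanish f q -> exists a' b' c' d',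
  [/\ [/\ a <= a', a' <= b' & b' <= b], [/\ c <= c', c' <= d' & d' <= d],
      rint f a' b' c' d' != 0 /\ (forall z, onb a' b' c' d' z -> O z) &
      ~~ inr a' b' c' d' q].
Proof.
move=> qr qO vq.
have /norP[q1 /norP[q2 /norP[q3 q4]]] :
    ~~ [|| Re q == a, Re q == b, Im q == c | Im q == d].
  by apply/negP => H; apply/qO/Hb; rewrite /onb qr.
case/and4P: (qr); rewrite !le_eqVlt (eq_sym a) (eq_sym c).
rewrite (negbTE q1) (negbTE q2) (negbTE q3) (negbTE q4) /= => r1 r2 r3 r4.
pose dl := Num.min (Num.min (Re q - a) (b - Re q)) (Num.min (Im q - c) (d - Im q)).
have dl0 : 0 < dl by rewrite !lt_min !subr_gt0 r1 r2 r3.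
have [d1 d2 d3 d4] : [/\ dl <= Re q - a, dl <= b - Re q, dl <= Im q - c & dl <= d - Im q].
  by rewrite /dl; split; rewrite !ge_min lexx ?orbT.
have [x1 [x2 [y1 [y2 [[t1 t2 t3 t4] [t5 t6 t7 t8] t9 [_ t10]]]]]] :=
  vq _ _ (fun k => Re (sing k)) (fun k => Im (sing k)) (cn_gt0 I0) dl0.
have a1 : a <= x1 by lra. have a2 : x1 <= x2 by lra. have a3 : x2 <= b by lra.
have c1 : c <= y1 by lra. have c2 : y1 <= y2 by lra. have c3 : y2 <= d by lra.
move=> {d1 d2 d3 d4 dl0 r1 r2 r3 r4 t1 t4 t5 t8}.
have Lx P e : side P e e by left.
have S1 e : side Re e x1 by right=> k; case: (t9 k).
have S2 e : side Re e x2 by right=> k; case: (t9 k).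
have S3 e : side Im e y1 by right=> k; case: (t9 k).
have S4 e : side Im e y2 by right=> k; case: (t9 k).
have x1b := le_trans a2 a3; have ax2 := le_trans a1 a2.
have y1d := le_trans c2 c3; have cy2 := le_trans c1 c2; have cd := le_trans c1 y1d.
have [p1 q1'] := @pieceP a x1 c d (lexx _) x1b (lexx _) (lexx _) (Lx _ _) (S1 _) (Lx _ _) (Lx _ _).
have [p2 q2'] := @pieceP x2 b c d ax2 (lexx _) (lexx _) (lexx _) (S2 _) (Lx _ _) (Lx _ _) (Lx _ _).
have [p3 q3'] := @pieceP x1 x2 c y1 a1 a3 (lexx _) y1d (S1 _) (S2 _) (Lx _ _) (S3 _).
have [p4 q4'] := @pieceP x1 x2 y2 d a1 a3 cy2 (lexx _) (S1 _) (S2 _) (S4 _) (Lx _ _).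
have [p5 q5'] := @pieceP x1 x2 y1 y2 a1 a3 c1 c3 (S1 _) (S2 _) (S3 _) (S4 _).
apply: contrapT => H; move: t10; rewrite ltNge => /negP; apply.
rewrite (rint_center a1 a2 a3 c1 c2 c3 q1' q3' q5' q4' q2').
have -> : rint f a x1 c d = 0.
  apply: contrapT => /eqP K; apply: H; exists a, x1, c, d; split=> //.
  by rewrite /inr (lt_geF t2) andbF.
have -> : rint f x2 b c d = 0.
  apply: contrapT => /eqP K; apply: H; exists x2, b, c, d; split=> //.
  by rewrite /inr (lt_geF t3).
have -> : rint f x1 x2 c y1 = 0.
  apply: contrapT => /eqP K; apply: H; exists x1, x2, c, y1; split=> //.
  by rewrite /inr (lt_geF t6) !andbF.
have -> : rint f x1 x2 y2 d = 0.
  apply: contrapT => /eqP K; apply: H; exists x1, x2, y2, d; split=> //.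
  by rewrite /inr (lt_geF t7) !andbF.
by rewrite !add0r; exact: rint_per.
Qed.

End Exceptional.

(* Every rectangle with nonzero integral contains a smaller one that avoids the
   k-th exceptional point; the intersection of such a nested sequence is then a
   point of [O], where Goursat's lemma applies. *)
Lemma cauchy_countable f (O : set C) (sing : nat -> C) a b c d :
  a <= b -> c <= d -> opn O -> (forall z, O z -> cdif f z) ->
  (forall z, inr a b c d z -> O z \/ exists k, z = sing k) ->
  (forall z, onb a b c d z -> O z) ->
  (forall k, inr a b c d (sing k) -> O (sing k) \/ vanish f (sing k)) ->
  rint f a b c d = 0.
Proof.
move=> ab cd oO fO HO Hb Hv; apply/eqP/negPn/negP => I0.
pose B (n : nat) a' b' c' d' := [/\ [/\ a <= a', b' <= b, c <= c' & d' <= d],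
  forall z, onb a' b' c' d' z -> O z, rint f a' b' c' d' != 0 &
  forall j, (j < n)%N -> inr a' b' c' d' (sing j) -> O (sing j)].
have [|n a' b' c' d' h1 h2 [[h3 h4 h5 h6] h7 h8 h9]|p Hp] := @nested_rects B a b c d ab cd.
- by split.
- have HO' z : inr a' b' c' d' z -> O z \/ exists k, z = sing k.
    by move=> zr; apply: HO; exact: (inr_sub h3 h4 h5 h6 zr).
  have [a1 [b1 [c1 [d1 [[k1 k2 k3 k4] [k5 k6 k7 k8] k9 k10]]]]] := rint_halve fO HO' h7 h8 h1 h2.
  have h3' := le_trans h3 k1; have h4' := le_trans k3 h4.
  have h5' := le_trans h5 k5; have h6' := le_trans k7 h6.
  have [qO|qO] := pselect (inr a1 b1 c1 d1 (sing n) -> O (sing n)).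
    exists a1, b1, c1, d1; split=> //; split=> // j; rewrite ltnS leq_eqVlt.
    move=> /orP[/eqP -> //|jn] jr; apply: (h9 j jn); exact: (inr_sub k1 k3 k5 k7 jr).
  have [qr qnO] : inr a1 b1 c1 d1 (sing n) /\ ~ O (sing n).
    by apply: contrapT => H; apply: qO => qr; apply: contrapT => h; exact: H.
  have HO1 z : inr a1 b1 c1 d1 z -> O z \/ exists k, z = sing k.
    by move=> zr; apply: HO; exact: (inr_sub h3' h4' h5' h6' zr).
  have [//|vq] := Hv n (inr_sub h3' h4' h5' h6' qr).
  have [a2 [b2 [c2 [d2 [[u1 u2 u3] [u4 u5 u6] [u7 u8] u9]]]]] := rint_excise fO HO1 k10 k9 qr qnO vq.
  exists a2, b2, c2, d2.
  have W (l r l' r' e : R) : l <= l' -> r' <= r -> r - l <= e -> r' - l' <= e by lra.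
  split.
  + by split=> //; [exact: le_trans u1|exact: le_trans k3|exact: W u1 u3 k4].
  + by split=> //; [exact: le_trans u4|exact: le_trans k7|exact: W u4 u6 k8].
  split=> //; first by split; [exact: le_trans u1|exact: le_trans h4'|exact: le_trans u4|exact: le_trans h6'].
  move=> j; rewrite ltnS leq_eqVlt => /orP[/eqP -> /(negP u9)//|jn] jr.
  apply: (h9 j jn); apply: (inr_sub k1 k3 k5 k7); exact: (inr_sub u1 u3 u4 u6 jr).
have pO : O p.
  have pR : inr a b c d p.
    have [a' [b' [c' [d' [[[? ? ? ?] _ _ _] pk _ _]]]]] := Hp 0%N.
    by apply: inr_sub pk.
  have [//|[j pj]] := HO p pR.
  have [a' [b' [c' [d' [[_ _ _ h] pk _ _]]]]] := Hp j.+1.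
  by rewrite pj; apply: (h j) => //; rewrite -pj.
have [r r0 Hr] := oO p pO.
have [k hk] := @shrink_lt (2/3) ((b - a) + (d - c)) r r0 ltac:(lra).
have [a' [b' [c' [d' [[[h1 h2 h3 h4] _ h5 _] pk w1 w2]]]]] := Hp k.
have [h6 h7] : a' <= b' /\ c' <= d'.
  by case/and4P: pk => p1 p2 p3 p4; split; [exact: le_trans p2|exact: le_trans p4].
move/eqP : h5; apply; apply: goursat => // z zr; apply/fO/Hr.
by rewrite (le_lt_trans (inr_cn pk zr))// (le_lt_trans _ hk)// mulrDr lerD.
Qed.

End Rect.

(** * The Cauchy formula on squares *)

Section CauchyFormula.
Variable R : realType.
Local Notation C := R[i].
Local Notation mu := (@lebesgue_measure R).
Local Notation Re := (@complex.Re R).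
Local Notation Im := (@complex.Im R).
Implicit Types (a b c d r s t : R) (f g : C -> C) (z w p q : C).

Lemma Rint_bound a b (g : R -> R) M (phi : R -> C) : a <= b -> ctn a b phi ->
  (forall t, g t = cn (phi t)) -> (forall t, a <= t <= b -> g t <= M) ->
  \int[mu]_(t in `[a, b]) g t <= (b - a) * M.
Proof.
move=> ab H gE B.
have -> : (b - a) * M = \int[mu]_(t in `[a, b]) M.
  rewrite Rintegral_cst//=; rewrite lebesgue_measure_itv/= lte_fin mulrC.
  case: ltP => // ba; congr (_ * _); apply/eqP; rewrite subr_eq0.
  by rewrite eq_le ab ba.
apply: le_Rintegral => //.
  by rewrite (_ : g = cn (R:=R) \o phi); [exact: (ctn_integrable (@cn_lip R))|exact/funext].
apply: (@ctn_integrable R a b (fun=> M%:C%C) Re); first exact: Re_lip.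
exact: ctn_cst.
Qed.

Lemma per_bound f a b c d M : a <= b -> c <= d -> bdif f a b c d ->
  (forall z, onb a b c d z -> cn (f z) <= M) ->
  per f a b c d <= 2 * M * ((b - a) + (d - c)).
Proof.
move=> ab cd F B; have [h1 h2 h3 h4] := bdif_ctn ab cd F.
rewrite /per (_ : 2 * M * _ = ((b - a) * M + (b - a) * M) + ((d - c) * M + (d - c) * M)); last ring.
apply: lerD; apply: lerD.
- apply: (Rint_bound ab h1) => // t /andP[t1 t2]; apply: B.
  by rewrite /onb /inr /= ?t1 ?t2 ?lexx ?ab ?cd ?eqxx ?orbT.
- apply: (Rint_bound ab h2) => // t /andP[t1 t2]; apply: B.
  by rewrite /onb /inr /= ?t1 ?t2 ?lexx ?ab ?cd ?eqxx ?orbT.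
- apply: (Rint_bound cd h3) => // t /andP[t1 t2]; apply: B.
  by rewrite /onb /inr /= ?t1 ?t2 ?lexx ?ab ?cd ?eqxx ?orbT.
- apply: (Rint_bound cd h4) => // t /andP[t1 t2]; apply: B.
  by rewrite /onb /inr /= ?t1 ?t2 ?lexx ?ab ?cd ?eqxx ?orbT.
Qed.

Lemma onb_far p x1 x2 y1 y2 t z :
  x1 <= Re p - t -> Re p + t <= x2 -> y1 <= Im p - t -> Im p + t <= y2 ->
  onb x1 x2 y1 y2 z -> t <= cn (z - p).
Proof.
case: p z => [p1 p2] [z1 z2] /= h1 h2 h3 h4 /andP[_ /or4P[]] /eqP /= E;
  rewrite /cn /=.
- by have := ler_norm (- (z1 - p1)); rewrite normrN; have := normr_ge0 (z2 - p2); lra.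
- by have := ler_norm (z1 - p1); have := normr_ge0 (z2 - p2); lra.
- by have := ler_norm (- (z2 - p2)); rewrite normrN; have := normr_ge0 (z1 - p1); lra.
- by have := ler_norm (z2 - p2); have := normr_ge0 (z1 - p1); lra.
Qed.

Lemma cnB_box p (x1 x2 y1 y2 t : R) z :
  Re p - t <= x1 -> x2 <= Re p + t -> Im p - t <= y1 -> y2 <= Im p + t ->
  inr x1 x2 y1 y2 z -> cn (z - p) <= 2 * t.
Proof.
case: p z => [p1 p2] [z1 z2] /= h1 h2 h3 h4 /and4P[/= k1 k2 k3 k4]; rewrite /cn /=.
have : `|z1 - p1| <= t by rewrite ler_norml; apply/andP; split; lra.
have : `|z2 - p2| <= t by rewrite ler_norml; apply/andP; split; lra.
by lra.
Qed.

(** On a rectangle of size [t] the perimeter is of order [t], so a function that is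
    [o(1 / cn (w - p))] has small boundary integral. *)
Lemma vanish_small_o f p :
  (forall e : R, 0 < e -> exists2 dl : R, 0 < dl & forall w, w != p -> cn (w - p) < dl ->
     cdif f w /\ cn (f w) * cn (w - p) <= e) -> vanish f p.
Proof.
move=> H e dl X Y e0 dl0.
have e1 : 0 < e / 32 by lra.
have [s s0 Hs] := H _ e1.
(* The sides lie at distances between [t] and [2 * t] from [p], so boundary points satisfy
   [t <= cn (z - p) <= 4 * t] and half the perimeter is at most [8 * t]. With [e / 32] the final
   bound is [e / 2]. *)
pose t := Num.min (dl / 4) (s / 8).
have t0 : 0 < t by rewrite lt_min; apply/andP; split; lra.
have td' : t <= dl / 4 by rewrite /t ge_min lexx.
have ts' : t <= s / 8 by rewrite /t ge_min lexx orbT.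
have [td ts] : 4 * t <= dl /\ 8 * t <= s by split; lra.
have [x1 /andP[a1 a2] X1] := @avoid_countable R (Re p - 2 * t) (Re p - t) X ltac:(lra).
have [x2 /andP[a3 a4] X2] := @avoid_countable R (Re p + t) (Re p + 2 * t) X ltac:(lra).
have [y1 /andP[a5 a6] Y1] := @avoid_countable R (Im p - 2 * t) (Im p - t) Y ltac:(lra).
have [y2 /andP[a7 a8] Y2] := @avoid_countable R (Im p + t) (Im p + 2 * t) Y ltac:(lra).
exists x1, x2, y1, y2; split; [split; lra|split; lra|by move=> k; split|].
have far z : onb x1 x2 y1 y2 z -> t <= cn (z - p).
  by apply: onb_far; exact: ltW.
have near z : onb x1 x2 y1 y2 z -> cn (z - p) <= 2 * (2 * t).
  by move=> /andP[zr _]; apply: (cnB_box _ _ _ _ zr); exact: ltW.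
have K z : onb x1 x2 y1 y2 z -> cdif f z /\ cn (f z) * cn (z - p) <= e / 32.
  move=> zb; have := far z zb; have := near z zb => n1 f1.
  apply: Hs; last by lra.
  by apply: contraTneq f1 => ->; rewrite subrr cn0 -ltNge.
have fb : bdif f x1 x2 y1 y2 by move=> z /K[].
have x12 : x1 <= x2 by lra.
have y12 : y1 <= y2 by lra.
split=> //; apply: (@le_lt_trans _ _ (2 * (e / 32 / t) * ((x2 - x1) + (y2 - y1)))).
  apply: per_bound => // z zb; rewrite ler_pdivlMr//.
  have [_ h] := K z zb; apply: le_trans h.
  by rewrite ler_wpM2l ?cn_ge0// far.
have : e / 32 / t * ((x2 - x1) + (y2 - y1)) <= e / 32 / t * (8 * t).
  by rewrite ler_wpM2l//; [rewrite divr_ge0// ltW|lra].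
have -> : e / 32 / t * (8 * t) = e / 4 by field; rewrite gt_eqF.
by rewrite -mulrA; lra.
Qed.

Lemma vanish_bounded f p (dl M : R) : 0 < dl ->
  (forall w, w != p -> cn (w - p) < dl -> cdif f w /\ cn (f w) <= M) -> vanish f p.
Proof.
move=> dl0 H; apply: vanish_small_o => e e0.
have M0 : 0 < `|M| + 1 by rewrite ltr_wpDl.
exists (Num.min dl (e / (`|M| + 1))) => [|w wp]; first by rewrite lt_min dl0 divr_gt0.
rewrite lt_min ltr_pdivlMr// => /andP[/(H w wp)[fw fM] we]; split=> //.
rewrite (le_trans _ (ltW we))// mulrC ler_wpM2l ?cn_ge0//.
by rewrite (le_trans fM)// (le_trans (ler_norm M))// lerDl.
Qed.

Lemma cdif_subq q z : cdif (fun w => w - q) z.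
Proof. by apply: cdifB; [exact: cdif_id|exact: cdif_cst]. Qed.

Lemma cdif_divq f q z : z != q -> cdif f z -> cdif (fun w => f w / (w - q)) z.
Proof. by move=> zq fz; apply: cdif_div => //; [rewrite subr_eq0|exact: cdif_subq]. Qed.

(** Near [p] the kernel is bounded because [p != q]. As [f] itself may be unbounded there, the
    comparison is made edge by edge: a factor [A] on the integral of [cn f], plus a term
    proportional to the length. *)
Lemma vanish_divq f p q k : p != q -> vanish f p ->
  vanish (fun z => (f z - k) / (z - q)) p.
Proof.
move=> pq vf e dl X Y e0 dl0; set rho := cn (p - q).
have rho0 : 0 < rho by rewrite cn_gt0// subr_eq0.
have k0 := cn_ge0 k.
pose A := 4 / rho; have A0 : 0 < A by rewrite divr_gt0.
pose t := Num.min (Num.min dl (rho / 4)) (e / (A * (cn k + 1) * 16)).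
have D0 : 0 < A * (cn k + 1) * 16 by rewrite mulr_gt0// mulr_gt0// ltr_wpDl.
have t0 : 0 < t by rewrite !lt_min dl0 !divr_gt0.
have [t1 t2 t3] : [/\ t <= dl, 4 * t <= rho & t * (A * (cn k + 1) * 16) <= e].
  split; first by rewrite /t !ge_min lexx.
    by have tr : t <= rho / 4; [rewrite /t !ge_min lexx ?orbT|lra].
  by rewrite -ler_pdivlMr// /t ge_min lexx orbT.
have e10 : 0 < e / 2 / A by rewrite !divr_gt0.
have [x1 [x2 [y1 [y2 [[a1 a2 a3 a4] [a5 a6 a7 a8] a9 [fb fp]]]]]] := vf _ _ X Y e10 t0.
exists x1, x2, y1, y2; split=> //; [by split=> //; lra|by split=> //; lra|].
have near z : onb x1 x2 y1 y2 z -> rho / 2 <= cn (z - q).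
  move=> /andP[zr _]; have : cn (z - p) <= 2 * t by apply: (cnB_box _ _ _ _ zr); exact: ltW.
  have -> : z - q = (p - q) - (p - z) by ring.
  by have := cnD (p - q - (p - z)) (p - z); rewrite subrK -/rho (cn_sym p z); lra.
have zq z : onb x1 x2 y1 y2 z -> z != q.
  by move=> /near; apply: contraTneq => ->; rewrite subrr cn0 -ltNge; lra.
have gb : bdif (fun z => (f z - k) / (z - q)) x1 x2 y1 y2.
  move=> z zb; apply: cdif_divq; first exact: zq.
  by apply: cdifB; [exact: fb|exact: cdif_cst].
split=> //.
have x12 : x1 <= x2 by lra.
have y12 : y1 <= y2 by lra.
have [h1 h2 h3 h4] := bdif_ctn x12 y12 fb; have [g1 g2 g3 g4] := bdif_ctn x12 y12 gb.
have gf z : onb x1 x2 y1 y2 z -> cn ((f z - k) / (z - q)) <= A * (cn (f z) + cn k).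
  move=> zb; rewrite (le_trans (cnM _ _))// mulrC ler_pM ?cn_ge0 ?cnB//.
  rewrite (le_trans (cnV _)) ?subr_eq0 ?zq// ler_pdivrMr; last first.
    by have := near z zb; lra.
  by have := near z zb; rewrite /A mulrAC ler_pdivlMr//; lra.
have J u v (P Q : R -> C) : u <= v -> ctn u v P -> ctn u v Q ->
    (forall t, u <= t <= v -> cn (Q t) <= A * (cn (P t) + cn k)) ->
    \int[mu]_(t in `[u, v]) cn (Q t) <= A * \int[mu]_(t in `[u, v]) cn (P t) + A * cn k * (v - u).
  move=> uv cP cQ PQ; have IP := ctn_integrable (@cn_lip R) cP.
  have IQ := ctn_integrable (@cn_lip R) cQ.
  have IA : mu.-integrable `[u, v] (EFin \o (fun t => A * cn (P t))).
    have I2 := @integrableZl _ _ R mu _ (measurable_itv _) A _ IP.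
    exact: eq_integrable I2.
  have Ik : mu.-integrable `[u, v] (EFin \o (fun=> A * cn k)).
    apply: (@ctn_integrable R u v (fun=> (A * cn k)%:C%C) Re); first exact: Re_lip.
    exact: ctn_cst.
  rewrite -RintegralZl//.
  have -> : A * cn k * (v - u) = \int[mu]_(t in `[u, v]) (A * cn k).
    rewrite Rintegral_cst//=; rewrite lebesgue_measure_itv/= lte_fin.
    case: ltP => // vu; congr (_ * _); apply/eqP; rewrite subr_eq0.
    by rewrite eq_le uv vu.
  rewrite -RintegralD//; apply: le_Rintegral => //.
    have I3 := @integrableD _ _ R mu _ (measurable_itv _) _ _ IA Ik.
    exact: eq_integrable I3.
  by move=> s; rewrite /= in_itv /= => /PQ; rewrite mulrDr.
have b1 : forall t, x1 <= t <= x2 -> onb x1 x2 y1 y2 (t +i* y1)%C /\ onb x1 x2 y1 y2 (t +i* y2)%C.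
  by move=> s /andP[s1 s2]; rewrite /onb /inr /= s1 s2 y12 !lexx !eqxx !orbT.
have b2 : forall t, y1 <= t <= y2 -> onb x1 x2 y1 y2 (x1 +i* t)%C /\ onb x1 x2 y1 y2 (x2 +i* t)%C.
  by move=> s /andP[s1 s2]; rewrite /onb /inr /= s1 s2 x12 !lexx !eqxx !orbT.
have Ak0 : 0 <= A * cn k by rewrite mulr_ge0// ltW.
have k1 : A * cn k * (x2 - x1) <= A * cn k * (2 * t) by rewrite ler_wpM2l//; lra.
have k2 : A * cn k * (y2 - y1) <= A * cn k * (2 * t) by rewrite ler_wpM2l//; lra.
have k3 : A * cn k * t < e / 16.
  have At : 0 < A * t by rewrite mulr_gt0.
  rewrite ltr_pdivlMr//; apply: lt_le_trans t3.
  by rewrite [ltRHS](_ : _ = A * cn k * t * 16 + A * t * 16); [lra|ring].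
have k4 : A * per f x1 x2 y1 y2 < e / 2 by rewrite mulrC -ltr_pdivlMr.
have fin (i1 i2 i3 i4 j1 j2 j3 j4 : R) : A * (i1 + i2 + (i3 + i4)) < e / 2 ->
    j1 <= A * i1 + A * cn k * (x2 - x1) -> j2 <= A * i2 + A * cn k * (x2 - x1) ->
    j3 <= A * i3 + A * cn k * (y2 - y1) -> j4 <= A * i4 + A * cn k * (y2 - y1) ->
    j1 + j2 + (j3 + j4) < e.
  move: (A * cn k) k1 k2 k3 => Ak k1 k2 k3; rewrite !mulrDr.
  by clear -k1 k2 k3; lra.
apply: (fin _ _ _ _ _ _ _ _ k4 (J _ _ _ _ x12 h1 g1 (fun t ht => gf _ (b1 t ht).1))
  (J _ _ _ _ x12 h2 g2 (fun t ht => gf _ (b1 t ht).2))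
  (J _ _ _ _ y12 h3 g3 (fun t ht => gf _ (b2 t ht).1))
  (J _ _ _ _ y12 h4 g4 (fun t ht => gf _ (b2 t ht).2))).
Qed.

Definition sq r z := inr (- r) r (- r) r z.
Definition sqb r z := onb (- r) r (- r) r z.
Definition sint f r := rint f (- r) r (- r) r.
(** The winding integral. Instead of the value 2 pi i, the lower bound in [W_lb] is used, and
    formulas are divided by [W r q]. *)
Definition W r q := sint (fun z => (z - q)^-1) r.

Lemma Re_cint_lb a b (phi : R -> C) m : a <= b -> ctn a b phi ->
  (forall t, a <= t <= b -> m <= Re (phi t)) -> (b - a) * m <= Re (cint a b phi).
Proof.
move=> ab H B.
have -> : (b - a) * m = \int[mu]_(t in `[a, b]) m.
  rewrite Rintegral_cst//=; rewrite lebesgue_measure_itv/= lte_fin mulrC.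
  case: ltP => // ba; congr (_ * _); apply/eqP; rewrite subr_eq0.
  by rewrite eq_le ab ba.
apply: le_Rintegral => //; last exact: (ctn_integrable (@Re_lip R)).
apply: (@ctn_integrable R a b (fun=> m%:C%C) Re); first exact: Re_lip.
exact: ctn_cst.
Qed.

Lemma Im_cint_lb a b (phi : R -> C) m : a <= b -> ctn a b phi ->
  (forall t, a <= t <= b -> m <= Im (phi t)) -> (b - a) * m <= Im (cint a b phi).
Proof.
move=> ab H B.
have -> : (b - a) * m = \int[mu]_(t in `[a, b]) m.
  rewrite Rintegral_cst//=; rewrite lebesgue_measure_itv/= lte_fin mulrC.
  case: ltP => // ba; congr (_ * _); apply/eqP; rewrite subr_eq0.
  by rewrite eq_le ab ba.
apply: le_Rintegral => //; last exact: (ctn_integrable (@Im_lip R)).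
apply: (@ctn_integrable R a b (fun=> m%:C%C) Re); first exact: Re_lip.
exact: ctn_cst.
Qed.

Lemma kernel_lb r x y : 0 < r -> `|x| <= 3 / 2 * r -> r / 2 <= y <= 3 / 2 * r ->
  1 / (9 * r) <= y / (x ^+ 2 + y ^+ 2).
Proof.
move=> r0 xr /andP[y1 y2]; have y0 : 0 < y by lra.
have : x ^+ 2 <= (3 / 2 * r) ^+ 2.
  by rewrite -(real_normK (num_real x)) ler_sqr ?nnegrE//; lra.
have y2r : y ^+ 2 <= (3 / 2 * r) ^+ 2 by rewrite ler_sqr ?nnegrE//; lra.
have yy : 0 < y ^+ 2 by rewrite exprn_gt0.
have := sqr_ge0 x; rewrite !exprMn => ? ?.
rewrite ler_pdivlMr; last lra.
rewrite mul1r mulrC ler_pdivrMr; last lra.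
have : r / 2 * r <= y * r by rewrite ler_wpM2r// ltW.
by lra.
Qed.

Lemma sq_box r q : sq (r / 2) q -> `|Re q| <= r / 2 /\ `|Im q| <= r / 2.
Proof. by move=> /and4P[h1 h2 h3 h4]; rewrite !ler_norml h1 h2 h3 h4. Qed.

Lemma sqb_sub r q z : sq (r / 2) q -> sqb r z -> r / 2 <= cn (z - q).
Proof.
by move=> /and4P[h1 h2 h3 h4]; apply: onb_far; lra.
Qed.

Lemma sqb_neq r q z : 0 < r -> sq (r / 2) q -> sqb r z -> z != q.
Proof.
move=> r0 qr /(sqb_sub qr); apply: contraTneq => ->.
by rewrite subrr cn0 -ltNge; lra.
Qed.

Lemma bdif_inv r q : 0 < r -> sq (r / 2) q ->
  bdif (fun z => (z - q)^-1) (- r) r (- r) r.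
Proof.
move=> r0 qr z zb; have zq := sqb_neq r0 qr zb.
have := @cdif_divq (fun=> 1) q z zq (cdif_cst 1 z).
by congr (cdif _ _); apply/funext => w; rewrite mul1r.
Qed.

(** All four edges contribute to the imaginary part with the same sign. An edge has length [2 * r]
    and integrand at least [1 / (9 * r)] by [kernel_lb], so each pair of opposite edges gives at
    least 4/9. *)
Lemma W_lb r q : 0 < r -> sq (r / 2) q -> 8 / 9 <= cn (W r q).
Proof.
move=> r0 qr; have rr : - r <= r by lra.
have fb := bdif_inv r0 qr; have [h1 h2] := bdif_ctnB rr rr fb.
have [q1 q2] := sq_box qr.
have := Im_cn (W r q); apply: le_trans; apply: le_trans (ler_norm _).
have ImD (A B : C) : Im (A + (0 +i* 1)%C * B) = Im A + Re B.
  by case: A B => [? ?] [? ?] /=; ring.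
rewrite /W /sint /rint ImD.
set A := cint _ _ _; set B := cint _ _ _.
have k x y : `|x| <= 3 / 2 * r -> r / 2 <= y <= 3 / 2 * r ->
    1 / (9 * r) <= y / (x ^+ 2 + y ^+ 2) by exact: kernel_lb.
have e4 : (r - - r) * (2 / (9 * r)) = 4 / 9 by field; rewrite gt_eqF.
have : 4 / 9 <= Im A.
  rewrite -e4; apply: Im_cint_lb => // t /andP[t1 t2].
  case: (q) q1 q2 => [u v] /= q1 q2; move: (q1) (q2); rewrite !ler_norml => /andP[? ?] /andP[? ?].
  have tu : `|t - u| <= 3 / 2 * r by rewrite ler_norml; apply/andP; split; lra.
  have := k (t - u) (r + v) tu ltac:(apply/andP; split; lra).
  have := k (t - u) (r - v) tu ltac:(apply/andP; split; lra).
  rewrite (_ : (- r - v) = - (r + v)); last by rewrite opprD.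
  by rewrite sqrrN !mulNr opprK !mul1r; lra.
have : 4 / 9 <= Re B.
  rewrite -e4; apply: Re_cint_lb => // t /andP[t1 t2].
  case: (q) q1 q2 => [u v] /= q1 q2; move: (q1) (q2); rewrite !ler_norml => /andP[? ?] /andP[? ?].
  have tu : `|t - v| <= 3 / 2 * r by rewrite ler_norml; apply/andP; split; lra.
  have := k (t - v) (r + u) tu ltac:(apply/andP; split; lra).
  have := k (t - v) (r - u) tu ltac:(apply/andP; split; lra).
  rewrite (_ : (- r - u) = - (r + u)); last by rewrite opprD.
  by rewrite sqrrN !mulNr opprK !mul1r ![_ + (t - v) ^+ 2]addrC; lra.
by lra.
Qed.

(** Cauchy's theorem holds for the difference quotient of [f] at [q]: it is bounded near [q], and by
    [vanish_divq] it remains harmless at the other exceptional points. *)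
Lemma cauchy_formula f (O : set C) (sing : nat -> C) r q :
  0 < r -> sq (r / 2) q -> opn O -> (forall z, O z -> cdif f z) ->
  (forall z, sq r z -> O z \/ exists k, z = sing k) ->
  (forall z, sqb r z -> O z) ->
  (forall k, sq r (sing k) -> O (sing k) \/ vanish f (sing k)) -> O q ->
  sint (fun z => f z / (z - q)) r = f q * W r q.
Proof.
move=> r0 qr oO fO HO Hb Hv qO; have rr : - r <= r by lra.
pose g z := (f z - f q) / (z - q).
have vq : vanish g q.
  have [s s0 Hs] := oO q qO; have [L Lq] := fO q qO.
  have [K [K0 [s' s'0 HK]]] := isd_lip Lq.
  apply: (@vanish_bounded g q (Num.min s s') (2 * K)); first by rewrite lt_min s0.
  move=> w wq; rewrite lt_min => /andP[/Hs wO /HK h]; split.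
    by apply: cdif_divq => //; apply: cdifB; [exact: fO|exact: cdif_cst].
  rewrite (le_trans (cnM _ _))//.
  have n0 : 0 < cn (w - q) by rewrite cn_gt0// subr_eq0.
  have h' := @cnV R (w - q) ltac:(by rewrite subr_eq0).
  rewrite (le_trans (ler_pM (cn_ge0 _) (cn_ge0 _) h h'))//.
  rewrite (_ : K * _ * _ = 2 * K)//; field.
  by rewrite gt_eqF.
have I0 : rint g (- r) r (- r) r = 0.
  pose O' : set C := [set z | O z /\ z != q].
  (* The point [q] joins the exceptional points as number 0, and the others shift by one. *)
  apply: (@cauchy_countable R g O' (fun k => if k is k'.+1 then sing k' else q)) => //.
  - move=> z [zO zq]; have [s s0 Hs] := oO z zO.
    exists (Num.min s (cn (z - q))); first by rewrite lt_min s0 cn_gt0// subr_eq0.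
    move=> w; rewrite lt_min => /andP[/Hs wO wz]; split=> //.
    by apply: contraTneq wz => ->; rewrite cn_sym ltxx.
  - move=> z [zO zq]; apply: cdif_divq => //.
    by apply: cdifB; [exact: fO|exact: cdif_cst].
  - move=> z zr; have [zq|zq] := eqVneq z q; first by right; exists 0%N.
    by have [zO|[k zk]] := HO z zr; [left|right; exists k.+1].
  - by move=> z zb; split; [exact: Hb|exact: sqb_neq zb].
  - move=> [_|k kr]; first by right.
    have [kq|kq] := eqVneq (sing k) q; first by right; rewrite kq.
    by have [kO|vk] := Hv k kr; [left|right; exact: vanish_divq].
have fb : bdif f (- r) r (- r) r by move=> z /Hb /fO.
have ib := bdif_inv r0 qr.
have f1b : bdif (fun z => f z / (z - q)) (- r) r (- r) r.
  by move=> z zb; apply: cdifM; [exact: fb|exact: ib].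
have f2b : bdif (fun z => f q * (z - q)^-1) (- r) r (- r) r.
  by move=> z zb; apply: cdif_scale; exact: ib.
apply/eqP; rewrite -subr_eq0 /W /sint -rintZ// -rintB//.
rewrite -I0; apply/eqP; apply: rint_ext => // z _.
by rewrite -mulrBl.
Qed.

End CauchyFormula.

(** * Cauchy estimates *)

Section CauchyEstimates.
Variable R : realType.
Local Notation C := R[i].
Local Notation Re := (@complex.Re R).
Local Notation Im := (@complex.Im R).
Implicit Types (a b c d r s t : R) (f g : C -> C) (z w p q : C).

Lemma sq0 r : 0 <= r -> sq r 0.
Proof. by move=> r0; apply/and4P; split => /=; lra. Qed.

Lemma sq_le r s z : r <= s -> sq r z -> sq s z.
Proof. by move=> rs /and4P[? ? ? ?]; apply/and4P; split; lra. Qed.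

Lemma cn_sq r z : cn z <= r -> sq r z.
Proof.
move=> zr; have := le_trans (Re_cn z) zr; have := le_trans (Im_cn z) zr.
by rewrite !ler_norml => /andP[? ?] /andP[? ?]; apply/and4P; split.
Qed.

Lemma sq_cn r z : sq r z -> cn z <= 2 * r.
Proof.
by move=> zr; rewrite -[z]subr0; apply: (cnB_box _ _ _ _ zr) => /=; lra.
Qed.

Lemma sqb_cn r z : sqb r z -> r <= cn z.
Proof. by move=> zr; rewrite -[z]subr0; apply: (onb_far _ _ _ _ zr) => /=; lra. Qed.

Lemma sqb_sq r z : sqb r z -> sq r z. Proof. by case/andP. Qed.

Lemma sint_bound f r M : 0 < r -> bdif f (- r) r (- r) r ->
  (forall z, sqb r z -> cn (f z) <= M) -> cn (sint f r) <= 8 * r * M.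
Proof.
move=> r0 fb fM; have rr : - r <= r by lra.
have := rint_bound rr rr fb fM.
by rewrite (_ : 2 * M * _ = 8 * r * M); last ring.
Qed.

Lemma W_neq0 r q : 0 < r -> sq (r / 2) q -> W r q != 0.
Proof.
move=> r0 qr; apply: contraTneq (W_lb r0 qr) => ->.
by rewrite cn0 -ltNge; lra.
Qed.

Lemma cn_divW r q (z k : C) : 0 < r -> sq (r / 2) q -> z * W r q = k ->
  cn z <= 9 / 4 * cn k.
Proof.
move=> r0 qr <-; have W0 := W_neq0 r0 qr; have Wlb := W_lb r0 qr.
rewrite -[z in leLHS](mulfK W0) (le_trans (cnM _ _))// mulrC ler_wpM2r ?cn_ge0//.
rewrite (le_trans (cnV W0))// ler_pdivrMr; lra.
Qed.

Lemma cn_divW_le r q (z k : C) B : 0 < r -> sq (r / 2) q -> z * W r q = k ->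
  cn k <= B -> cn z <= 9 / 4 * B.
Proof.
by move=> r0 qr /(cn_divW r0 qr) h kB; rewrite (le_trans h)// ler_wpM2l.
Qed.

(** The origin is the only exceptional point. This is the form for quotients by powers of [z], whose
    value at 0 is a mere convention. *)
Lemma cauchy_formula_punctured f (O : set C) r q : 0 < r -> sq (r / 2) q -> opn O ->
  (forall z, O z -> z != 0 -> cdif f z) -> (forall z, sq r z -> O z) ->
  vanish f 0 -> q != 0 ->
  sint (fun z => f z / (z - q)) r = f q * W r q.
Proof.
move=> r0 qr oO fO HO v0 q0.
have qO : O q by apply/HO/(sq_le _ qr); lra.
apply: (@cauchy_formula R f [set z | O z /\ z != 0] (fun=> 0)) => //.
- move=> z [zO z0]; have [s s0 Hs] := oO z zO.
  exists (Num.min s (cn z)) => [|w]; first by rewrite lt_min s0 cn_gt0.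
  rewrite lt_min => /andP[/Hs wO wz]; split=> //.
  by apply: contraTneq wz => ->; rewrite sub0r cnN ltxx.
- by move=> z [zO z0]; exact: fO.
- by move=> z /HO zO; have [->|z0] := eqVneq z 0; [right; exists 0%N|left].
- move=> z zb; split; first exact/HO/sqb_sq.
  by apply: contraTneq (sqb_cn zb) => ->; rewrite cn0 -ltNge.
- by right.
Qed.

Lemma sint_vanish f (O : set C) r : 0 < r -> opn O ->
  (forall z, O z -> z != 0 -> cdif f z) -> (forall z, sq r z -> O z) ->
  vanish f 0 -> sint f r = 0.
Proof.
move=> r0 oO fO HO v0; have rr : - r <= r by lra.
apply: (@cauchy_countable R f [set z | O z /\ z != 0] (fun=> 0)) => //.
- move=> z [zO z0]; have [s s0 Hs] := oO z zO.
  exists (Num.min s (cn z)) => [|w]; first by rewrite lt_min s0 cn_gt0.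
  rewrite lt_min => /andP[/Hs wO wz]; split=> //.
  by apply: contraTneq wz => ->; rewrite sub0r cnN ltxx.
- by move=> z [zO z0]; exact: fO.
- by move=> z /HO zO; have [->|z0] := eqVneq z 0; [right; exists 0%N|left].
- move=> z zb; split; first exact/HO/sqb_sq.
  by apply: contraTneq (sqb_cn zb) => ->; rewrite cn0 -ltNge.
- by right.
Qed.

Lemma sqb_neq0 r z : 0 < r -> sqb r z -> z != 0.
Proof. by move=> r0 zb; apply: contraTneq (sqb_cn zb) => ->; rewrite cn0 -ltNge. Qed.

Lemma sqb_cnV r z : 0 < r -> sqb r z -> cn z^-1 <= 2 / r.
Proof.
move=> r0 zb; rewrite (le_trans (cnV (sqb_neq0 r0 zb)))// ler_wpM2l//.
by rewrite lef_pV2 ?posrE ?sqb_cn// (lt_le_trans r0)// sqb_cn.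
Qed.

Lemma sqb_cnVq r q z : 0 < r -> sq (r / 2) q -> sqb r z -> cn (z - q)^-1 <= 4 / r.
Proof.
move=> r0 qr zb; have zq := sqb_neq r0 qr zb.
have h := sqb_sub qr zb.
rewrite (le_trans (cnV _)) ?subr_eq0// (_ : 4 / r = 2 / (r / 2)); last first.
  by field; rewrite gt_eqF.
by rewrite ler_wpM2l// lef_pV2 ?posrE//; lra.
Qed.

(** The second-order remainder over [z ^ 2], called [eta], is harmless at 0. Cauchy's theorem for
    [eta] yields the integral formula for [L 1], and the Cauchy formula for [eta] bounds the
    remainder, all without power series. The third clause expresses the derivative by values of [f],
    so regularity in parameters carries over to it. *)
Lemma cauchy_quad : exists K : R, 0 < K /\ forall f (O : set C) r M L,
  0 < r -> opn O -> (forall z, O z -> cdif f z) -> (forall z, sq r z -> O z) ->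
  (forall z, sq r z -> cn (f z) <= M) -> isd (V := R[i]^o) (@cn R) f 0 L ->
  [/\ cn (L 1) <= K * M / r,
      forall q, sq (r / 2) q -> cn (f q - f 0 - q * L 1) <= K * M / r ^+ 2 * cn q ^+ 2 &
      L 1 * W r 0 = sint (fun z => (f z - f 0) / z ^+ 2) r].
Proof.
(* In both constants 9/4 comes from dividing by [W] and 8 from the length in [sint_bound]. In [K1]
   the factors 2 and 4 bound [f z - f 0] and [z ^- 2]; in [K2] the numerator gains [K1 * 2] from
   [z * l], and the last 4 bounds the kernel. *)
pose K1 : R := 9 / 4 * (8 * (2 * 4)); pose K2 : R := 9 / 4 * (8 * ((2 + K1 * 2) * 4 * 4)).
have K10 : 0 < K1 by rewrite /K1; lra.
have K20 : 0 < K2 by rewrite /K2 !mulr_gt0//; lra.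
exists (K1 + K2); split; first by lra.
move=> f O r M L r0 oO fO HO fM Lf; set l := L 1.
have M0 : 0 <= M by rewrite (le_trans (cn_ge0 (f 0)))// fM// sq0// ltW.
have s0 : sq (r / 2) 0 by rewrite sq0// divr_ge0// ltW.
have rr : - r <= r by lra.
have LE u := isd_lin1 u Lf.
pose eta z := (f z - f 0 - z * l) / z ^+ 2.
have etad z : O z -> z != 0 -> cdif eta z.
  move=> zO z0; apply: cdif_div; first by rewrite expf_neq0.
    apply: cdifB; first by apply: cdifB; [exact: fO|exact: cdif_cst].
    by apply: cdifM; [exact: cdif_id|exact: cdif_cst].
  by apply: cdifX; exact: cdif_id.
have v0 : vanish eta 0.
  apply: vanish_small_o => e e0; have [_ _ H] := Lf.
  have e4 : 0 < e / 4 by lra.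
  have [s s0' Hs] := H _ e4; have [s' s'0 Hs'] := oO 0 (HO 0 (sq0 (ltW r0))).
  exists (Num.min s s') => [|w w0]; first by rewrite lt_min s0'.
  rewrite lt_min => /andP[/Hs + /Hs' wO]; rewrite LE !subr0 => h.
  split; first exact: etad.
  have nw : 0 < cn w by exact: cn_gt0.
  rewrite /eta expr2 invfM.
  rewrite (le_trans (ler_wpM2r (cn_ge0 _) (cnM _ _)))//.
  have := cnM w^-1 w^-1; have := cnV w0; have := cn_ge0 w^-1.
  move: h (cn_ge0 (f w - f 0 - w * l)); rewrite -/l; move: (cn (f w - f 0 - w * l)) (cn (w^-1 / w)) (cn w^-1) (cn_ge0 (w^-1 / w)).
  move=> A B D B0 h1 A0 D0 h2 h3.
  have h4 : B <= 2 / cn w * (2 / cn w) by rewrite (le_trans h3)// ler_pM.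
  rewrite -mulrA; apply: (@le_trans _ _ (e / 4 * cn w * (2 / cn w * (2 / cn w) * cn w))).
    by apply: ler_pM => //; [rewrite mulr_ge0// ltW|rewrite ler_wpM2r// ltW].
  by rewrite le_eqVlt; apply/orP; left; apply/eqP; field; rewrite gt_eqF.
have fb : bdif f (- r) r (- r) r by move=> z /sqb_sq/HO/fO.
have f0b : bdif (fun z => f z - f 0) (- r) r (- r) r.
  by move=> z /fb zf; apply: cdifB => //; exact: cdif_cst.
have f2b : bdif (fun z => (f z - f 0) / z ^+ 2) (- r) r (- r) r.
  move=> z zb; apply: cdif_div; first by rewrite expf_neq0// (sqb_neq0 r0).
    exact: f0b.
  by apply: cdifX; exact: cdif_id.
have i0b : bdif (fun z => l * (z - 0)^-1) (- r) r (- r) r.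
  by move=> z zb; apply: cdif_scale; exact: (bdif_inv r0 s0).
have f0M z : sq r z -> cn (f z - f 0) <= 2 * M.
  move=> zr; have := cnB (f z) (f 0); have := fM z zr.
  by have := fM 0 (sq0 (ltW r0)); lra.
have V2 z : sqb r z -> cn (z ^- 2) <= 4 / r ^+ 2.
  move=> zb; rewrite -exprVn (le_trans (cnX _ _))// (_ : 4 / r ^+ 2 = (2 / r) ^+ 2).
    by rewrite ler_sqr ?nnegrE ?cn_ge0 ?divr_ge0 ?(ltW r0)// sqb_cnV.
  by field; rewrite gt_eqF.
have lW : l * W r 0 = sint (fun z => (f z - f 0) / z ^+ 2) r.
  apply/eqP; rewrite eq_sym -subr_eq0 /W /sint -rintZ//; last exact: bdif_inv.
  rewrite -rintB//; apply/eqP; rewrite -[RHS](sint_vanish r0 oO etad HO v0).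
  apply: rint_ext => // z zb; rewrite /eta subr0.
  by field; exact: (sqb_neq0 r0 zb).
have lM : cn l <= K1 * M / r.
  rewrite (le_trans (cn_divW_le r0 s0 lW (sint_bound (M := 2 * M * (4 / r ^+ 2)) r0 f2b _)))//.
    move=> z zb; rewrite (le_trans (cnM _ _))// ler_pM ?cn_ge0 ?V2// f0M//.
    exact: sqb_sq.
  by rewrite /K1 le_eqVlt; apply/orP; left; apply/eqP; field; rewrite gt_eqF.
split=> //.
  rewrite (le_trans lM)// ler_wpM2r ?invr_ge0 ?(ltW r0)// ler_wpM2r//.
  by lra.
move=> q qr; have [->|q0] := eqVneq q 0.
  by rewrite subrr mul0r subr0 cn0 expr0n /= mulr0.
have := cauchy_formula_punctured r0 qr oO etad HO v0 q0 => /esym h.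
have etab : bdif (fun z => eta z / (z - q)) (- r) r (- r) r.
  move=> z zb; apply: cdifM; last exact: (bdif_inv r0 qr).
  by apply: etad; [exact/HO/sqb_sq|exact: (sqb_neq0 r0)].
have hM z : sqb r z -> cn (eta z / (z - q)) <= (2 + K1 * 2) * M * (4 / r ^+ 2) * (4 / r).
  move=> zb; rewrite (le_trans (cnM _ _))// ler_pM ?cn_ge0 ?sqb_cnVq//.
  rewrite (le_trans (cnM _ _))// ler_pM ?cn_ge0 ?V2//.
  rewrite (le_trans (cnB _ _))// mulrDl lerD ?f0M ?sqb_sq//.
  rewrite (le_trans (cnM _ _))// (_ : K1 * 2 * M = 2 * r * (K1 * M / r)).
    by rewrite ler_pM ?cn_ge0// sq_cn// sqb_sq.
  by field; rewrite gt_eqF.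
have := cn_divW_le r0 qr h (sint_bound r0 etab hM).
have -> : 9 / 4 * (8 * r * ((2 + K1 * 2) * M * (4 / r ^+ 2) * (4 / r))) = K2 * M / r ^+ 2.
  by rewrite /K2; field; rewrite gt_eqF.
move=> hq; have -> : f q - f 0 - q * l = eta q * q ^+ 2.
  by rewrite /eta mulfVK// expf_neq0.
rewrite (le_trans (cnM _ _))// ler_pM ?cn_ge0 ?cnX//.
rewrite (le_trans hq)// ler_wpM2r ?invr_ge0 ?exprn_ge0 ?(ltW r0)// ler_wpM2r//.
by lra.
Qed.

(* If all these Taylor remainders are controlled, the Cauchy formula for
   [f z / z ^+ m] gives [cn (f q) <= K * (cn q / r) ^+ m] for every [m]. *)
Lemma flat_zero f (O : set C) r : 0 < r -> opn O -> (forall z, O z -> cdif f z) ->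
  (forall z, sq r z -> O z) -> (exists M, forall z, sqb r z -> cn (f z) <= M) ->
  (forall m : nat, exists K dl : R, 0 < dl /\
     forall z, cn z < dl -> cn (f z) <= K * cn z ^+ m) ->
  forall q, sq (r / 16) q -> f q = 0.
Proof.
move=> r0 oO fO HO [M fM] Hm q qr; have [q0|q0] := eqVneq q 0.
  have [K [dl [dl0 H]]] := Hm 1%N; apply: cn_eq0; apply/eqP.
  have := H 0; rewrite cn0 expr1 mulr0 q0 => /(_ dl0) h.
  by rewrite eq_le cn_ge0 andbT.
have qr2 : sq (r / 2) q by apply: (sq_le _ qr); lra.
have key m : cn (f q) <= 9 / 4 * (8 * r * (M * (4 / r))) * (1 / 4) ^+ m.
  pose g z := f z / z ^+ m.
  have gd z : O z -> z != 0 -> cdif g z.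
    move=> zO z0; apply: cdif_div; first by rewrite expf_neq0.
      exact: fO.
    by apply: cdifX; exact: cdif_id.
  have v0 : vanish g 0.
    have [K [dl [dl0 H]]] := Hm m; have [s s0 Hs] := oO 0 (HO 0 (sq0 (ltW r0))).
    apply: (@vanish_bounded R g 0 (Num.min dl s) (`|K| * 2 ^+ m)).
      by rewrite lt_min dl0.
    move=> w w0; rewrite lt_min => /andP[wd /Hs wO].
    split; first exact: gd.
    rewrite subr0 in wd; rewrite /g -exprVn (le_trans (cnM _ _))//.
    have := H w wd; have := cnX w^-1 m; have nw := cn_gt0 w0.
    have h1 : cn w^-1 ^+ m <= (2 / cn w) ^+ m.
      by apply: lerXn2r; rewrite ?nnegrE ?cn_ge0 ?divr_ge0 ?cnV// ltW.
    move=> h2 h3; rewrite (@le_trans _ _ (`|K| * cn w ^+ m * (2 / cn w) ^+ m))//.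
      apply: ler_pM; rewrite ?cn_ge0//; last exact: le_trans h1.
      by rewrite (le_trans h3)// ler_wpM2r ?ler_norm// exprn_ge0// ltW.
    rewrite expr_div_n le_eqVlt; apply/orP; left; apply/eqP.
    by rewrite mulrACA -mulrA mulrCA mulfV ?mulr1// ?expf_neq0 ?gt_eqF//; ring.
  have h := cauchy_formula_punctured r0 qr2 oO gd HO v0 q0.
  have gb : bdif (fun z => g z / (z - q)) (- r) r (- r) r.
    move=> z zb; apply: cdifM; last exact: (bdif_inv r0 qr2).
    by apply: gd; [exact/HO/sqb_sq|exact: (sqb_neq0 r0)].
  have hM z : sqb r z -> cn (g z / (z - q)) <= M * (2 / r) ^+ m * (4 / r).
    move=> zb; rewrite (le_trans (cnM _ _))// ler_pM ?cn_ge0 ?sqb_cnVq//.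
    rewrite (le_trans (cnM _ _))// ler_pM ?cn_ge0 ?fM//.
    rewrite -exprVn (le_trans (cnX _ _))// lerXn2r// ?nnegrE ?cn_ge0 ?sqb_cnV//.
    by rewrite divr_ge0// ltW.
  have := cn_divW_le r0 qr2 (esym h) (sint_bound r0 gb hM).
  move=> hq; have -> : f q = g q * q ^+ m by rewrite /g mulfVK// expf_neq0.
  rewrite (le_trans (cnM _ _))//.
  have q8 : cn q <= r / 8 by have := sq_cn qr; lra.
  have hqm : cn (q ^+ m) <= (r / 8) ^+ m.
    by rewrite (le_trans (cnX _ _))// lerXn2r// ?nnegrE ?cn_ge0// divr_ge0// ltW.
  rewrite (le_trans (ler_pM (cn_ge0 _) (cn_ge0 _) hq hqm))//.
  have -> : (1 / 4) ^+ m = (2 / r) ^+ m * (r / 8) ^+ m :> R.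
    by rewrite -exprMn; congr (_ ^+ _); field; rewrite gt_eqF.
  by rewrite le_eqVlt; apply/orP; left; apply/eqP; ring.
apply: cn_eq0; apply/eqP; rewrite eq_le cn_ge0 andbT leNgt; apply/negP => fq0.
have [k] := @shrink_lt R (1 / 4) (9 / 4 * (8 * r * (M * (4 / r)))) _ fq0 ltac:(lra).
by rewrite mulrC ltNge key.
Qed.

(** By bisection: if the growth on a segment is too fast, it is too fast on one of its halves, and
    at the limit point this contradicts the bound on the derivative. *)
Lemma mean_value f q B : (forall t, 0 <= t <= 1 -> exists2 L,
    isd (V := R[i]^o) (@cn R) f (t%:C%C * q) L & cn (L 1) <= B) ->
  cn (f q - f 0) <= B * cn q.
Proof.
move=> H; rewrite leNgt; apply/negP => bad.
have q0 : 0 < cn q.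
  rewrite cn_gt0//; apply: contraTneq bad => ->.
  by rewrite subrr cn0 mulr0 ltxx.
pose e := (cn (f q - f 0) - B * cn q) / 2.
have e0 : 0 < e by rewrite /e; lra.
(* Rectangles of height zero turn [nested_rects] into the bisection of a segment. The slack [e]
   absorbs the differentiability error at the limit point. *)
pose P (k : nat) a b c d := [/\ 0 <= a, a < b, b <= 1, c = 0 /\ d = 0 &
  (B * cn q + e) * (b - a) < cn (f (b%:C%C * q) - f (a%:C%C * q))].
have [|k a b c d ab cd [a0 ab' b1 [c0 d0] h]|p Hp] := @nested_rects R P 0 1 0 0 ler01 (lexx 0).
- split=> //.
  by rewrite subr0 mulr1 mul1r mul0r /e; lra.
- pose m := (a + b) / 2.
  have am : a < m by rewrite /m; lra.
  have mb : m < b by rewrite /m; lra.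
  apply: contrapT => K.
  have h1 : cn (f (m%:C%C * q) - f (a%:C%C * q)) <= (B * cn q + e) * (m - a).
    rewrite leNgt; apply/negP => L; apply: K; exists a, m, c, d.
    by split; [split; rewrite /m; lra|split; lra|split=> //; lra].
  have h2 : cn (f (b%:C%C * q) - f (m%:C%C * q)) <= (B * cn q + e) * (b - m).
    rewrite leNgt; apply/negP => L; apply: K; exists m, b, c, d.
    by split; [split; rewrite /m; lra|split; lra|split=> //; lra].
  have := cnD (f (b%:C%C * q) - f (m%:C%C * q)) (f (m%:C%C * q) - f (a%:C%C * q)).
  rewrite addrA subrK; rewrite !mulrBr in h h1 h2; lra.
have p01 : 0 <= Re p <= 1.
  have [a [b [c [d [[h1 h2 h3 _ _] /and4P[k1 k2 _ _] _ _]]]]] := Hp 0%N.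
  by apply/andP; split; lra.
set t := Re p in p01.
have [L Lp LB] := H t p01; have LE := fun u => isd_lin1 u Lp.
have [_ _ /(_ (e / cn q))[|s s0 Hs]] := Lp; first by rewrite divr_gt0.
have [k hk] := @shrink_lt R (2/3) (1 * cn q) s s0 ltac:(lra).
have [a [b [c [d [[a0 ab b1 _ h] /and4P[pa pb _ _] w _]]]]] := Hp k.
have wq : (b - a) * cn q < s.
  apply: le_lt_trans hk; rewrite mul1r ler_wpM2r ?(ltW q0)//.
  by move: w; rewrite subr0 mulr1.
have est u : a <= u <= b -> cn (f (u%:C%C * q) - f (t%:C%C * q)) <= (B * cn q + e) * `|u - t|.
  move=> /andP[u1 u2]; have E : u%:C%C * q - t%:C%C * q = (u - t)%:C%C * q.
    by rewrite -mulrBl; congr (_ * _); rewrite raddfB.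
  have n1 : cn (u%:C%C * q - t%:C%C * q) <= `|u - t| * cn q.
    by rewrite E (le_trans (cnM _ _))// cn_real.
  have ut : `|u - t| <= b - a by rewrite ler_norml; apply/andP; split; rewrite /t in pa pb *; lra.
  have /Hs : cn (u%:C%C * q - t%:C%C * q) < s.
    by rewrite (le_lt_trans n1)// (le_lt_trans _ wq)// ler_wpM2r// ltW.
  rewrite LE => h1.
  have := cnD (f (u%:C%C * q) - f (t%:C%C * q) - (u%:C%C * q - t%:C%C * q) * L 1) ((u%:C%C * q - t%:C%C * q) * L 1).
  rewrite subrK => h2; rewrite (le_trans h2)// [leLHS]addrC [leRHS]mulrDl lerD//.
    rewrite (le_trans (cnM _ _))// (_ : B * cn q * `|u - t| = `|u - t| * cn q * B); last ring.
    by apply: ler_pM; rewrite ?cn_ge0.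
  have ec : 0 <= e / cn q by rewrite divr_ge0 ?(ltW q0) ?(ltW e0).
  rewrite (le_trans h1)// (le_trans (ler_wpM2l ec n1))//.
  by rewrite (_ : e / cn q * _ = e * `|u - t|)//; field; rewrite gt_eqF.
have := est a ltac:(apply/andP; split; lra); have := est b ltac:(apply/andP; split; lra).
rewrite (ler0_norm (_ : a - t <= 0)) ?(ger0_norm (_ : 0 <= b - t)); [|rewrite /t; lra..].
rewrite -[cn (f (a%:C%C * q) - _)]cnN opprB.
have := cnD (f (b%:C%C * q) - f (t%:C%C * q)) (f (t%:C%C * q) - f (a%:C%C * q)).
by rewrite addrA subrK; move: h; rewrite !mulrBr opprB !mulrBr; lra.
Qed.

(** Each step integrates: a bound of order [m] on [f k.+1] becomes, by [mean_value] on the segment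
    from 0, a bound of order [m + 1] on [f k]. The base case is continuity. *)
Lemma flat_of_derivs (f : nat -> C -> C) r : 0 < r ->
  (forall k z, sq r z -> isd (V := R[i]^o) (@cn R) (f k) z (fun u => u * f k.+1 z)) ->
  (forall k, f k 0 = 0) ->
  forall m k : nat, exists K dl : R, 0 < dl /\
     forall z, cn z < dl -> cn (f k z) <= K * cn z ^+ m.
Proof.
move=> r0 fd f0; elim=> [|m IH] k.
  have /dif_cnt/(_ 1 ltr01)[dl dl0 H] : cdif (f k) 0.
    by exists (fun u => u * f k.+1 0); apply: fd; rewrite sq0// ltW.
  exists 1, dl; split=> // z zd; have := H z; rewrite subr0 f0 subr0 expr0 mulr1.
  by move=> /(_ zd)/ltW.
have [K [dl [dl0 H]]] := IH k.+1.
exists `|K|, (Num.min dl r); split; first by rewrite lt_min dl0.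
move=> z; rewrite lt_min => /andP[zd zr]; have := f0 k => fk0.
rewrite -[f k z]subr0 -fk0 exprSr mulrA; apply: mean_value => t /andP[t0 t1].
have tz : cn (t%:C%C * z) <= cn z.
  by rewrite (le_trans (cnM _ _))// cn_real ger0_norm// ler_piMl// cn_ge0.
exists (fun u => u * f k.+1 (t%:C%C * z)).
  by apply: fd; apply: cn_sq; rewrite (le_trans tz)// ltW.
rewrite mul1r (le_trans (H _ (le_lt_trans tz zd)))//.
rewrite (le_trans (ler_wpM2r _ (ler_norm K))) ?exprn_ge0 ?cn_ge0//.
by rewrite ler_wpM2l// lerXn2r// nnegrE cn_ge0.
Qed.

End CauchyEstimates.

(** * Holomorphic functions of several variables *)

Section SquareCompactness.
Variable R : realType.
Local Notation C := R[i].
Local Notation Re := (@complex.Re R).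
Local Notation Im := (@complex.Im R).
Implicit Types (a b c d r t : R) (f g : C -> C) (z p q : C).

(** Cousin's lemma: bad rectangles would nest down to a point near which the property holds. It
    plays the role of compactness of the closed rectangle. *)
Lemma rect_induction (P : R -> R -> R -> R -> Prop) a b c d : a <= b -> c <= d ->
  (forall a x b c y d, a <= x -> x <= b -> c <= y -> y <= d ->
     P a x c y -> P a x y d -> P x b c y -> P x b y d -> P a b c d) ->
  (forall p, inr a b c d p -> exists2 dl : R, 0 < dl & forall a' b' c' d',
     a <= a' -> b' <= b -> c <= c' -> d' <= d ->
     (forall w, inr a' b' c' d' w -> cn (w - p) < dl) -> P a' b' c' d') ->
  P a b c d.
Proof.
move=> ab cd Hs Hl; apply: contrapT => nP.
pose B (k : nat) a' b' c' d' := [/\ a <= a', b' <= b, c <= c', d' <= d & ~ P a' b' c' d'].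
have [|k a' b' c' d' h1 h2 [h3 h4 h5 h6 h7]|p Hp] := @nested_rects R B a b c d ab cd.
- by split.
- pose x := (a' + b') / 2; pose y := (c' + d') / 2.
  have x1 : a' <= x by rewrite /x; lra. have x2 : x <= b' by rewrite /x; lra.
  have y1 : c' <= y by rewrite /y; lra. have y2 : y <= d' by rewrite /y; lra.
  have wx1 : x - a' <= 2/3 * (b' - a') by rewrite /x; lra.
  have wx2 : b' - x <= 2/3 * (b' - a') by rewrite /x; lra.
  have wy1 : y - c' <= 2/3 * (d' - c') by rewrite /y; lra.
  have wy2 : d' - y <= 2/3 * (d' - c') by rewrite /y; lra.
  have ax := le_trans h3 x1; have xb := le_trans x2 h4.
  have cy := le_trans h5 y1; have yd := le_trans y2 h6.
  apply: contrapT => K; apply: h7; apply: (Hs a' x b' c' y d') => //;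
    apply: contrapT => L; apply: K.
  + by exists a', x, c', y.
  + by exists a', x, y, d'.
  + by exists x, b', c', y.
  + by exists x, b', y, d'.
have pR : inr a b c d p.
  by have [a' [b' [c' [d' [[? ? ? ? _] pk _ _]]]]] := Hp 0%N; exact: inr_sub pk.
have [dl dl0 H] := Hl p pR.
have [k hk] := @shrink_lt R (2/3) ((b - a) + (d - c)) dl dl0 ltac:(lra).
have [a' [b' [c' [d' [[h1 h2 h3 h4 h5] pk w1 w2]]]]] := Hp k.
apply/h5/H => // w wr.
by rewrite (le_lt_trans (inr_cn pk wr))// (le_lt_trans _ hk)// mulrDr lerD.
Qed.

Lemma inr_quarter a x b c y d z : inr a b c d z ->
  [\/ inr a x c y z, inr a x y d z, inr x b c y z | inr x b y d z].
Proof.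
move=> /and4P[h1 h2 h3 h4]; rewrite /inr h1 h2 h3 h4 /= !andbT.
have [zx|/ltW zx] := leP (Re z) x; have [zy|/ltW zy] := leP (Im z) y.
- by constructor 1; rewrite ?zx ?zy. - by constructor 2; rewrite ?zx ?zy.
- by constructor 3; rewrite ?zx ?zy. - by constructor 4; rewrite ?zx ?zy.
Qed.

Lemma cdif_bounded f r : (forall z, sq r z -> cdif f z) ->
  exists M : R, forall z, sq r z -> cn (f z) <= M.
Proof.
move=> fd; have [r0|r0] := ltP r 0.
  by exists 0 => z /and4P[]; lra.
apply: (@rect_induction (fun a b c d => exists M : R, forall z, inr a b c d z -> cn (f z) <= M)); try lra.
- move=> a x b c y d _ _ _ _ [M1 H1] [M2 H2] [M3 H3] [M4 H4].
  exists (Num.max (Num.max M1 M2) (Num.max M3 M4)) => z /(@inr_quarter a x b c y d)[/H1|/H2|/H3|/H4] h;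
  by rewrite !le_max h ?orbT.
move=> p /fd/dif_cnt/(_ 1 ltr01)[dl dl0 H]; exists dl => // a b c d _ _ _ _ K.
exists (cn (f p) + 1) => z /K/H h.
by have := cnD (f z - f p) (f p); rewrite subrK; lra.
Qed.

Lemma sqb_closed r p : ~~ sqb r p -> exists2 dl : R, 0 < dl &
  forall w, cn (w - p) < dl -> ~~ sqb r w.
Proof.
have e0 (x y : R) : x != y -> 0 < `|x - y| by rewrite normr_gt0 subr_eq0.
have far (x y u dl : R) : x != y -> dl <= `|x - y| -> `|u - x| < dl -> u != y.
  by move=> xy h1 h2; apply: contraTneq h2 => ->; rewrite -leNgt distrC.
rewrite negb_and => /orP[|].
  move=> pr; have [z|nz] := pselect (exists2 dl : R, 0 < dl & forall w, cn (w - p) < dl -> ~~ sq r w).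
    by have [dl dl0 H] := z; exists dl => // w /H; apply: contra; case/andP.
  exfalso; apply: nz; move: pr; rewrite !negb_and -!ltNge => /or4P[] h.
  - exists (- r - Re p) => [|w wp]; first lra.
    have := le_lt_trans (Re_lip w p) wp; rewrite ltr_norml => /andP[_ k].
    by rewrite /sq /inr lt_geF//; lra.
  - exists (Re p - r) => [|w wp]; first lra.
    have := le_lt_trans (Re_lip w p) wp; rewrite ltr_norml => /andP[k _].
    by rewrite /sq /inr (@lt_geF _ _ r) ?andbF//; lra.
  - exists (- r - Im p) => [|w wp]; first lra.
    have := le_lt_trans (Im_lip w p) wp; rewrite ltr_norml => /andP[_ k].
    by rewrite /sq /inr (@lt_geF _ _ (Im w)) ?andbF//; lra.
  - exists (Im p - r) => [|w wp]; first lra.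
    have := le_lt_trans (Im_lip w p) wp; rewrite ltr_norml => /andP[k _].
    by rewrite /sq /inr (@lt_geF _ _ r (Im w)) ?andbF//; lra.
rewrite !negb_or => /and4P[h1 h2 h3 h4].
exists (Num.min (Num.min `|Re p - - r| `|Re p - r|) (Num.min `|Im p - - r| `|Im p - r|)).
  by rewrite !lt_min !e0.
move=> w; rewrite !lt_min => /andP[/andP[k1 k2] /andP[k3 k4]].
rewrite negb_and !negb_or; apply/orP; right; apply/and4P; split.
- exact: far h1 (lexx _) (le_lt_trans (Re_lip _ _) k1).
- exact: far h2 (lexx _) (le_lt_trans (Re_lip _ _) k2).
- exact: far h3 (lexx _) (le_lt_trans (Im_lip _ _) k3).
- exact: far h4 (lexx _) (le_lt_trans (Im_lip _ _) k4).
Qed.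

(** Joint continuity at the pair [(s, w0)], within [S] and [P]. The function [ds] stands for the
    distance to [w0], so that the parameter may be a row vector or a point of the plane. *)
Definition jc (T : Type) (S : C -> bool) (P : set T) (ds : T -> R) (phi : C -> T -> C) s w0 :=
  forall e : R, 0 < e -> exists2 dl : R, 0 < dl & forall s' w, S s' -> P w ->
    cn (s' - s) < dl -> ds w < dl -> cn (phi s' w - phi s w0) < e.

(** The tube lemma for the boundary of a square, by [rect_induction] over the full square; points
    off the boundary are disposed of locally because [sqb r] is closed. *)
Lemma tube_sq (T : Type) (P : set T) (ds : T -> R) (phi : C -> T -> C) w0 r e :
  - r <= r -> (forall s, sqb r s -> jc (sqb r) P ds phi s w0) -> P w0 -> ds w0 <= 0 ->
  0 < e -> exists2 dl : R, 0 < dl & forall s w, sqb r s -> P w -> ds w < dl ->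
    cn (phi s w - phi s w0) < e.
Proof.
move=> rr H Pw0 d0 e0.
have [dl [dl0 Hdl]] : exists dl : R, 0 < dl /\ forall s w, inr (- r) r (- r) r s -> sqb r s ->
    P w -> ds w < dl -> cn (phi s w - phi s w0) < e.
  apply: (@rect_induction (fun a b c d => exists dl : R, 0 < dl /\ forall s w, inr a b c d s ->
     sqb r s -> P w -> ds w < dl -> cn (phi s w - phi s w0) < e)) => //.
  - move=> a x b c y d _ _ _ _ [d1 [p1 h1]] [d2 [p2 h2]] [d3 [p3 h3]] [d4 [p4 h4]].
    exists (Num.min (Num.min d1 d2) (Num.min d3 d4)); split; first by rewrite !lt_min p1 p2 p3.
    move=> s w /(@inr_quarter a x b c y d) sr sb Pw; rewrite !lt_min.
    move=> /andP[/andP[k1 k2] /andP[k3 k4]].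
    by case: sr => sr; [exact: h1|exact: h2|exact: h3|exact: h4].
  move=> p pr; have [pb|/sqb_closed[dl dl0 Hdl]] := boolP (sqb r p); last first.
    exists dl => // a b c d _ _ _ _ K; exists 1; split=> // s w /K/Hdl.
    by move=> /negbTE ->.
  have e2 : 0 < e / 2 by lra.
  have [dl dl0 Hdl] := H p pb _ e2; exists dl => // a b c d _ _ _ _ K.
  exists dl; split=> // s w /K sp sb Pw wd.
  have h1 := Hdl s w sb Pw sp wd.
  have h2 := Hdl s w0 sb Pw0 sp (le_lt_trans d0 dl0).
  have := cnB (phi s w - phi p w0) (phi s w0 - phi p w0).
  by rewrite opprB addrA subrK; lra.
exists dl => // s w sb; exact: (Hdl s w (sqb_sq sb) sb).
Qed.

Definition scnt f r := forall s, sqb r s -> forall e : R, 0 < e ->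
  exists2 dl : R, 0 < dl & forall s', sqb r s' -> cn (s' - s) < dl -> cn (f s' - f s) < e.

Definition sctn f r := [/\ ctn (- r) r (fun t => f (t +i* - r)%C), ctn (- r) r (fun t => f (t +i* r)%C),
  ctn (- r) r (fun t => f (- r +i* t)%C) & ctn (- r) r (fun t => f (r +i* t)%C)].

Lemma scnt_sctn f r : scnt f r -> sctn f r.
Proof.
move=> H; have key (P : R -> C) : (forall t, - r <= t <= r -> sqb r (P t)) ->
    (forall u v : R, cn (P u - P v) <= `|u - v|) -> ctn (- r) r (fun t => f (P t)).
  move=> Pb PL t tr e e0; have [dl dl0 K] := H _ (Pb t tr) e e0.
  by exists dl => // u ur ut; apply: K; [exact: Pb|exact: le_lt_trans ut].
split; apply: key => [t /andP[t1 t2]|u v].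
all: rewrite /sqb /onb /inr /cn /= ?subrr ?normr0 ?addr0 ?add0r ?t1 ?t2 ?(le_trans t1 t2) ?lexx ?eqxx ?orbT//.
Qed.

Lemma sctnB f g r : sctn f r -> sctn g r -> sctn (fun z => f z - g z) r.
Proof. by move=> [? ? ? ?] [? ? ? ?]; split; exact: ctnB. Qed.

Lemma sctnZ k f r : sctn f r -> sctn (fun z => k * f z) r.
Proof. by move=> [? ? ? ?]; split; exact: ctnZ. Qed.

Lemma sctnD_sint f g r : sctn f r -> sctn g r ->
  sint (fun z => f z + g z) r = sint f r + sint g r.
Proof.
move=> [f1 f2 f3 f4] [g1 g2 g3 g4].
rewrite /sint /rint addrACA -mulrDr -!cintD//; [|exact: ctnB..].
by congr (_ + _ * _); apply: cint_ext => t _; ring.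
Qed.

Lemma sctnZ_sint k f r : sctn f r -> sint (fun z => k * f z) r = k * sint f r.
Proof.
move=> [f1 f2 f3 f4]; rewrite /sint /rint mulrDr mulrCA -(cintZ _ (ctnB f1 f2)) -(cintZ _ (ctnB f4 f3)).
by congr (_ + _ * _); apply: cint_ext => t _; rewrite mulrBr.
Qed.

Lemma sctnB_sint f g r : sctn f r -> sctn g r ->
  sint (fun z => f z - g z) r = sint f r - sint g r.
Proof.
move=> [f1 f2 f3 f4] [g1 g2 g3 g4].
rewrite /sint /rint opprD addrACA -mulrBr -!cintB//; [|exact: ctnB..].
by congr (_ + _ * _); apply: cint_ext => t _; ring.
Qed.

Lemma sint_ext f g r : 0 < r -> (forall z, sqb r z -> f z = g z) -> sint f r = sint g r.
Proof. by move=> r0 H; apply: rint_ext => //; lra. Qed.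

Lemma sctn_bound f r M : 0 < r -> sctn f r -> (forall z, sqb r z -> cn (f z) <= M) ->
  cn (sint f r) <= 8 * r * M.
Proof.
move=> r0 [f1 f2 f3 f4] B; have rr : - r <= r by lra.
rewrite /sint /rint (le_trans (cnD _ _))//.
have -> : 8 * r * M = (r - - r) * (2 * M) + (r - - r) * (2 * M) by ring.
have sb (t : R) : - r <= t <= r -> [/\ sqb r (t +i* - r)%C, sqb r (t +i* r)%C,
    sqb r (- r +i* t)%C & sqb r (r +i* t)%C].
  by move=> /andP[t1 t2]; split; rewrite /sqb /onb /inr /= t1 t2 ?rr ?lexx ?eqxx ?orbT.
apply: lerD; last (rewrite (le_trans (cnM _ _))// cn_i mul1r);
  apply: cint_bound => //; try exact: ctnB; move=> t /sb[s1 s2 s3 s4].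
- by have := cnB (f (t +i* - r)%C) (f (t +i* r)%C); have := B _ s1; have := B _ s2; lra.
- by have := cnB (f (r +i* t)%C) (f (- r +i* t)%C); have := B _ s3; have := B _ s4; lra.
Qed.

End SquareCompactness.

(** * Derivatives in several variables and integrals depending on a parameter *)

Section VecNorm.
Variables (R : realType) (d : nat).
Local Notation C := R[i].
Local Notation V := 'rV[R[i]]_d.
Implicit Types (z w u v : V).

Definition vn z : R := \sum_j cn (z 0 j).

Lemma vn_ge0 z : 0 <= vn z. Proof. by apply: sumr_ge0 => j _; exact: cn_ge0. Qed.

Lemma vn0 : vn 0 = 0. Proof. by rewrite /vn big1// => j _; rewrite mxE cn0. Qed.

Lemma vnN z : vn (- z) = vn z.
Proof. by apply: eq_bigr => j _; rewrite mxE cnN. Qed.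

Lemma vnD z w : vn (z + w) <= vn z + vn w.
Proof. by rewrite -big_split; apply: ler_sum => j _; rewrite mxE cnD. Qed.

Lemma vn_sym z w : vn (z - w) = vn (w - z).
Proof. by rewrite -opprB vnN. Qed.

Lemma vnZ (a : C) z : vn (a *: z) <= cn a * vn z.
Proof. by rewrite mulr_sumr; apply: ler_sum => j _; rewrite mxE cnM. Qed.

Lemma vn_coord z j : cn (z 0 j) <= vn z.
Proof.
by rewrite /vn (bigD1 j)//= lerDl; apply: sumr_ge0 => i _; exact: cn_ge0.
Qed.

Lemma subrr_vn z : vn (z - z) <= 0. Proof. by rewrite subrr vn0. Qed.

Lemma vn_eq0 z : vn z = 0 -> z = 0.
Proof.
move=> h; apply/rowP => j; rewrite mxE; apply: cn_eq0; apply/eqP.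
by rewrite eq_le cn_ge0 andbT -h vn_coord.
Qed.

Lemma vn_gt0 z : z != 0 -> 0 < vn z.
Proof. by move=> z0; rewrite lt0r vn_ge0 andbT; apply: contra_neq z0; exact: vn_eq0. Qed.

Lemma vn_dist z w v : vn (z - v) <= vn (z - w) + vn (w - v).
Proof. by have := vnD (z - w) (w - v); rewrite addrA subrK. Qed.

Definition vopn (U : set V) := forall z, U z -> exists2 r : R, 0 < r &
  forall w, vn (w - z) < r -> U w.

Definition hol (U : set V) (f : V -> C) := vopn U /\ forall z, U z -> dif vn f z.

(** Chosen classically, and zero where [f] is not differentiable, so that it is a total operation
    that can be iterated. *)
Definition Dv (f : V -> C) z : V -> C :=
  match pselect (dif vn f z) with left h => projT1 (cid h) | right _ => fun=> 0 end.

Lemma DvP f z : dif vn f z -> isd vn f z (Dv f z).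
Proof. by move=> h; rewrite /Dv; case: pselect => // h'; case: cid. Qed.

Lemma isd_line (f : V -> C) z u (s : C) L : isd vn f (z + s *: u) L ->
  isd (V := R[i]^o) (@cn R) (fun t : C => f (z + t *: u)) s (fun h => L (h *: u)).
Proof.
move=> H.
have := @isd_aff R V (R[i]^o) vn (@cn R) (fun t : C => z + t *: u) (vn u) f s L
  (@cn_ge0 R) (vn_ge0 u).
have -> : (fun w : R[i]^o => L (z + w *: u - (z + 0 *: u))) = (fun h => L (h *: u)).
  by apply/funext => h; rewrite scale0r addr0 addrC addKr.
apply => //.
- move=> w t a; rewrite opprD addrACA subrr add0r -scalerBl scale0r addr0.
  rewrite [in RHS]addrC addKr scalerA; congr (_ *: _).
  by rewrite addrK.
- by move=> w t; rewrite scale0r addr0 opprD addrACA subrr add0r -scalerBl [RHS]addrC addKr.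
- by move=> w; rewrite scale0r addr0 addrC addKr mulrC vnZ.
Qed.

Lemma cdif_line (f : V -> C) z u (s : C) : dif vn f (z + s *: u) ->
  cdif (fun t : C => f (z + t *: u)) s.
Proof. by move=> [L HL]; exists (fun h => L (h *: u)); exact: isd_line. Qed.

Lemma opn_line (U : set V) z u : vopn U -> opn [set s : C | U (z + s *: u)].
Proof.
move=> oU s /= /oU[r r0 Hr]; have u0 := vn_ge0 u.
exists (r / (vn u + 1)) => [|w wr]; first by rewrite divr_gt0// ltr_wpDl.
apply: Hr; rewrite opprD addrACA subrr add0r -scalerBl (le_lt_trans (vnZ _ _))//.
move: wr; rewrite ltr_pdivlMr ?ltr_wpDl// mulrDr mulr1 => h.
by have := cn_ge0 (w - s); lra.
Qed.

Lemma dif_trans (f : V -> C) c z : dif vn f (z + c) -> dif vn (fun w => f (w + c)) z.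
Proof.
move=> [L HL].
have := @isd_aff R V V vn vn (fun w => w + c) 1 f z L vn_ge0 ler01.
move=> /(_ _ _ _ HL) H; exists (fun w => L (w + c - (0 + c))); apply: H.
- by move=> w t a; apply/rowP => j; rewrite !mxE; ring.
- by move=> w t; apply/rowP => j; rewrite !mxE; ring.
- by move=> w; rewrite add0r addrK mul1r.
Qed.

(** Each direction reduces to [cauchy_quad] on a complex line, with half side [rho / (2 * vn u)]:
    points of that square have norm at most twice this, so the line stays in the ball. For
    [vn u <= rho / 4] the parameter 1 lies in the half-size square. *)
Lemma dv_quad : exists K : R, 0 < K /\ forall f (U : set V) z (rho M : R) L,
  0 < rho -> hol U f ->
  (forall w, vn (w - z) <= rho -> U w /\ cn (f w - f z) <= M) -> isd vn f z L ->
  (forall u, cn (L u) <= K * M / rho * vn u) /\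
  (forall u, vn u <= rho / 4 -> cn (f (z + u) - f z - L u) <= K * M / rho ^+ 2 * vn u ^+ 2).
Proof.
have [K [K0 HK]] := cauchy_quad R; exists (4 * K); split; first by rewrite mulr_gt0.
move=> f U z rho M L rho0 [oU fU] HM Lf.
have M0 : 0 <= M.
  by have [_] := HM z ltac:(by rewrite subrr vn0 ltW); exact: le_trans (cn_ge0 _).
have key u : u != 0 -> cn (L u) <= 4 * K * M / rho * vn u /\ (vn u <= rho / 4 ->
    cn (f (z + u) - f z - L u) <= 4 * K * M / rho ^+ 2 * vn u ^+ 2).
  move=> u0; have nu := vn_gt0 u0; pose r := rho / (2 * vn u).
  have r0 : 0 < r by rewrite divr_gt0// mulr_gt0.
  have inU s : sq r s -> vn (z + s *: u - z) <= rho.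
    move=> /sq_cn h; rewrite addrC addKr (le_trans (vnZ _ _))//.
    rewrite (le_trans (ler_wpM2r (ltW nu) h))// /r le_eqVlt; apply/orP; left.
    by apply/eqP; field; rewrite gt_eqF.
  have Lf' : isd (V := R[i]^o) (@cn R) (fun t : C => f (z + t *: u) - f z) 0 (fun h => L (h *: u)).
    have : isd (V := R[i]^o) (@cn R) (fun t : C => f (z + t *: u)) 0 (fun h => L (h *: u)).
      by apply: isd_line; rewrite scale0r addr0.
    case=> h1 h2 h3; split=> // e e0; have [s s0 Hs] := h3 e e0.
    by exists s => // w ws; rewrite opprB addrA subrK; exact: Hs.
  have cd s : U (z + s *: u) -> cdif (fun t : C => f (z + t *: u) - f z) s.
    by move=> sU; apply: cdifB; [exact/cdif_line/fU|exact: cdif_cst].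
  have [h1 h2 _] := HK (fun t : C => f (z + t *: u) - f z) [set s | U (z + s *: u)]
    r M _ r0 (opn_line oU) cd (fun s hs => (HM _ (inU s hs)).1)
    (fun s hs => (HM _ (inU s hs)).2) Lf'.
  rewrite scale1r in h1 h2; split.
    rewrite (le_trans h1)// /r.
    have -> : K * M / (rho / (2 * vn u)) = 2 * K * M / rho * vn u.
      by field; rewrite !gt_eqF.
    rewrite ler_wpM2r ?(ltW nu)// ler_wpM2r ?invr_ge0 ?(ltW rho0)// ler_wpM2r//.
    lra.
  move=> u4; have := h2 1 _; rewrite scale0r addr0 subrr subr0 scale1r mul1r cn1 expr1n mulr1.
  have -> : K * M / r ^+ 2 = 4 * K * M / rho ^+ 2 * vn u ^+ 2.
    by rewrite /r; field; rewrite !gt_eqF.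
  apply; have r2 : 1 <= r / 2.
    by rewrite /r -mulrA -invfM ler_pdivlMr ?mulr_gt0//; lra.
  by apply/and4P; split => /=; lra.
have L0 : L 0 = 0.
  have [/(_ 0 0 0) + _ _] := Lf; rewrite scaler0 add0r mul0r add0r => _.
  by have [/(_ (-1) 0 0) + _ _] := Lf; rewrite scaler0 add0r mulN1r addNr.
split=> u; have [->|u0] := eqVneq u 0.
- by rewrite L0 cn0 vn0 mulr0.
- by have [] := key u u0.
- by rewrite addr0 subrr L0 subr0 cn0 vn0 expr0n mulr0.
- by have [] := key u u0.
Qed.

Lemma Dv_formula f (U : set V) z u (r : R) L : 0 < r -> hol U f ->
  (forall s, sq r s -> U (z + s *: u)) -> isd vn f z L ->
  L u * W r 0 = sint (fun s : C => (f (z + s *: u) - f z) / s ^+ 2) r.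
Proof.
move=> r0 [oU fU] HU Lf.
have Lf' : isd (V := R[i]^o) (@cn R) (fun t : C => f (z + t *: u)) 0 (fun h => L (h *: u)).
  by apply: isd_line; rewrite scale0r addr0.
have [K [_ HK]] := cauchy_quad R.
have cd s : U (z + s *: u) -> cdif (fun t : C => f (z + t *: u)) s.
  by move=> sU; exact/cdif_line/fU.
have [M HM] := cdif_bounded (fun s hs => cd s (HU s hs)).
have [_ _] := HK (fun t : C => f (z + t *: u)) [set s | U (z + s *: u)]
    r M _ r0 (opn_line oU) cd HU HM Lf'.
by rewrite scale1r scale0r addr0.
Qed.

(** By [tube_sq] the functions [phi s] vary by at most 1 on a common ball, so [dv_quad] gives a
    quadratic remainder that is uniform in [s] and can be integrated. What remains is continuity of
    the derivative in [s]. *)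
Lemma hol_sint (U : set V) (phi : C -> V -> C) (r : R) : 0 < r -> vopn U ->
  (forall s z, sqb r s -> U z -> dif vn (phi s) z) ->
  (forall s z, sqb r s -> U z -> jc (sqb r) setT (fun w => vn (w - z)) phi s z) ->
  forall z, U z -> dif vn (fun z => sint (phi^~ z) r) z.
Proof.
move=> r0 oU pd pj z zU; have [K [K0 HK]] := dv_quad.
have rr : - r <= r by lra.
have phic w : U w -> sctn (phi^~ w) r.
  move=> wU; apply: scnt_sctn => s sb e e0.
  have [dl dl0 H] := pj s w sb wU e e0; exists dl => // s' sb' ss.
  by apply: H => //; rewrite subrr vn0.
have [s0 s00 HU] := oU z zU.
have [dl dl0 Hdl] := tube_sq rr (fun s sb => pj s z sb zU) I (@subrr_vn z) ltr01.
pose rho := Num.min s0 dl / 2.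
have rho0 : 0 < rho by rewrite divr_gt0// lt_min s00.
have [rs rd] : rho < s0 /\ rho < dl.
  have m1 : Num.min s0 dl <= s0 by rewrite ge_min lexx.
  have m2 : Num.min s0 dl <= dl by rewrite ge_min lexx orbT.
  by rewrite /rho; split; lra.
pose U0 : set V := [set w | vn (w - z) < s0].
have oU0 : vopn U0.
  move=> w; rewrite /U0 /= => ws; exists (s0 - vn (w - z)) => [|v vw]; first lra.
  by have := vn_dist v w z; rewrite /U0 /=; lra.
have hphi s : sqb r s -> hol U0 (phi s).
  by move=> sb; split=> // w /HU; exact: pd.
have Hb s : sqb r s -> forall w, vn (w - z) <= rho -> U0 w /\ cn (phi s w - phi s z) <= 1.
  move=> sb w wr; split; first by rewrite /U0 /= (le_lt_trans wr).
  by apply/ltW/Hdl => //; rewrite (le_lt_trans wr).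
pose L s := Dv (phi s) z.
have LP s : sqb r s -> isd vn (phi s) z (L s) by move=> sb; exact/DvP/pd.
have Lq s (sb : sqb r s) := HK (phi s) U0 z rho 1 (L s) rho0 (hphi s sb) (Hb s sb) (LP s sb).
(* By [Dv_formula] the derivative along [u] is an integral of values of [phi s] over a small square,
   where these are uniformly continuous in [s]. The tolerance [e * q / 160] grows to [9 / 10 * e]
   through the factors [8 * q], 2, [4 / q ^ 2] and 9/4. *)
have Lc u : scnt (L^~ u) r.
  move=> s sb e e0; have u0 := vn_ge0 u.
  pose q := rho / (2 * (vn u + 1)).
  have u1 : 0 < vn u + 1 by lra.
  have q0 : 0 < q by rewrite divr_gt0// mulr_gt0.
  have qU x : sq q x -> vn (z + x *: u - z) <= rho.
    move=> /sq_cn h; rewrite addrC addKr (le_trans (vnZ _ _))//.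
    rewrite (le_trans (ler_wpM2r u0 h))//.
    have : 2 * q * (vn u + 1) = rho by rewrite /q; field; rewrite gt_eqF.
    by rewrite mulrDr mulr1 => <-; rewrite lerDl mulr_ge0// ltW.
  have qr : - q <= q by lra.
  have e1 : 0 < e * q / 160 by rewrite divr_gt0// mulr_gt0.
  have J x : sqb q x -> jc (sqb q) (sqb r) (fun s' => cn (s' - s)) (fun x s' => phi s' (z + x *: u)) x s.
    move=> /sqb_sq/qU xr e' e'0; have := pj s (z + x *: u) sb (HU _ _).
    move=> /(_ (le_lt_trans xr rs) e' e'0)[dl' dl'0 H].
    exists (Num.min dl' (dl' / (vn u + 1))) => [|x' s' _ s'b].
      by rewrite lt_min dl'0 divr_gt0.
    rewrite !lt_min => /andP[_ xx] /andP[ss _]; apply: H => //.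
    rewrite opprD addrACA subrr add0r -scalerBl (le_lt_trans (vnZ _ _))//.
    move: xx; rewrite ltr_pdivlMr// mulrDr mulr1 => h.
    by have := cn_ge0 (x' - x); lra.
  have ss0 : cn (s - s) <= 0 by rewrite subrr cn0.
  have [dl1 dl10 H1] := tube_sq qr J sb ss0 e1.
  have [dl2 dl20 H2] := pj s z sb zU _ e1.
  exists (Num.min dl1 dl2) => [|s' s'b]; first by rewrite lt_min dl10.
  rewrite lt_min => /andP[/(H1 _ _ _ s'b) h1 h2].
  have h3 := H2 s' z s'b I h2 ltac:(by rewrite subrr vn0).
  have qU0 x : sq q x -> U0 (z + x *: u) by move=> /qU h; rewrite /U0 /= (le_lt_trans h).
  have F1 := Dv_formula q0 (hphi s' s'b) qU0 (LP s' s'b).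
  have F2 := Dv_formula q0 (hphi s sb) qU0 (LP s sb).
  have bd s'' : sqb r s'' -> bdif (fun x => (phi s'' (z + x *: u) - phi s'' z) / x ^+ 2) (- q) q (- q) q.
    move=> hs x xb; apply: cdif_div; first by rewrite expf_neq0// (sqb_neq0 q0).
      apply: cdifB; last exact: cdif_cst.
      by apply: cdif_line; apply: pd => //; apply: HU; exact/qU0/sqb_sq.
    by apply: cdifX; exact: cdif_id.
  have F : (L s' u - L s u) * W q 0 = rint (fun x : C => (phi s' (z + x *: u) - phi s' z) / x ^+ 2 -
      (phi s (z + x *: u) - phi s z) / x ^+ 2) (- q) q (- q) q.
    by rewrite mulrBl F1 F2 /sint -rintB//; exact: bd.
  have sq00 : sq (q / 2) 0 by rewrite sq0// divr_ge0// ltW.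
  have B : cn (rint (fun x : C => (phi s' (z + x *: u) - phi s' z) / x ^+ 2 -
      (phi s (z + x *: u) - phi s z) / x ^+ 2) (- q) q (- q) q) <= 8 * q * (2 * (e * q / 160) * (4 / q ^+ 2)).
    apply: sint_bound => //.
      by move=> x xb; apply: cdifB; exact: bd.
    move=> x xb; rewrite -mulrBl (le_trans (cnM _ _))// ler_pM ?cn_ge0//.
      rewrite (_ : _ - _ = (phi s' (z + x *: u) - phi s (z + x *: u)) - (phi s' z - phi s z)); last ring.
      by have := cnB (phi s' (z + x *: u) - phi s (z + x *: u)) (phi s' z - phi s z); have := h1 x xb; lra.
    rewrite -exprVn (le_trans (cnX _ _))// (_ : 4 / q ^+ 2 = (2 / q) ^+ 2).
      have q20 : 0 <= 2 / q by apply: divr_ge0 => //; exact: ltW.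
      by apply: lerXn2r; rewrite ?nnegrE ?cn_ge0//; exact: (sqb_cnV q0 xb).
    by field; rewrite gt_eqF.
  apply: (le_lt_trans (cn_divW_le q0 sq00 F B)).
  have -> : 9 / 4 * (8 * q * (2 * (e * q / 160) * (4 / q ^+ 2))) = 9 / 10 * e.
    by field; rewrite gt_eqF.
  lra.
have Ls u : sctn (L^~ u) r by exact: scnt_sctn.
have KR0 : 0 <= K * 1 / rho by apply: divr_ge0; [rewrite mulr1|]; exact: ltW.
have KR1 : 0 <= K * 1 / rho ^+ 2.
  by apply: divr_ge0; [rewrite mulr1; exact: ltW|exact: exprn_ge0 (ltW rho0)].
have r80 : 0 <= 8 * r by rewrite mulr_ge0// ltW.
exists (fun u => sint (L^~ u) r); split.
- move=> a u v; rewrite -sctnZ_sint// -sctnD_sint//; last exact: sctnZ.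
  by apply: sint_ext => // s sb; have [-> _ _] := LP s sb.
- exists (8 * r * (K * 1 / rho)); split; first exact: mulr_ge0.
  move=> u; rewrite -(mulrA _ _ (vn u)); apply: sctn_bound => // s sb.
  by have [+ _] := Lq s sb; exact.
move=> e e0.
pose A := 8 * r * (K * 1 / rho ^+ 2) + 1.
have A0 : 0 < A by apply: ltr_wpDl => //; exact: mulr_ge0.
exists (Num.min (rho / 4) (e / A)) => [|w]; first by rewrite lt_min; apply/andP; split; exact: divr_gt0.
rewrite lt_min => /andP[w1 w2].
have wU : U w by apply: HU; lra.
rewrite -sctnB_sint//; [|exact: phic..]; rewrite -sctnB_sint//; last first.
  by apply: sctnB; exact: phic.
apply: (@le_trans _ _ (8 * r * (K * 1 / rho ^+ 2 * vn (w - z) ^+ 2))).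
  apply: sctn_bound => // [|s sb].
    by apply: sctnB => //; apply: sctnB; exact: phic.
  have [_ /(_ (w - z) (ltW w1))] := Lq s sb.
  by rewrite [z + _]addrC subrK.
rewrite (_ : _ * (_ * _ ^+ 2) = 8 * r * (K * 1 / rho ^+ 2) * vn (w - z) * vn (w - z)).
  2: by rewrite expr2 !mulrA.
rewrite ler_wpM2r ?vn_ge0//.
move: w2; rewrite ltr_pdivlMr// /A mulrDr mulr1 => w2.
rewrite mulrC; apply: le_trans (ltW w2); rewrite mulr1 lerDl.
exact: vn_ge0.
Qed.

End VecNorm.

Arguments vn {R d} z.

(** * Joint continuity of integrands *)

Section JointContinuity.
Variables (R : realType) (d : nat).
Local Notation C := R[i].
Local Notation V := 'rV[R[i]]_d.
Variables (S : C -> bool).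
Local Notation jcv := (fun phi s w => jc S setT (fun v : V => vn (v - w)) phi s w).

Lemma jcM (phi psi : C -> V -> C) s w : jcv phi s w -> jcv psi s w ->
  jcv (fun s w => phi s w * psi s w) s w.
Proof.
move=> H K e e0; pose A := cn (phi s w) + cn (psi s w) + 2.
have p0 := cn_ge0 (phi s w); have q0 := cn_ge0 (psi s w).
have A0 : 0 < A by rewrite /A; lra.
have e1 : 0 < Num.min 1 (e / A) by rewrite lt_min ltr01 divr_gt0.
have [r r0 Hr] := H _ e1; have [q q0' Hq] := K _ e1.
exists (Num.min r q) => [|s' w' Ss _]; first by rewrite lt_min r0.
rewrite !lt_min => /andP[a1 a2] /andP[b1 b2].
have := Hr s' w' Ss I a1 b1; have := Hq s' w' Ss I a2 b2.
rewrite !lt_min !ltr_pdivlMr// => /andP[h1 h2] /andP[h3 h4].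
have -> : phi s' w' * psi s' w' - phi s w * psi s w =
   (phi s' w' - phi s w) * (psi s' w' - psi s w) + phi s w * (psi s' w' - psi s w)
   + (phi s' w' - phi s w) * psi s w by ring.
have num (x y P Q : R) : 0 <= x -> 0 <= y -> 0 <= P -> 0 <= Q -> x < 1 ->
    x * (P + Q + 2) < e -> y * (P + Q + 2) < e -> x * y + P * y + x * Q < e.
  move=> x0 y0 P0 Q0 x1 hx hy.
  have xy : x * y <= y by rewrite ler_piMl// ltW.
  have hx' : x * P + x * Q + x * 2 < e by rewrite -!mulrDr.
  have hy' : y * P + y * Q + y * 2 < e by rewrite -!mulrDr.
  have m1 := mulr_ge0 y0 Q0; have m2 := mulr_ge0 x0 P0.
  have [ab|/ltW ba] := leP x y.
    have : x * Q <= y * Q by rewrite ler_wpM2r.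
    by rewrite [P * y]mulrC; clear -hy' xy y0; lra.
  have : P * y <= P * x by rewrite ler_wpM2l.
  by rewrite [P * x]mulrC; clear -hx' xy x0 ba; lra.
have := num _ _ _ _ (cn_ge0 _) (cn_ge0 _) p0 q0 h3 h4 h2.
apply: le_lt_trans; apply: (le_trans (cnD _ _)); rewrite lerD ?cnM//.
by apply: (le_trans (cnD _ _)); rewrite lerD ?cnM.
Qed.

Lemma jcB (phi psi : C -> V -> C) s w : jcv phi s w -> jcv psi s w ->
  jcv (fun s w => phi s w - psi s w) s w.
Proof.
move=> H K e e0; have e1 : 0 < e / 2 by lra.
have [r r0 Hr] := H _ e1; have [q q0' Hq] := K _ e1.
exists (Num.min r q) => [|s' w' Ss _]; first by rewrite lt_min r0.
rewrite !lt_min => /andP[a1 a2] /andP[b1 b2].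
have := Hr s' w' Ss I a1 b1; have := Hq s' w' Ss I a2 b2.
have := cnB (phi s' w' - phi s w) (psi s' w' - psi s w).
have -> : phi s' w' - psi s' w' - (phi s w - psi s w) =
   (phi s' w' - phi s w) - (psi s' w' - psi s w) by ring.
by lra.
Qed.

Lemma jc_cntl (h : C -> C) s w : cnt (V := R[i]^o) (@cn R) h s -> jcv (fun s _ => h s) s w.
Proof. by move=> H e /H[r r0 Hr]; exists r => // s' w' _ _ ss _; exact: Hr. Qed.

Lemma jc_cntr (h : V -> C) s w : cnt vn h w -> jcv (fun _ w => h w) s w.
Proof. by move=> H e /H[r r0 Hr]; exists r => // s' w' _ _ _ ww; exact: Hr. Qed.

Lemma jc_comp (h : C -> C) (phi : C -> V -> C) s w :
  cnt (V := R[i]^o) (@cn R) h (phi s w) -> jcv phi s w -> jcv (fun s w => h (phi s w)) s w.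
Proof.
move=> H K e /H[r r0 Hr]; have [q q0 Hq] := K r r0.
by exists q => // s' w' Ss _ ss ww; apply: Hr; exact: Hq.
Qed.

Lemma jc_aff m (A : C -> V -> 'rV[R[i]]_m) (K : R) (f : 'rV[R[i]]_m -> C) s w :
  0 < K -> (forall s' w', vn (A s' w' - A s w) <= K * (cn (s' - s) + vn (w' - w))) ->
  cnt vn f (A s w) -> jcv (fun s w => f (A s w)) s w.
Proof.
move=> K0 AK H e /H[r r0 Hr]; exists (r / K / 2) => [|s' w' _ _ ss ww].
  by rewrite !divr_gt0.
apply: Hr; rewrite (le_lt_trans (AK _ _))// mulrC -ltr_pdivlMr//.
by rewrite [ltRHS]splitr ltrD.
Qed.

End JointContinuity.

(** * Iterated directional derivatives and the spread of zeros *)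

Section HolTheory.
Variables (R : realType) (d : nat).
Local Notation C := R[i].
Local Notation V := 'rV[R[i]]_d.
Implicit Types (U : set V) (f g : V -> C) (u : V).

Lemma Dv_scale f z (a : C) u : dif vn f z -> Dv f z (a *: u) = a * Dv f z u.
Proof.
move=> /DvP[H _ _]; have L0 : Dv f z 0 = 0.
  by have := H (-1) 0 0; rewrite scaler0 add0r mulN1r addNr.
by have := H a u 0; rewrite L0 !addr0.
Qed.

Lemma dif_vcnt f z : dif vn f z -> cnt vn f z.
Proof. exact: dif_cnt. Qed.

Lemma vopn_ball z (r : R) : vopn [set w : V | vn (w - z) < r].
Proof.
move=> w /= wr; exists (r - vn (w - z)) => [|v vw /=]; first by rewrite subr_gt0.
by have := vn_dist v w z; lra.
Qed.

Lemma hol_sub U U' f : vopn U' -> U' `<=` U -> hol U f -> hol U' f.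
Proof. by move=> oU' UU [oU fU]; split=> // z /UU; exact: fU. Qed.

(** By [Dv_formula] the derivative is, up to the factor [W r 0], an integral of difference quotients
    in which [z] is a parameter, so [hol_sint] applies. *)
Lemma hol_Dv U f u : hol U f -> hol U (fun z => Dv f z u).
Proof.
move=> [oU fU]; split=> // z zU; have [rho rho0 HU] := oU z zU.
have u0 := vn_ge0 u; have u1 : 0 < vn u + 1 by lra.
pose r := rho / (4 * (vn u + 1)).
have [r0 rE] : 0 < r /\ 4 * (r * (vn u + 1)) = rho.
  by split; [rewrite divr_gt0// mulr_gt0|rewrite /r; field; rewrite gt_eqF].
clearbody r; pose U0 : set V := [set w | vn (w - z) < rho / 2].
have inU w s : U0 w -> sq r s -> U (w + s *: u).
  rewrite /U0 /= => wz sr; apply: HU; have := vn_dist (w + s *: u) w z.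
  rewrite [w + _ - w]addrC addKr => h; have := vnZ s u; have := sq_cn sr => h1 h2.
  have h3 : cn s * vn u <= 2 * r * vn u by rewrite ler_wpM2r.
  have rE' : 4 * (r * vn u) + 4 * r = rho by rewrite -rE; ring.
  by have := mulr_ge0 (ltW r0) u0; rewrite -mulrA in h3; lra.
have sq00 : sq (r / 2) (0 : C) by rewrite sq0// divr_ge0// ltW.
have sqr0 : sq r (0 : C) by rewrite sq0// ltW.
have U0U w : U0 w -> U w by move=> /inU/(_ sqr0); rewrite scale0r addr0.
pose phi (s : C) w := (f (w + s *: u) - f w) / s ^+ 2.
have zU0 : U0 z by rewrite /U0 /= subrr vn0 divr_gt0.
have pd s w : sqb r s -> U0 w -> dif vn (phi s) w.
  move=> sb wU; apply: difM; last exact: dif_cst (@vn_ge0 R d) _ _.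
    exact: vn_ge0.
  apply: difB; [exact: vn_ge0| |exact/fU/U0U].
  by apply: dif_trans; apply: fU; apply: inU => //; exact: sqb_sq.
have pj s w : sqb r s -> U0 w -> jc (sqb r) setT (fun v => vn (v - w)) phi s w.
  move=> sb wU; apply: jcM; last first.
    apply: (@jc_cntl R d (sqb r) (fun s => (s ^+ 2)^-1)).
    apply: dif_cnt.
    have := @cdif_div R (fun=> 1) (fun s => s ^+ 2) s ltac:(by rewrite expf_neq0// (sqb_neq0 r0)) (cdif_cst _ _) (cdif_sq s).
    by congr (cdif _ _); apply/funext => x; rewrite mul1r.
  apply: jcB; last by apply: jc_cntr; exact/dif_vcnt/fU/U0U.
  apply: (@jc_aff R d (sqb r) d (fun s w => w + s *: u) (vn u + 1) f s w) => //.
    move=> s' w'; rewrite opprD addrACA -scalerBl (le_trans (vnD _ _))//.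
    have := vnZ (s' - s) u; have := mulr_ge0 u0 (vn_ge0 (w' - w)).
    have := cn_ge0 (s' - s); move: (vn _) (vn _) (vn _) (cn _) => A B D E.
    by rewrite (_ : (_ + 1) * _ = E * D + E + D * B + B); [lra|ring].
  by apply/dif_vcnt/fU/inU => //; exact: sqb_sq.
have H := hol_sint r0 (@vopn_ball z (rho / 2)) pd pj zU0.
have W0 := W_neq0 r0 sq00.
have Wf w : U0 w -> Dv f w u = (W r 0)^-1 * sint (phi^~ w) r.
  move=> wU; have := Dv_formula r0 (conj oU fU) (fun s => @inU w s wU) (DvP (fU w (U0U w wU))).
  by rewrite -/(phi^~ w) => <-; rewrite mulrCA mulVf// mulr1.
apply: (@dif_ext R V vn (fun w => (W r 0)^-1 * sint (phi^~ w) r)); last exact: (dif_scale (@vn_ge0 R d)).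
  by exists (rho / 2) => [|w wz]; [rewrite divr_gt0|rewrite Wf].
by rewrite Wf.
Qed.

(** On the line from [p] to [w] the function vanishes near 0, so [flat_zero] with half side 16
    reaches all of [sq 1], in particular the parameter 1. *)
Lemma zero_spread U f p w : hol U f -> (forall s : C, sq 16 s -> U (p + s *: (w - p))) ->
  (exists2 e : R, 0 < e & forall v, vn (v - p) < e -> f v = 0) -> f w = 0.
Proof.
move=> [oU fU] HU [e e0 He]; set u := w - p; have u0 := vn_ge0 u.
have cd s : U (p + s *: u) -> cdif (fun t : C => f (p + t *: u)) s.
  by move=> sU; exact/cdif_line/fU.
have [M HM] := cdif_bounded (fun s hs => cd s (HU s hs)).
have F := @flat_zero R (fun t : C => f (p + t *: u)) [set s | U (p + s *: u)] 16
  ltac:(lra) (opn_line oU) cd HU (ex_intro _ M (fun s hs => HM s (sqb_sq hs))).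
have -> : w = p + 1 *: u by rewrite scale1r /u addrC subrK.
apply: F.
  move=> m; exists 0, (e / (vn u + 1)); split; first by rewrite divr_gt0// ltr_wpDl.
  move=> s; rewrite ltr_pdivlMr ?ltr_wpDl// mulrDr mulr1 => h.
  rewrite He ?cn0 ?mul0r// addrC addKr (le_lt_trans (vnZ _ _))//.
  by rewrite -/u; have := cn_ge0 s; lra.
by apply/and4P; split => /=; lra.
Qed.

Definition flat f z := exists2 e : R, 0 < e & forall v, vn (v - z) < e -> f v = 0.

(** The vector [w - p] is shorter than [2 * rho / 130] and parameters in [sq 16] have norm at most
    32, so the lines stay within [65 * rho / 130], half of [rho]. Because the ratio 130 is
    universal, limits of flat points inside the domain are flat. *)
Lemma flat_spread U f z (rho : R) p : hol U f -> 0 < rho ->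
  (forall w, vn (w - z) < rho -> U w) -> vn (p - z) < rho / 130 -> flat f p -> flat f z.
Proof.
move=> fU rho0 HU pz pf; exists (rho / 130) => [|w wz]; first by rewrite divr_gt0.
apply: (zero_spread fU) pf => s /sq_cn s16; apply: HU.
have := vn_dist (p + s *: (w - p)) p z; rewrite [p + _ - p]addrC addKr.
have := vnZ s (w - p); have := vn_dist w z p; rewrite (vn_sym z p).
have := vn_ge0 (w - p) => h0 h1 h2 h3.
have : cn s * vn (w - p) <= 2 * 16 * vn (w - p) by rewrite ler_wpM2r.
by lra.
Qed.

(** If all iterated derivatives along [u] vanished at [z], then [flat_of_derivs] would make [f] flat
    to infinite order on the line, and [flat_zero] would force [f (z + u) = 0]. *)
Lemma line_order U f z u (rho : R) : hol U f -> 0 < rho ->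
  (forall w, vn (w - z) < rho -> U w) -> vn u < rho / 130 -> f (z + u) != 0 ->
  exists m : nat, iter m (fun g v => Dv g v u) f z != 0.
Proof.
move=> fU rho0 HU ur nz; apply: contrapT => H.
pose g k := iter k (fun g v => Dv g v u) f.
have g0 k : g k z = 0 by apply/eqP/negPn/negP => h; apply: H; exists k.
have gh k : hol U (g k) by elim: k => // k IH; exact: hol_Dv.
have inU (s : C) : sq 16 s -> U (z + s *: u).
  move=> /sq_cn h; apply: HU; rewrite addrC addKr (le_lt_trans (vnZ _ _))//.
  have : cn s * vn u <= 2 * 16 * vn u by rewrite ler_wpM2r// vn_ge0.
  by have := vn_ge0 u; lra.
have [oU fd] := fU.
have cd s : U (z + s *: u) -> cdif (fun t : C => f (z + t *: u)) s.
  by move=> sU; exact/cdif_line/fd.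
have [M HM] := cdif_bounded (fun s hs => cd s (inU s hs)).
have F := @flat_of_derivs R (fun k t => g k (z + t *: u)) 16 ltac:(lra).
have F1 m := F _ _ m 0%N.
have F2 := @flat_zero R (fun t : C => f (z + t *: u)) [set s | U (z + s *: u)] 16
  ltac:(lra) (opn_line oU) cd inU (ex_intro _ M (fun s hs => HM s (sqb_sq hs))).
move/eqP: nz; apply; have := F2 _ 1; rewrite scale1r; apply.
  apply: F1 => [k s /inU sU|k]; last by rewrite scale0r addr0.
  have [_ gd] := gh k; have := isd_line (DvP (gd _ sU)).
  congr (isd _ _ _ _); apply/funext => h; rewrite Dv_scale; first by [].
  exact: gd.
by apply/and4P; split => /=; lra.
Qed.

End HolTheory.

(** * Covering content and zero sets *)

Section StrictDif.
Variables (R : realType) (d : nat).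
Local Notation C := R[i].
Local Notation V := 'rV[R[i]]_d.
Implicit Types (U : set V) (f g : V -> C) (u : V).

Lemma isd_sum f (z : V) L v : isd vn f z L ->
  L v = \sum_j v 0 j * L (delta_mx 0 j).
Proof.
case=> Ll _ _; have L0 : L 0 = 0.
  by have := Ll (-1) 0 0; rewrite scaler0 add0r mulN1r addNr.
rewrite {1}[v]row_sum_delta; elim/big_ind2: _ => //.
  by move=> x1 x2 y1 y2 <- <-; have := Ll 1 x2 y2; rewrite scale1r mul1r.
by move=> j _; have := Ll (v 0 j) (delta_mx 0 j) 0; rewrite L0 !addr0.
Qed.

(** A harmonic combination lies below every [dl i] and makes sense for an empty index type too. *)
Lemma fin_min (I : finType) (dl : I -> R) : (forall i, 0 < dl i) ->
  exists2 m : R, 0 < m & forall i, m <= dl i.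
Proof.
move=> dl0; have S0 : 0 <= \sum_i (dl i)^-1 by apply: sumr_ge0 => i _; rewrite invr_ge0 ltW.
exists (1 + \sum_i (dl i)^-1)^-1 => [|i]; first by rewrite invr_gt0 ltr_wpDr.
rewrite -[leRHS]invrK lef_pV2 ?posrE ?invr_gt0 ?ltr_wpDr//.
rewrite (bigD1 i)//= addrCA lerDl addr_ge0//.
by apply: sumr_ge0 => j _; rewrite invr_ge0 ltW.
Qed.

(** The remainder at [y] is quadratic by [dv_quad], and [Dv g y] is close to [Dv g w] because
    directional derivatives are holomorphic, hence continuous. Each contributes half of [e]. *)
Lemma strict_dif U g w : hol U g -> U w -> forall e : R, 0 < e -> exists2 dl : R, 0 < dl &
  (forall x, vn (x - w) < dl -> U x) /\
  forall x y, vn (x - w) < dl -> vn (y - w) < dl ->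
    cn (g x - g y - Dv g w (x - y)) <= e * vn (x - y).
Proof.
move=> gU wU e e0; have [oU gd] := gU; have [K [K0 HK]] := @dv_quad R d.
have [r0 r00 HU] := oU w wU; have [r1 r10 Hc] := dif_cnt (gd w wU) ltr01.
pose rho := Num.min r0 r1 / 2.
have rho0 : 0 < rho by rewrite divr_gt0// lt_min r00.
have [rs rd] : 2 * rho <= r0 /\ 2 * rho <= r1.
  have m1 : Num.min r0 r1 <= r0 by rewrite ge_min lexx.
  have m2 : Num.min r0 r1 <= r1 by rewrite ge_min lexx orbT.
  by rewrite /rho; split; lra.
clearbody rho.
have e2 : 0 < e / 2 by lra.
have /choice[dl Hdl] : forall j : 'I_d, exists dl : R, 0 < dl /\ forall y, vn (y - w) < dl ->
    cn (Dv g y (delta_mx 0 j) - Dv g w (delta_mx 0 j)) < e / 2.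
  move=> j; have [_ /(_ w wU)/dif_cnt/(_ _ e2)[dl dl0 H]] := hol_Dv (delta_mx 0 j) gU.
  by exists dl.
have [m m0 Hm] := fin_min (fun j => (Hdl j).1).
pose A := K * 2 / rho ^+ 2.
have A0 : 0 < A by rewrite !mulr_gt0// invr_gt0 exprn_gt0.
exists (Num.min (Num.min m (rho / 8)) (e / 4 / A)).
  by rewrite !lt_min m0 (divr_gt0 rho0)//=; apply: divr_gt0 => //; exact: divr_gt0.
split=> [x|x y]; rewrite !lt_min => /andP[/andP[x1 x2] x3].
  by apply: HU; lra.
move=> /andP[/andP[y1 y2] y3].
have yU : U y by apply: HU; lra.
have xy := vn_dist x w y; rewrite (vn_sym w y) in xy.
have [|_ Hq] := HK g U y rho 2 (Dv g y) rho0 gU _ (DvP (gd y yU)).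
  move=> v vy; have vw := vn_dist v y w; split; first by apply: HU; lra.
  have := cnB (g v - g w) (g y - g w); rewrite opprB addrA subrK.
  have : cn (g v - g w) < 1 by apply: Hc; lra.
  have : cn (g y - g w) < 1 by apply: Hc; lra.
  by lra.
have xyE : x = y + (x - y) by rewrite addrC subrK.
have := Hq (x - y) ltac:(lra); rewrite -xyE -/A => h.
have h2 : cn (Dv g y (x - y) - Dv g w (x - y)) <= e / 2 * vn (x - y).
  rewrite (isd_sum _ (DvP (gd y yU))) (isd_sum _ (DvP (gd w wU))) -sumrB.
  rewrite (le_trans (cn_sum _ _))// mulr_sumr; apply: ler_sum => j _.
  rewrite -mulrBr (le_trans (cnM _ _))// mulrC ler_wpM2r ?cn_ge0//.
  by have [_ H] := Hdl j; apply/ltW/H; exact: lt_le_trans (Hm j).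
have := cnD (g x - g y - Dv g y (x - y)) (Dv g y (x - y) - Dv g w (x - y)).
rewrite addrA subrK => h3.
have h4 : A * vn (x - y) ^+ 2 <= e / 2 * vn (x - y).
  rewrite expr2 mulrA ler_wpM2r ?vn_ge0// mulrC -ler_pdivlMr//.
  by rewrite (_ : e / 2 / A = e / 4 / A + e / 4 / A); [lra|field; rewrite gt_eqF].
by lra.
Qed.

End StrictDif.

(** * Covering content: countable unions, Lipschitz maps, graphs *)

Section Content.
Variable R : realType.
Local Notation C := R[i].

(* For [k = 2 * n] this bounds the upper Minkowski content of real dimension
   [k]; [sc k] is its countable version. *)
Definition cb (k d : nat) (X : set 'rV[C]_d) := exists A : R, forall e : R, 0 < e <= 1 ->
  exists t : seq 'rV[C]_d, (size t)%:R * e ^+ k <= A /\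
    forall x, X x -> exists2 c, c \in t & vn (x - c) <= e.

Definition sc (k d : nat) (X : set 'rV[C]_d) := exists Y : nat -> set 'rV[C]_d,
  (forall i, cb k (Y i)) /\ X `<=` \bigcup_i Y i.

Section Basic.
Variables (k d : nat).
Implicit Types X Y : set 'rV[C]_d.

Lemma cb_sub X Y : X `<=` Y -> cb k Y -> cb k X.
Proof.
move=> XY [A H]; exists A => e /H[t [h1 h2]]; exists t; split=> // x /XY; exact: h2.
Qed.

Lemma sc_sub X Y : X `<=` Y -> sc k Y -> sc k X.
Proof. by move=> XY [Z [h1 h2]]; exists Z; split=> // x /XY/h2. Qed.

Lemma cb0 : cb k (set0 : set 'rV[C]_d).
Proof. by exists 0 => e _; exists [::]; rewrite mul0r; split. Qed.

Lemma sc_cb X : cb k X -> sc k X.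
Proof. by move=> h; exists (fun=> X); split=> // x Xx; exists 0%N. Qed.

Lemma sc0 : sc k (set0 : set 'rV[C]_d). Proof. exact: sc_cb cb0. Qed.

Lemma sc_bigcup (X : nat -> set 'rV[C]_d) : (forall i, sc k (X i)) -> sc k (\bigcup_i X i).
Proof.
move=> /choice[Y HY].
exists (fun m => if (unpickle m : option (nat * nat)) is Some p then Y p.1 p.2 else set0).
split=> [m|x [i _ Xx]].
  by case: unpickle => [[i j]|]; [have [+ _] := HY i; exact|exact: cb0].
have [_ /(_ x Xx)[j _ yx]] := HY i.
by exists (pickle (i, j)) => //=; rewrite pickleK.
Qed.

Lemma sc_setU X Y : sc k X -> sc k Y -> sc k (X `|` Y).
Proof.
move=> hX hY; apply: (@sc_sub _ (\bigcup_i (if i is 0%N then X else Y))).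
  by move=> x [?|?]; [exists 0%N|exists 1%N].
by apply: sc_bigcup => -[|i].
Qed.

Lemma ball_rat (x : 'rV[C]_d) (r : R) : 0 < r ->
  exists q : 'rV[rat * rat]_d,
    vn (x - \row_j ((ratr (q 0 j).1 : R) +i* ratr (q 0 j).2)%C) < r.
Proof.
move=> r0; pose e := r / (2 * (d%:R + 1)).
have d0 : 0 <= d%:R :> R by [].
have e0 : 0 < e by rewrite divr_gt0// mulr_gt0//; lra.
have hr (y : R) : exists q : rat, `|y - ratr q| < e.
  have [q] := @rat_in_itvoo R (y - e) (y + e) ltac:(lra).
  by rewrite in_itv /= => /andP[h1 h2]; exists q; rewrite ltr_norml; apply/andP; split; lra.
have /choice[q Hq] : forall j : 'I_d, exists q : rat * rat,
    cn (x 0 j - ((ratr q.1 : R) +i* ratr q.2)%C) < e + e.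
  move=> j; have [q1 h1] := hr (complex.Re (x 0 j)); have [q2 h2] := hr (complex.Im (x 0 j)).
  by exists (q1, q2); move: h1 h2; case: (x 0 j) => a b h1 h2; rewrite /cn /= ltrD.
exists (\row_j q j).
apply: (@le_lt_trans _ _ (\sum_(j < d) (e + e))).
  by apply: ler_sum => j _; rewrite !mxE; exact/ltW/Hq.
rewrite sumr_const card_ord -mulr_natr -mulr2n -mulr_natr /e.
rewrite [ltLHS](_ : _ = r * (d%:R / (d%:R + 1))); last by field; lra.
rewrite gtr_pMr// ltr_pdivrMr; lra.
Qed.

(** The balls with rational centre and radius [1 / (m + 1)] are countably many; those violating [P]
    are replaced by the empty set. [P] is abstract because it will be thinness of a set, thinness of
    its image, or nullity of its image. *)
Lemma lindelof (P : set 'rV[C]_d -> Prop) X : P set0 -> (forall A B, A `<=` B -> P B -> P A) ->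
  (forall x, X x -> exists2 r : R, 0 < r & P (X `&` [set y | vn (y - x) < r])) ->
  exists Y : nat -> set 'rV[C]_d, (forall i, P (Y i)) /\ X `<=` \bigcup_i Y i.
Proof.
move=> P0 PS H.
pose B (p : 'rV[rat * rat]_d * nat) := X `&` [set y |
   vn (y - \row_j ((ratr (p.1 0 j).1 : R) +i* ratr (p.1 0 j).2)%C) < (p.2.+1%:R)^-1].
pose Y (m : nat) : set 'rV[C]_d :=
  if (unpickle m : option ('rV[rat * rat]_d * nat)) is Some p then
    if `[< P (B p) >] then B p else set0 else set0.
exists Y; split; first by move=> m; rewrite /Y; case: unpickle => [p|//]; case: asboolP.
move=> x Xx; have [r r0 Hr] := H x Xx.
have [m Hm] : exists m : nat, (m.+1%:R)^-1 < r / 2 :> R.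
  exists (Num.truncn (r / 2)^-1); rewrite invf_plt ?posrE ?divr_gt0//.
  exact: truncnS_gt.
have m0 : 0 < (m.+1%:R)^-1 :> R by rewrite invr_gt0.
have [q Hq] := ball_rat x m0.
exists (pickle (q, m)) => //; rewrite /Y pickleK; case: asboolP => [_|[]]; first by [].
apply: PS Hr => y [Xy /= yq]; split=> //=.
set c := \row_j _ in Hq yq; have := vn_dist y c x; rewrite (vn_sym c x).
by move: (m.+1%:R^-1 : R) Hm Hq yq => i; lra.
Qed.

Lemma sc_local X : (forall x, X x -> exists2 r : R, 0 < r &
    sc k (X `&` [set y | vn (y - x) < r])) -> sc k X.
Proof.
by move=> /(lindelof sc0 sc_sub)[Y [Yc XY]]; apply: sc_sub XY _; exact: sc_bigcup.
Qed.

End Basic.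

Lemma cb_lip (k d d' : nat) (X : set 'rV[C]_d) (p : 'rV[C]_d -> 'rV[C]_d') (L : R) :
  (forall x y, X x -> X y -> vn (p x - p y) <= L * vn (x - y)) ->
  cb k X -> cb k (p @` X).
Proof.
move=> pL [A HA]; pose M := `|L| + 1.
have M1 : 1 <= M by rewrite lerDr.
have M0 : 0 < M by lra.
exists (A * (2 * M) ^+ k) => e /andP[e0 e1].
have e'0 : 0 < e / (2 * M) by rewrite divr_gt0// mulr_gt0.
have [|t [h1 h2]] := HA (e / (2 * M)).
  by rewrite e'0 ler_pdivrMr ?mulr_gt0//; lra.
(* A centre need not lie in [X], where alone [p] is Lipschitz. It is replaced by a point of [X] in
   its ball, which doubles the radius and accounts for the 2 in [2 * M]; the default 0 is met only
   for balls missing [X]. *)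
pose y c := xget 0 [set x | X x /\ vn (x - c) <= e / (2 * M)].
exists [seq p (y c) | c <- t]; split.
  rewrite size_map (_ : e ^+ k = (e / (2 * M)) ^+ k * (2 * M) ^+ k).
    by rewrite mulrA ler_wpM2r// exprn_ge0// ltW// mulr_gt0.
  by rewrite -exprMn divfK// gt_eqF// mulr_gt0.
move=> _ [x Xx <-]; have [c ct xc] := h2 x Xx.
have [Xy yc] : X (y c) /\ vn (y c - c) <= e / (2 * M).
  by have := @xgetI _ 0 [set x | X x /\ vn (x - c) <= e / (2 * M)] x (conj Xx xc).
exists (p (y c)); first exact: map_f.
rewrite (le_trans (pL _ _ Xx Xy))//.
have xy : vn (x - y c) <= e / (2 * M) + e / (2 * M).
  by have := vn_dist x c (y c); rewrite (vn_sym c); lra.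
apply: (@le_trans _ _ (M * vn (x - y c))).
  by rewrite ler_wpM2r ?vn_ge0// /M (le_trans (ler_norm L))// lerDl.
rewrite (le_trans (ler_wpM2l (ltW M0) xy))// le_eqVlt; apply/orP; left.
by apply/eqP; field; rewrite gt_eqF.
Qed.

(** A grid of mesh [eta] in the [2 * n] real coordinates other than the [j]-th complex one yields
    one representative per cell, and the hypothesis controls coordinate [j]. The additive [eta] is
    there for images near critical points, which are graphs only up to an error. *)
Lemma graph_cover (n : nat) (X : set 'rV[C]_n.+1) (j : 'I_n.+1) (B L eta : R) :
  0 <= B -> 0 <= L -> 0 < eta -> (forall x, X x -> vn x <= B) ->
  (forall x y, X x -> X y ->
     cn (x 0 j - y 0 j) <= L * \sum_(i < n) cn (x 0 (lift j i) - y 0 (lift j i)) + eta) ->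
  exists t : seq 'rV[C]_n.+1, (size t)%:R <= (2 * B / eta + 2) ^+ (2 * n) /\
    forall x, X x -> exists2 c, c \in t & vn (x - c) <= ((1 + L) * (2 * n%:R) + 1) * eta.
Proof.
move=> B0 L0 eta0 XB XL; pose M := (Num.truncn (2 * B / eta)).+1.
pose T := {ffun 'I_n * bool -> 'I_M}.
pose co (x : 'rV[C]_n.+1) (p : 'I_n * bool) : R :=
  let z := x 0 (lift j p.1) in if p.2 then complex.Re z else complex.Im z.
pose cell (x : 'rV[C]_n.+1) : T := [ffun p => inord (Num.truncn ((co x p + B) / eta))].
have coB x p : X x -> 0 <= (co x p + B) / eta <= 2 * B / eta.
  move=> /XB xB; have zB := le_trans (vn_coord x (lift j p.1)) xB.
  have : `|co x p| <= B.
    by rewrite /co; case: p.2; [exact: le_trans (Re_cn _) zB|exact: le_trans (Im_cn _) zB].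
  rewrite ler_norml => /andP[h1 h2]; rewrite divr_ge0 ?(ltW eta0)//=; last lra.
  by rewrite ler_wpM2r ?invr_ge0 ?(ltW eta0)//; lra.
have close x y p : X x -> X y -> cell x = cell y -> `|co x p - co y p| <= eta.
  move=> Xx Xy /ffunP/(_ p); rewrite !ffunE => /(congr1 val).
  have /andP[x0 x1] := coB x p Xx; have /andP[y0 y1] := coB y p Xy.
  rewrite /= !inordK ?ltnS; [|exact: le_truncn..] => E.
  have /andP[a1 a2] := truncn_itv x0; have /andP[b1 b2] := truncn_itv y0.
  rewrite E in a1 a2; move: a1 a2 b1 b2; move: (Num.truncn _) => N.
  rewrite -natr1 !ler_pdivlMr// !ltr_pdivrMr// => *.
  by rewrite ler_norml; apply/andP; split; lra.
pose y (c : T) := xget 0 [set x | X x /\ cell x = c].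
exists [seq y c | c <- enum T]; split.
  rewrite size_map -cardE card_ffun card_prod card_bool !card_ord natrX mulnC.
  apply: lerXn2r; rewrite ?nnegrE ?addr_ge0 ?divr_ge0 ?mulr_ge0 ?(ltW eta0)//.
  have : (Num.truncn (2 * B / eta))%:R <= 2 * B / eta.
    by rewrite truncn_le// divr_ge0 ?mulr_ge0// ltW.
  by rewrite /M -natr1; lra.
move=> x Xx; exists (y (cell x)); first by rewrite map_f// mem_enum.
have [Xy yx] : X (y (cell x)) /\ cell (y (cell x)) = cell x.
  exact: (@xgetI _ 0 [set x' | X x' /\ cell x' = cell x] x (conj Xx erefl)).
set w := y (cell x) in Xy yx *.
have S : \sum_(i < n) cn (x 0 (lift j i) - w 0 (lift j i)) <= 2 * n%:R * eta.
  apply: (@le_trans _ _ (\sum_(i < n) (eta + eta))).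
    apply: ler_sum => i _; have := close x w (i, true) Xx Xy (esym yx).
    have := close x w (i, false) Xx Xy (esym yx); rewrite /co /=.
    by case: (x 0 _) (w 0 _) => [? ?] [? ?]; rewrite /cn /= => *; exact: lerD.
  rewrite sumr_const card_ord -mulr_natl le_eqVlt; apply/orP; left.
  by apply/eqP; ring.
rewrite /vn (bigD1_ord j)//= !mxE.
under eq_bigr do rewrite !mxE.
have := XL x w Xx Xy; have := ler_wpM2l L0 S.
have -> : ((1 + L) * (2 * n%:R) + 1) * eta = L * (2 * n%:R * eta) + eta + 2 * n%:R * eta.
  by ring.
by lra.
Qed.

Lemma cb_graph (n : nat) (X : set 'rV[C]_n.+1) (j : 'I_n.+1) (B L : R) :
  0 <= B -> 0 <= L -> (forall x, X x -> vn x <= B) ->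
  (forall x y, X x -> X y ->
     cn (x 0 j - y 0 j) <= L * \sum_(i < n) cn (x 0 (lift j i) - y 0 (lift j i))) ->
  cb (2 * n) X.
Proof.
move=> B0 L0 XB XL.
have [D [DE D1]] : exists D, D = (1 + L) * (2 * n%:R) + 1 /\ 1 <= D.
  by eexists; split; [reflexivity|rewrite lerDr !mulr_ge0// addr_ge0].
have D0 : 0 < D by lra.
exists (((2 * B + 2) * D) ^+ (2 * n)) => e /andP[e0 e1].
have eta0 : 0 < e / D by rewrite divr_gt0.
have [|t [h1 h2]] := @graph_cover n X j B L (e / D) B0 L0 eta0 XB.
  by move=> x y Xx Xy; rewrite (le_trans (XL _ _ Xx Xy))// lerDl ltW.
exists t; split.
  rewrite (le_trans (ler_wpM2r _ h1)) ?exprn_ge0 ?(ltW e0)// -exprMn.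
  have -> : (2 * B / (e / D) + 2) * e = 2 * B * D + 2 * e.
    by field; rewrite !gt_eqF.
  have BD : 0 <= 2 * B * D by rewrite mulr_ge0 ?mulr_ge0// ltW.
  have le : 2 * B * D + 2 * e <= (2 * B + 2) * D by lra.
  by apply: lerXn2r => //; rewrite nnegrE; [|apply: le_trans le]; lra.
by move=> x /h2[c ct]; rewrite -DE mulrC divfK ?gt_eqF// => xc; exists c.
Qed.

End Content.

(** * Thinness of zero sets *)

Section ZeroSets.
Variables (R : realType) (n : nat).
Local Notation C := R[i].
Local Notation V := 'rV[R[i]]_n.+1.
Implicit Types (U : set V) (f g : V -> C) (u : V).

(** Some partial derivative [a] is nonzero, and strict differentiability between two zeros bounds
    [v * a], with [v] the change in coordinate [j], by the other coordinates plus a small multiple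
    of [cn v]. Absorbing the latter gives a Lipschitz graph without solving for an implicit
    function. *)
Lemma regular_sc U g u : hol U g ->
  sc (2 * n) [set w | [/\ U w, g w = 0 & Dv g w u != 0]].
Proof.
move=> gU; have [oU gd] := gU; apply: sc_local => w [wU gw Du].
have [j a0] : exists j, Dv g w (delta_mx 0 j) != 0.
  apply: contrapT => H; move/eqP: Du; apply.
  rewrite (isd_sum u (DvP (gd w wU))) big1// => j _.
  have [->|nz] := eqVneq (Dv g w (delta_mx 0 j)) 0; first by rewrite mulr0.
  by exfalso; apply: H; exists j.
set a := Dv g w (delta_mx 0 j) in a0; have na := cn_gt0 a0.
have e0 : 0 < cn a / 4 by rewrite divr_gt0.
have [dl dl0 [_ H]] := strict_dif gU wU e0.
exists dl => //; apply: sc_cb.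
pose K := \sum_(i < n) cn (Dv g w (delta_mx 0 (lift j i))).
have K0 : 0 <= K by apply: sumr_ge0 => i _; exact: cn_ge0.
apply: (@cb_graph R n _ j (dl + vn w) (4 / cn a * (cn a / 4 + K))).
- by rewrite addr_ge0 ?vn_ge0// ltW.
- by rewrite mulr_ge0// ?divr_ge0 ?addr_ge0// ltW.
- by move=> x [_ /= xw]; have := vnD (x - w) w; rewrite subrK; lra.
move=> x y [[xU gx _] /= xw] [[yU gy _] /= yw].
have := H x y xw yw; rewrite gx gy subrr sub0r cnN (isd_sum _ (DvP (gd w wU))).
rewrite /vn !(bigD1_ord j)//= -/a !mxE.
under eq_bigr do rewrite !mxE.
under [X in _ * (_ + X)]eq_bigr do rewrite !mxE.
set v := x 0 j - y 0 j; set S := \sum_(i < n) cn _; set T := \sum_(i < n) _ * _.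
have S0 : 0 <= S by apply: sumr_ge0 => i _; exact: cn_ge0.
have TK : cn T <= K * S.
  rewrite (le_trans (cn_sum _ _))// mulr_suml; apply: ler_sum => i _.
  rewrite (le_trans (cnM _ _))// mulrC ler_wpM2l ?cn_ge0//.
  by rewrite /S (bigD1 i)//= lerDl; apply: sumr_ge0 => l _; exact: cn_ge0.
move=> h; have va : cn (v * a) <= cn a / 4 * (cn v + S) + K * S.
  by have := cnB (v * a + T) T; rewrite addrK; lra.
have vv : cn v <= 2 / cn a * cn (v * a).
  rewrite -[v in leLHS](mulfK a0) (le_trans (cnM _ _))// mulrC.
  by rewrite ler_wpM2r ?cn_ge0// cnV.
have c0 : 0 <= 2 / cn a by rewrite divr_ge0// ltW.
have := le_trans vv (ler_wpM2l c0 va).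
have -> : 2 / cn a * (cn a / 4 * (cn v + S) + K * S) = cn v / 2 + (S / 2 + 2 / cn a * K * S).
  by field; rewrite gt_eqF.
have -> : 4 / cn a * (cn a / 4 + K) * S = 2 * (S / 2 + 2 / cn a * K * S).
  by field; rewrite gt_eqF.
by move: (2 / cn a * K * S) => E; lra.
Qed.

(** One direction [u] and one order [m] serve all zeros near [z]: the [m]-th derivative along [u]
    stays nonzero, so every such zero is a regular zero of some earlier derivative [g k]. *)
Lemma zero_sc U f : hol U f -> (forall z, U z -> ~ flat f z) ->
  sc (2 * n) [set z | U z /\ f z = 0].
Proof.
move=> fU nf; have [oU fd] := fU; apply: sc_local => z [zU fz].
have [rho rho0 HU] := oU z zU.
have [u ur nz] : exists2 u, vn u < rho / 130 & f (z + u) != 0.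
  apply: contrapT => H; apply: (nf z zU); exists (rho / 130); first by rewrite divr_gt0.
  move=> v vz; apply/eqP/negPn/negP => nz; apply: H; exists (v - z) => //.
  by rewrite addrC subrK.
have [m gm] := line_order fU rho0 HU ur nz.
pose g k := iter k (fun g v => Dv g v u) f.
have gh k : hol U (g k) by elim: k => // k IH; exact: hol_Dv.
have [_ /(_ z zU)/dif_cnt/(_ _ (cn_gt0 gm))[dl dl0 Hdl]] := gh m.
exists (Num.min dl rho); first by rewrite lt_min dl0.
apply: (@sc_sub _ _ _ _ (\bigcup_k [set w | [/\ U w, g k w = 0 & Dv (g k) w u != 0]])).
  move=> w [[wU fw] /=]; rewrite lt_min => /andP[/Hdl wd _].
  have gmw : g m w != 0.
    by apply: contraTneq wd => ->; rewrite sub0r cnN ltxx.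
  apply: contrapT => H; move/negP: gmw; apply; apply/eqP.
  elim: m {gm wd Hdl} => // k IH; apply/eqP/negPn/negP => nk; apply: H.
  by exists k.
by apply: sc_bigcup => k; exact: regular_sc.
Qed.

End ZeroSets.

(** * Iterated integrals of lower semicontinuous functions *)

Section Liminf.
Variable R : realType.
Local Open Scope ereal_scope.
Implicit Types (u v : nat -> \bar R) (a : R).

Lemma limn_einfE u : limn_einf u = ereal_sup (range (einfs u)).
Proof. by rewrite limn_einf_lim; apply/cvg_lim => //; exact: cvg_einfs_sup. Qed.

Lemma einfs_le u n k : (n <= k)%N -> einfs u n <= u k.
Proof. by move=> nk; apply: ereal_inf_lbound; exists k. Qed.

Lemma le_limn_einf u v : (forall k, u k <= v k) -> limn_einf u <= limn_einf v.
Proof.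
move=> uv; rewrite !limn_einf_lim; apply: lee_lim; [exact: is_cvg_einfs..|].
apply: nearW => n; apply: le_ereal_inf_tmp => _ [k /= nk] <-.
by apply: le_trans (uv k); exact: einfs_le.
Qed.

Lemma limn_einf_gt u (x : \bar R) : x < limn_einf u ->
  exists N : nat, forall k, (N <= k)%N -> x < u k.
Proof.
rewrite limn_einfE => /ereal_sup_gt[_ [N _ <-] xN]; exists N => k Nk.
exact: lt_le_trans xN (einfs_le _ _).
Qed.

Lemma limn_einf_ge_cst u (x : \bar R) (N : nat) :
  (forall k, (N <= k)%N -> x <= u k) -> x <= limn_einf u.
Proof.
move=> H; rewrite limn_einfE; apply: (@le_trans _ _ (einfs u N)).
  by apply: le_ereal_inf_tmp => _ [k /= nk] <-; exact: H.
by apply: ereal_sup_ubound; exists N.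
Qed.

Lemma limn_einf_ge u (x : \bar R) :
  (forall a, a%:E < x -> exists N : nat, forall k, (N <= k)%N -> a%:E <= u k) ->
  x <= limn_einf u.
Proof.
move=> H; have H' a : a%:E < x -> a%:E <= limn_einf u.
  by move=> /H[N]; exact: limn_einf_ge_cst.
rewrite leNgt; apply/negP; case: (limn_einf u) H' => [r| |] H'.
- case: x {H} H' => [s| |] H' //; rewrite ?lte_fin => rs.
    by have := H' ((r + s) / 2)%R; rewrite lte_fin lee_fin => /(_ ltac:(lra)); lra.
  by have := H' (r + 1)%R (ltry _); rewrite lee_fin; lra.
- by rewrite ltNge leey.
- case: x {H} H' => [s| |] H' // _.
    by have := H' (s - 1)%R; rewrite lte_fin => /(_ ltac:(lra)).
  by have := H' 0%R (ltry _).
Qed.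

End Liminf.

Section IterInt.
Variable R : realType.
Local Notation mu := (@lebesgue_measure R).
Local Open Scope ereal_scope.
Implicit Types (f g h : seq R -> \bar R) (t : seq R).

(** The integral of a nonnegative function is a supremum over simple functions below it, so
    monotonicity holds for arbitrary integrands. *)
Lemma integral_mono (f g : R -> \bar R) : (forall x, 0 <= f x) ->
  (forall x, f x <= g x) -> \int[mu]_x f x <= \int[mu]_x g x.
Proof.
move=> f0 fg; have g0 x : 0 <= g x by exact: le_trans (fg x).
rewrite !ge0_integralTE//; apply: le_ereal_sup => _ [k kf <-].
by exists k => // x; exact: le_trans (kf x) (fg x).
Qed.

Definition sconv (s : nat -> seq R) t := forall i (e : R), (0 < e)%R ->
  exists N : nat, forall k, (N <= k)%N -> (`|(s k)`_i - t`_i| < e)%R.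

(** Sequential lower semicontinuity for coordinatewise convergence of lists. The class is closed
    under slices, sums and partial integration, and its members have measurable partial
    integrals. *)
Definition lscs g := forall s t (a : R), sconv s t -> a%:E < g t ->
  exists N : nat, forall k, (N <= k)%N -> a%:E < g (s k).

Lemma sconv_cons s t (x : nat -> R) y : sconv s t ->
  (forall e : R, (0 < e)%R -> exists N : nat, forall k, (N <= k)%N -> (`|x k - y| < e)%R) ->
  sconv (fun k => x k :: s k) (y :: t).
Proof. by move=> st xy [|i] e e0 /=; [exact: xy|exact: st]. Qed.

Lemma sconv_cst t : sconv (fun=> t) t.
Proof. by move=> i e e0; exists 0%N => k _; rewrite subrr normr0. Qed.

Lemma real_cst (y : R) (e : R) : (0 < e)%R ->
  exists N : nat, forall k : nat, (N <= k)%N -> (`|y - y| < e)%R.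
Proof. by move=> e0; exists 0%N => k _; rewrite subrr normr0. Qed.

Lemma sconv_behead s t : sconv s t -> sconv (fun k => behead (s k)) (behead t).
Proof.
move=> st i e e0; have [N H] := st i.+1 e e0; exists N => k /H.
by rewrite !nth_behead.
Qed.

Lemma lscs_comp g (F : seq R -> seq R) :
  (forall s t, sconv s t -> sconv (fun k => F (s k)) (F t)) -> lscs g -> lscs (fun s => g (F s)).
Proof. by move=> Fc gl s t a st; apply: gl; exact: Fc. Qed.

Lemma lscs_cons g x : lscs g -> lscs (fun s => g (x :: s)).
Proof. by apply: lscs_comp => s t st; apply: sconv_cons => // e; exact: real_cst. Qed.

Lemma lscs_liminf g s t : lscs g -> sconv s t -> g t <= limn_einf (fun k => g (s k)).
Proof.
move=> gl st; apply: limn_einf_ge => a /(gl s t a st)[N H].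
by exists N => k /H/ltW.
Qed.

Lemma lscsD f g : lscs f -> lscs g -> (forall s, 0 <= f s) -> (forall s, 0 <= g s) ->
  lscs (fun s => f s + g s).
Proof.
move=> fl gl f0 g0 s t a st afg.
have key (p q : \bar R) : 0 <= p -> 0 <= q -> a%:E < p + q ->
    exists b c : R, [/\ (a <= b + c)%R, b%:E < p & c%:E < q].
  case: p q => [p| |] [q| |] //; rewrite ?leey ?lee_fin => p0 q0.
  - rewrite -EFinD lte_fin => h; exists (p - (p + q - a) / 2)%R, (q - (p + q - a) / 2)%R.
    by rewrite !lte_fin; split; lra.
  - by move=> _; exists (p - 1)%R, (a - p + 1)%R; rewrite ?lte_fin ?ltry; split=> //; lra.
  - by move=> _; exists (a - q + 1)%R, (q - 1)%R; rewrite ?lte_fin ?ltry; split=> //; lra.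
  - by move=> _; exists a, 0%R; rewrite !ltry; split=> //; lra.
have [b [c [abc bf cg]]] := key _ _ (f0 t) (g0 t) afg.
have [N1 H1] := fl s t b st bf; have [N2 H2] := gl s t c st cg.
exists (maxn N1 N2) => k; rewrite geq_max => /andP[/H1 h1 /H2 h2].
by apply: (@le_lt_trans _ _ (b + c)%:E); [rewrite lee_fin|rewrite EFinD lteD].
Qed.

Lemma lscs_cst (c : \bar R) : lscs (fun=> c).
Proof. by move=> s t a _ ac; exists 0%N. Qed.

Lemma lsc_measurable (f : R -> \bar R) : (forall (x : nat -> R) y (a : R),
    (forall e : R, (0 < e)%R -> exists N : nat, forall k, (N <= k)%N -> (`|x k - y| < e)%R) ->
    a%:E < f y -> exists N : nat, forall k, (N <= k)%N -> a%:E < f (x k)) ->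
  measurable_fun [set: R] f.
Proof.
move=> H; apply: lower_semicontinuous_measurable => y a ay; apply: contrapT => nV.
have /choice[x Hx] : forall n : nat, exists x : R, (`|x - y| < n.+1%:R^-1)%R /\ f x <= a%:E.
  move=> n; apply: contrapT => K; apply: nV.
  exists (ball y (n.+1%:R^-1)%R); first by apply: nbhsx_ballx; rewrite invr_gt0.
  move=> x xy; rewrite ltNge; apply/negP => L; apply: K; exists x; split=> //.
  by rewrite distrC.
have [|N HN] := H x y a _ ay; last first.
  by have [_] := Hx N; rewrite leNgt HN.
move=> e e0; exists (Num.truncn e^-1) => k Nk; apply: (lt_trans (Hx k).1).
rewrite invf_plt ?posrE//; apply: lt_le_trans (truncnS_gt _) _.
by rewrite ler_nat ltnS.
Qed.

Lemma iter_ge0 n f : (forall s, 0 <= f s) -> 0 <= iter_int n f.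
Proof. by elim: n f => [|n IH] f f0 //=; apply: integral_ge0 => x _; exact: IH. Qed.

Lemma iter_le n f g : (forall s, 0 <= f s) -> (forall s, f s <= g s) ->
  iter_int n f <= iter_int n g.
Proof.
elim: n f g => [|n IH] f g f0 fg //=.
by apply: integral_mono => x; [exact: iter_ge0|exact: IH].
Qed.

Lemma iter_eq n f g : f =1 g -> iter_int n f = iter_int n g.
Proof. by move=> /funext ->. Qed.

Lemma iter_cst0 n : iter_int n (fun=> 0 : \bar R) = 0.
Proof. by elim: n => //= n ->; exact: integral0. Qed.

Lemma iter_fatou_measurable n :
  (forall g : nat -> seq R -> \bar R, (forall k, lscs (g k)) -> (forall k s, 0 <= g k s) ->
    iter_int n (fun s => limn_einf (fun k => g k s)) <= limn_einf (fun k => iter_int n (g k)))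
  /\ (forall f, lscs f -> (forall s, 0 <= f s) ->
       measurable_fun [set: R] (fun x => iter_int n (fun s => f (x :: s)))).
Proof.
have meas m : (forall g : nat -> seq R -> \bar R, (forall k, lscs (g k)) -> (forall k s, 0 <= g k s) ->
      iter_int m (fun s => limn_einf (fun k => g k s)) <= limn_einf (fun k => iter_int m (g k))) ->
    forall f, lscs f -> (forall s, 0 <= f s) ->
      measurable_fun [set: R] (fun x => iter_int m (fun s => f (x :: s))).
  move=> F f fl f0; apply: lsc_measurable => x y a xy ay; apply: limn_einf_gt.
  apply: (lt_le_trans ay); apply: le_trans (F (fun k s => f (x k :: s)) _ _).
  - apply: iter_le => // s; apply: (lscs_liminf fl).
    by apply: sconv_cons => //; exact: sconv_cst.
  - by move=> k; exact: lscs_cons.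
  - by move=> k s.
elim: n => [|n [IHF IHM]].
  have F0 (g : nat -> seq R -> \bar R) : (forall k, lscs (g k)) -> (forall k s, 0 <= g k s) ->
    iter_int 0 (fun s => limn_einf (fun k => g k s)) <= limn_einf (fun k => iter_int 0 (g k)).
    by move=> _ _; exact: lexx.
  by split=> //; exact: meas F0.
suff F : forall g : nat -> seq R -> \bar R, (forall k, lscs (g k)) -> (forall k s, 0 <= g k s) ->
    iter_int n.+1 (fun s => limn_einf (fun k => g k s)) <= limn_einf (fun k => iter_int n.+1 (g k)).
  by split=> //; exact: meas F.
move=> g gl g0 /=.
apply: (@le_trans _ _ (\int[mu]_x limn_einf (fun k => iter_int n (fun s => g k (x :: s))))).
  apply: integral_mono => x.
    by apply: iter_ge0 => s; apply: (@limn_einf_ge_cst _ _ _ 0%N) => k _.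
  by apply: (IHF (fun k s => g k (x :: s))) => k; [exact: lscs_cons|move=> s].
apply: fatou => //.
  by move=> k; exact: IHM.
by move=> k x _; exact: iter_ge0.
Qed.

Lemma iter_fatou n (g : nat -> seq R -> \bar R) :
  (forall k, lscs (g k)) -> (forall k s, 0 <= g k s) ->
  iter_int n (fun s => limn_einf (fun k => g k s)) <= limn_einf (fun k => iter_int n (g k)).
Proof. by have [+ _] := iter_fatou_measurable n; exact. Qed.

Lemma iter_measurable n f : lscs f -> (forall s, 0 <= f s) ->
  measurable_fun [set: R] (fun x => iter_int n (fun s => f (x :: s))).
Proof. by have [_] := iter_fatou_measurable n; exact. Qed.

Lemma iter_lsc n (f : seq R -> seq R -> \bar R) :
  (forall t, lscs (f t)) -> (forall t s, 0 <= f t s) ->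
  (forall u t s, sconv u t -> f t s <= limn_einf (fun k => f (u k) s)) ->
  lscs (fun t => iter_int n (f t)).
Proof.
move=> fl f0 H s t a st ay; apply: limn_einf_gt; apply: (lt_le_trans ay).
apply: le_trans (iter_fatou _ _ _); [|by move=> k|by move=> k u].
by apply: iter_le => // u; exact: H.
Qed.

Lemma iterD n f g : lscs f -> lscs g -> (forall s, 0 <= f s) -> (forall s, 0 <= g s) ->
  iter_int n (fun s => f s + g s) = iter_int n f + iter_int n g.
Proof.
elim: n f g => [|n IH] f g fl gl f0 g0 //=.
rewrite -ge0_integralD//; [|by move=> x _; exact: iter_ge0|exact: iter_measurable
  |by move=> x _; exact: iter_ge0|exact: iter_measurable].
by apply: eq_integral => x _; rewrite IH//; exact: lscs_cons.
Qed.

Lemma lscs_sum (I : Type) (r : seq I) (F : I -> seq R -> \bar R) :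
  (forall i, lscs (F i)) -> (forall i s, 0 <= F i s) ->
  lscs (fun s => \sum_(i <- r) F i s).
Proof.
move=> Fl F0; elim: r => [|i r IH].
  by rewrite (_ : (fun s => _) = fun=> 0); [exact: lscs_cst|apply/funext => s; rewrite big_nil].
rewrite (_ : (fun s => _) = fun s => F i s + \sum_(j <- r) F j s); last first.
  by apply/funext => s; rewrite big_cons.
by apply: lscsD => // s; apply: sume_ge0.
Qed.

Lemma iter_sum n (I : Type) (r : seq I) (F : I -> seq R -> \bar R) :
  (forall i, lscs (F i)) -> (forall i s, 0 <= F i s) ->
  iter_int n (fun s => \sum_(i <- r) F i s) = \sum_(i <- r) iter_int n (F i).
Proof.
move=> Fl F0; elim: r => [|i r IH].
  by rewrite [RHS]big_nil -[RHS](iter_cst0 n); apply: iter_eq => s; rewrite big_nil.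
rewrite big_cons -IH -iterD//; first by apply: iter_eq => s; rewrite big_cons.
  exact: lscs_sum.
by move=> s; apply: sume_ge0.
Qed.

Fixpoint inbox (e : R) (c s : seq R) : bool :=
  if c is a :: c' then (`|s`_0 - a| < e)%R && inbox e c' (behead s) else true.

Lemma lscs_inbox e c (K : R) : (0 <= K)%R -> lscs (fun s => if inbox e c s then K%:E else 0).
Proof.
move=> K0 s t a st; case: ifPn => [tb|_]; last first.
  by rewrite lte_fin => a0; exists 0%N => k _; case: ifP => // _; rewrite lte_fin// (lt_le_trans a0).
move=> aK; suff [N H] : exists N : nat, forall k, (N <= k)%N -> inbox e c (s k).
  by exists N => k /H ->.
elim: c s t st tb {K0 aK} => [|b c IH] s t st /=; first by exists 0%N.
move=> /andP[h /(IH _ _ (sconv_behead st))[N1 H1]].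
have [|N2 H2] := st 0%N (e - `|t`_0 - b|)%R; first by rewrite subr_gt0.
exists (maxn N1 N2) => k; rewrite geq_max => /andP[/H1 -> /H2 h2]; rewrite andbT.
by have := ler_distD t`_0 (s k)`_0 b; lra.
Qed.

Lemma integral_window (a e K : R) : (0 < e)%R -> (0 <= K)%R ->
  \int[mu]_x (if (`|x - a| < e)%R then K%:E else 0) = (K * (2 * e))%:E.
Proof.
move=> e0 K0.
have -> : \int[mu]_x (if (`|x - a| < e)%R then K%:E else 0) = \int[mu]_(x in `](a - e)%R, (a + e)%R[) K%:E.
  rewrite [RHS]integral_mkcond; apply: eq_integral => x _; rewrite patchE.
  have -> : (x \in `](a - e)%R, (a + e)%R[%classic) = (`|x - a| < e)%R; last by [].
  by rewrite ltr_norml; apply/idP/idP; rewrite inE /= in_itv /= => /andP[h1 h2]; apply/andP; split; lra.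
rewrite integral_cst//= lebesgue_measure_itv/= lte_fin ifT; last by lra.
by rewrite -EFinD -EFinM; congr (_%:E); ring.
Qed.

Lemma iter_inbox e c (K : R) : (0 < e)%R -> (0 <= K)%R ->
  iter_int (size c) (fun s => if inbox e c s then K%:E else 0) = (K * (2 * e) ^+ size c)%:E.
Proof.
move=> e0 K0; elim: c => [|a c IH]; first by rewrite /= expr0 mulr1.
rewrite [LHS]/= (_ : (fun x => _) =
   fun x => if (`|x - a| < e)%R then (K * (2 * e) ^+ size c)%:E else 0); last first.
  by apply/funext => x; case: ifP => _ /=; [exact: IH|exact: iter_cst0].
rewrite integral_window//; last by rewrite mulr_ge0// exprn_ge0// mulr_ge0// ltW.
by rewrite (_ : size (a :: c) = (size c).+1)// exprS; congr (_%:E); ring.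
Qed.

Lemma measurable_open2 (U : set (R * R)) :
  (forall x, U x -> exists2 r : R, (0 < r)%R &
     forall y, (`|y.1 - x.1| < r)%R -> (`|y.2 - x.2| < r)%R -> U y) -> measurable U.
Proof.
move=> HU.
pose I (q : rat) (r : R) : set R := [set x | (`|x - ratr q| < r)%R].
have mI q r : measurable (I q r).
  rewrite (_ : I q r = `](ratr q - r)%R, (ratr q + r)%R[%classic); first exact: measurable_itv.
  apply/seteqP; split=> x; rewrite /I /= in_itv /= ltr_norml => /andP[h1 h2];
  by apply/andP; split; lra.
pose B (p : rat * rat * nat) := I p.1.1 (p.2.+1%:R^-1)%R `*` I p.1.2 (p.2.+1%:R^-1)%R.
pose Y (m : nat) : set (R * R) :=
  if (unpickle m : option (rat * rat * nat)) is Some p then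
    if `[< B p `<=` U >] then B p else set0 else set0.
suff -> : U = \bigcup_m Y m.
  apply: bigcup_measurable => m _; rewrite /Y; case: unpickle => [p|] //.
  by case: asboolP => // _; exact: measurableX.
apply/seteqP; split=> [x Ux|x [m _]]; last first.
  by rewrite /Y; case: unpickle => [p|] //; case: asboolP => // + Bx; exact.
have [r r0 Hr] := HU x Ux.
have [m Hm] : exists m : nat, (m.+1%:R^-1 < r / 2)%R.
  exists (Num.truncn (r / 2)^-1)%R; rewrite invf_plt ?posrE ?divr_gt0//.
  exact: truncnS_gt.
have m0 : (0 < m.+1%:R^-1 :> R)%R by rewrite invr_gt0.
have hr (i y : R) : (0 < i)%R -> exists q : rat, (`|y - ratr q| < i)%R.
  move=> i0; have [q] := @rat_in_itvoo R (y - i)%R (y + i)%R ltac:(lra).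
  by rewrite in_itv /= => /andP[h1 h2]; exists q; rewrite ltr_norml; apply/andP; split; lra.
have [q1 h1] := hr _ x.1 m0; have [q2 h2] := hr _ x.2 m0.
exists (pickle (q1, q2, m)); first by []. rewrite /Y pickleK; case: asboolP => [_|[]]; first by split; [exact: h1|exact: h2].
move=> y [/= y1 y2]; rewrite /I /= in y1 y2; move: (m.+1%:R^-1 : R)%R Hm h1 h2 y1 y2 => i Hm h1 h2 y1 y2.
apply: Hr.
  by have := ler_distD (ratr q1) y.1 x.1; rewrite (distrC (ratr q1) x.1); lra.
by have := ler_distD (ratr q2) y.2 x.2; rewrite (distrC (ratr q2) x.2); lra.
Qed.

Lemma lscs_measurable2 f : lscs f ->
  measurable_fun [set: R * R] (fun z : R * R => f [:: z.1; z.2]).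
Proof.
move=> fl; apply: (@measurability _ _ _ _ _ _ (@ErealGenOInfty.G R)).
  exact: ErealGenOInfty.measurableE.
move=> _ [_ [a ->] <-]; apply: measurableI => //; apply: measurable_open2 => z.
rewrite /= in_itv /= andbT => az; apply: contrapT => nr.
have /choice[y Hy] : forall n : nat, exists y : R * R, [/\ (`|y.1 - z.1| < n.+1%:R^-1)%R,
   (`|y.2 - z.2| < n.+1%:R^-1)%R & f [:: y.1; y.2] <= a%:E].
  move=> n; apply: contrapT => K; apply: nr; exists (n.+1%:R^-1)%R; first by rewrite invr_gt0.
  move=> y y1 y2; rewrite /= in_itv /= andbT ltNge; apply/negP => L; apply: K.
  by exists y.
have cv e : (0 < e)%R -> exists N : nat, forall k, (N <= k)%N -> (k.+1%:R^-1 < e :> R)%R.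
  move=> e0; exists (Num.truncn e^-1) => k Nk.
  rewrite invf_plt ?posrE//; apply: lt_le_trans (truncnS_gt _) _.
  by rewrite ler_nat ltnS.
have [|N HN] := fl (fun k => [:: (y k).1; (y k).2]) [:: z.1; z.2] a _ az.
  apply: sconv_cons; [apply: sconv_cons; [exact: sconv_cst|]|] => e /cv[N HN];
  by exists N => k /HN; apply: lt_trans; case: (Hy k).
by have [_ _] := Hy N; rewrite leNgt HN.
Qed.

Lemma lscs_tonelli f : lscs f -> (forall s, 0 <= f s) ->
  \int[mu]_x \int[mu]_y f [:: x; y] = \int[mu]_y \int[mu]_x f [:: x; y].
Proof.
move=> fl f0.
exact: (@fubini_tonelli _ _ _ _ R mu mu (fun z => f [:: z.1; z.2]) (lscs_measurable2 fl) (fun z => f0 _)).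
Qed.

Lemma lscs_integral (f : R -> seq R -> \bar R) :
  (forall x u t, sconv u t -> f x t <= limn_einf (fun k => f x (u k))) ->
  (forall t, lscs (fun s => f s`_0 t)) -> (forall x t, 0 <= f x t) ->
  lscs (fun t => \int[mu]_x f x t).
Proof.
move=> fl fx f0.
have := @iter_lsc 1 (fun t s => f s`_0 t).
by apply => // u t s; exact: fl.
Qed.

(** Tonelli in the plane moves [x] past one variable, applied to the partial integral [k], which is
    lower semicontinuous by [iter_lsc]; the induction hypothesis moves it past the others. *)
Lemma iter_swap n f : lscs f -> (forall s, 0 <= f s) ->
  \int[mu]_x iter_int n (fun s => f (x :: s)) = iter_int n (fun s => \int[mu]_x f (x :: s)).
Proof.
elim: n f => [|n IH] f fl f0 //=.
pose k t := iter_int n (fun s => f (t`_0 :: t`_1 :: s)).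
have kl : lscs k.
  apply: (@iter_lsc n (fun t s => f [:: t`_0, t`_1 & s])) => // [t|u t s ut].
    exact: (@lscs_cons (fun l => f (t`_0 :: l)) t`_1 (lscs_cons fl)).
  apply: (lscs_liminf fl); apply: sconv_cons; last exact: (ut 0%N).
  by apply: sconv_cons; [exact: sconv_cst|exact: (ut 1%N)].
have k0 t : 0 <= k t by exact: iter_ge0.
have -> : \int[mu]_x \int[mu]_y iter_int n (fun s => f (x :: y :: s)) =
          \int[mu]_x \int[mu]_y k [:: x; y] by [].
rewrite (lscs_tonelli kl k0); apply: eq_integral => y _.
have := IH (fun l => f (l`_0 :: y :: behead l)); rewrite /k /=; apply => //.
apply: lscs_comp fl => s t st; apply: sconv_cons; last exact: (st 0%N).
by apply: sconv_cons; [exact: sconv_behead|move=> e; exact: real_cst].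
Qed.

Lemma iter_swap2 n f : lscs f -> (forall s, 0 <= f s) ->
  iter_int n.+2 f = iter_int n (fun s => \int[mu]_x \int[mu]_y f [:: x, y & s]).
Proof.
move=> fl f0 /=.
pose g l := \int[mu]_y f (l`_0 :: y :: behead l).
have gl : lscs g.
  apply: (@lscs_integral (fun y l => f (l`_0 :: y :: behead l))) => //.
    move=> y u t ut; apply: (lscs_liminf fl); apply: sconv_cons; last exact: (ut 0%N).
    by apply: sconv_cons; [exact: sconv_behead|move=> e; exact: real_cst].
  move=> t; apply: lscs_comp fl => u v uv; apply: sconv_cons; last by move=> e; exact: real_cst.
  by apply: sconv_cons; [exact: sconv_cst|exact: (uv 0%N)].
have := @iter_swap n g gl _; rewrite /g /= => <-; last by move=> s; apply: integral_ge0.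
apply: eq_integral => x _.
exact: (iter_swap n (lscs_cons fl) (fun s => f0 _)).
Qed.

Lemma integral_translate (f : R -> \bar R) (c : R) : measurable_fun [set: R] f ->
  (forall x, 0 <= f x) -> \int[mu]_x f (x + c)%R = \int[mu]_x f x.
Proof.
move=> mf f0.
have mphi : measurable_fun [set: measurableTypeR R]
    (fun x : measurableTypeR R => (x + c)%R : measurableTypeR R).
  by apply: continuous_measurable_fun => x; apply: cvgD; [exact: cvg_id|exact: cvg_cst].
pose phi : {mfun measurableTypeR R >-> measurableTypeR R} :=
  HB.pack (fun x : measurableTypeR R => (x + c)%R : measurableTypeR R)
    (@isMeasurableFun.Build _ _ _ _ _ mphi).
have E A : measurable A -> mu A = pushforward mu phi A.
  move=> mA; apply: lebesgue_measure_unique mA => _ [[a b] _ <-].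
  change (mu `]a, b] = mu (phi @^-1` `]a, b])).
  rewrite (_ : phi @^-1` _ = `](a - c)%R, (b - c)%R]%classic); last first.
    by apply/seteqP; split=> x; rewrite /phi /= !in_itv /= => /andP[h1 h2]; apply/andP; split; lra.
  rewrite !lebesgue_measure_itv/= !lte_fin ltrD2r; case: ifP => // _.
  by rewrite -!EFinD; congr (_%:E); ring.
have -> : \int[mu]_x f x = \int[pushforward mu phi]_x f x.
  by apply: eq_measure_integral => A mA _; exact: E.
rewrite ge0_integral_pushforward//= ?preimage_setT//.
Qed.

Definition translate (c s : seq R) : seq R := mkseq (fun i => s`_i + c`_i)%R (size s).

Lemma translate_cons c x s : translate c (x :: s) = (x + c`_0)%R :: translate (behead c) s.
Proof.
rewrite /translate /mkseq /= -[1%N]addn0 iotaDl -map_comp; congr (_ :: _).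
by apply: eq_map => i /=; rewrite nth_behead.
Qed.

Lemma iter_translate n c f : lscs f -> (forall s, 0 <= f s) ->
  iter_int n (fun s => f (translate c s)) = iter_int n f.
Proof.
elim: n c f => [|n IH] c f fl f0 //=.
have -> : (fun x => iter_int n (fun s => f (translate c (x :: s)))) =
          (fun x => iter_int n (fun s => f ((x + c`_0)%R :: s))).
  apply/funext => x; rewrite -(IH (behead c) (fun s => f ((x + c`_0)%R :: s))) //; last exact: lscs_cons.
  by apply: iter_eq => s; rewrite translate_cons.
apply: (@integral_translate (fun x => iter_int n (fun s => f (x :: s)))).
  exact: iter_measurable.
by move=> x; exact: iter_ge0.
Qed.

End IterInt.

(** * Square integrability makes exceptional points harmless *)

Section SquareIntegrable.
Variable R : realType.
Local Notation C := R[i].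
Local Notation mu := (@lebesgue_measure R).
Local Notation Re := (@complex.Re R).
Local Notation Im := (@complex.Im R).

(** Dominated convergence for the restrictions of [V] to intervals shrinking to [a]. The point [a]
    is removed from the domain so that they tend to zero everywhere, which is why []l, r[] must lie
    on one side of [a]. *)
Lemma integral_near_small (V : R -> \bar R) (a eta : R) :
  measurable_fun [set: R] V -> (forall x, (0 <= V x)%E) -> (\int[mu]_x V x < +oo)%E -> 0 < eta ->
  exists2 t : R, 0 < t & forall l r, a - t <= l -> l <= r -> r <= a + t -> r <= a \/ a <= l ->
    (\int[mu]_(x in `]l, r[) V x < eta%:E)%E.
Proof.
move=> mV V0 IV e0; pose D := ~` [set a].
have mD : measurable D by apply: measurableC; exact: measurable_set1.
pose f (n : nat) x := (V \_ `](a - n.+1%:R^-1), (a + n.+1%:R^-1)[) x.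
have mf n : measurable_fun D (f n).
  by apply: measurable_funTS; apply/(measurable_restrictT _ _).1 => //; exact: measurable_funTS.
have f0 n x : (0 <= f n x)%E by rewrite /f /patch; case: ifP.
have fV n x : (f n x <= V x)%E by rewrite /f /patch; case: ifP.
have iV : mu.-integrable D V.
  apply: (@integrableS _ _ _ _ setT) => //; apply/integrableP; split=> //.
  by under eq_integral do rewrite gee0_abs//.
have c1 : {ae mu, forall x, D x -> f ^~ x @ \oo --> cst 0%E x}.
  apply: aeW => x /= xa; apply: cvg_near_cst; near=> n.
  rewrite /f /patch ifF//.
  apply/negbTE/negP => /set_mem /=; rewrite in_itv /= => /andP[h1 h2].
  have : `|x - a| < n.+1%:R^-1.
    by move: h1 h2; set q := (_^-1 : R) => h1 h2; rewrite ltr_norml; apply/andP; split; lra.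
  apply/negP; rewrite -leNgt; near: n.
  have xa0 : 0 < `|x - a| by rewrite normr_gt0 subr_eq0; apply/eqP.
  exists (Num.truncn `|x - a|^-1) => // n /= Nn.
  apply/ltW; rewrite invf_plt ?posrE//; apply: lt_le_trans (truncnS_gt _) _.
  by rewrite ler_nat ltnS.
have c2 : {ae mu, forall x n, D x -> (`|f n x| <= V x)%E}.
  by apply: aeW => x n _; rewrite gee0_abs.
have [_ _] := @dominated_convergence _ _ R mu D mD f (cst 0%E) V mf (@measurable_cst _ _ _ _ _ _) c1 iV c2.
rewrite integral0 => /fine_cvgP[/= [N1 _ H1] /cvgrPdist_lt/(_ _ e0)[N2 _ H2]].
pose n := maxn N1 N2; exists n.+1%:R^-1; first by rewrite invr_gt0.
move=> l r al lr ra lra0.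
have := H2 n (leq_maxr _ _); have := H1 n (leq_maxl _ _) => fn.
rewrite /= sub0r normrN => fe.
apply: (@le_lt_trans _ _ (\int[mu]_(x in D) f n x)%E); last first.
  rewrite -(fineK fn) lte_fin; apply: le_lt_trans fe; exact: ler_norm.
apply: (@le_trans _ _ (\int[mu]_(x in `]l, r[) f n x)%E).
  apply: ge0_le_integral => //; try exact: measurable_funTS.
    apply: measurable_funS (mf n) => // x /=; rewrite in_itv /= => /andP[h1 h2] xa.
    by case: lra0 => q; [move: (lt_le_trans h2 q)|move: (le_lt_trans q h1)]; rewrite xa ltxx.
  move=> x /=; rewrite in_itv /= => /andP[h1 h2]; rewrite /f /patch ifT//.
  apply/mem_set; move: al ra; rewrite /= in_itv /=; set q := (_^-1 : R) => al ra.
  by apply/andP; split; clear -h1 h2 al ra; lra.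
apply: ge0_subset_integral; [exact: measurable_itv|exact: mD|exact: mf|by move=> x _|].
move=> x /=; rewrite in_itv /= => /andP[h1 h2] xa.
by case: lra0 => q; [move: (lt_le_trans h2 q)|move: (le_lt_trans q h1)]; rewrite xa ltxx.
Unshelve. all: by end_near. Qed.

(** Otherwise [V] would exceed [M] on the interval outside the null set [range X], and its integral
    would be at least [M * (r - l)]. *)
Lemma pick_small (V : R -> \bar R) (l r M : R) (X : nat -> R) :
  measurable_fun [set: R] V -> (forall x, (0 <= V x)%E) -> l < r -> 0 <= M ->
  (\int[mu]_(x in `]l, r[) V x < (M * (r - l))%:E)%E ->
  exists x, [/\ l < x, x < r, (forall k, x != X k) & (V x <= M%:E)%E].
Proof.
move=> mV V0 lr M0 H; apply: contrapT => no; move: H; apply/negP; rewrite -leNgt.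
have cX : countable (range X) by exact: card_le_trans (card_image_le _ _) _.
have mX : measurable (range X).
  by apply: countable_measurable cX => t; exact: measurable_set1.
have mA : measurable (`]l, r[ `\` range X) by exact: measurableD.
apply: (@le_trans _ _ (\int[mu]_(x in `]l, r[ `\` range X) cst M%:E x)%E).
  rewrite integral_cst// measureD//=; last first.
    by rewrite lebesgue_measure_itv/= lte_fin lr -EFinB ltry.
  rewrite (_ : mu (_ `&` _) = 0%E) ?sube0; last first.
    apply: countable_lebesgue_measure0; apply: sub_countable cX.
    by apply: subset_card_le => x [].
  by rewrite lebesgue_measure_itv/= lte_fin lr -EFinB -EFinM.
apply: (@le_trans _ _ (\int[mu]_(x in `]l, r[ `\` range X) V x)%E).
  apply: ge0_le_integral => //; try exact: measurable_funTS.
  move=> x [/=]; rewrite in_itv /= => /andP[h1 h2] xX; rewrite leNgt; apply/negP => h.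
  apply: no; exists x; split=> //; last exact: ltW.
  by move=> k; apply/eqP => e; apply: xX; exists k.
by apply: ge0_subset_integral => //; exact: measurable_funTS.
Qed.

(** The pointwise inequality [u <= al + q / al], with [q] the squared modulus, takes the place of
    Cauchy-Schwarz; the free parameter [al] is there to balance the two terms. *)
Lemma amgm_side (psi : R -> C) (hh : R -> \bar R) (a b v al : R) :
  a <= b -> ctn a b psi -> measurable_fun [set: R] hh -> (forall t, (0 <= hh t)%E) ->
  (forall t, a <= t <= b -> hh t = (sqmod (psi t))%:E) ->
  (\int[mu]_t hh t <= v%:E)%E -> 0 < al ->
  \int[mu]_(t in `[a, b]) cn (psi t) <= (b - a) * al + v / al.
Proof.
move=> ab cp mh h0 hp hv al0.
have I := ctn_integrable (g := @cn R) (@cn_lip R) cp.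
have fI : (\int[mu]_(t in `[a, b]) (cn (psi t))%:E)%E \is a fin_num.
  by have := @lebesgue_integrable.integrable_fin_num _ _ R mu `[a, b]%classic _ _ I; apply.
rewrite -lee_fin [X in (X%:E <= _)%E]/Rintegral fineK//.
have al1 : 0 <= al^-1 by rewrite invr_ge0 ltW.
have mal : measurable_fun `[a, b] (fun t => (al^-1)%:E * hh t)%E.
  by apply: measurable_funeM; exact: measurable_funTS.
apply: (@le_trans _ _ (\int[mu]_(t in `[a, b]) (cst al%:E t + (al^-1)%:E * hh t))%E).
  apply: ge0_le_integral => //.
  - by move=> t _; rewrite lee_fin cn_ge0.
  - by case/integrableP: I.
  - by apply: emeasurable_funD => //; exact: measurable_cst.
  move=> t /=; rewrite in_itv /= => /hp ->; rewrite -EFinM -EFinD lee_fin.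
  have := cn_sqmod (psi t); have := cn_ge0 (psi t); set u := cn _; set q := sqmod _ => u0 uq.
  clearbody u q; rewrite -(ler_pM2l al0) (_ : al * (al + _) = al * al + q); last first.
    by field; rewrite gt_eqF.
  have := sqr_ge0 (u - al); clear -uq u0 al0; nra.
rewrite ge0_integralD//; first last.
- by move=> t _; rewrite mule_ge0.
- by move=> t _; rewrite lee_fin ltW.
rewrite integral_cst//= lebesgue_measure_itv/= lte_fin.
rewrite EFinD; apply: leeD.
  case: ltP => _; rewrite -?EFinB -?EFinM ?lee_fin; first by rewrite mulrC.
  by rewrite mulr0 mulr_ge0 ?subr_ge0// ltW.
rewrite ge0_integralZl//; first last.
  exact: measurable_funTS.
rewrite mulrC EFinM; apply: lee_wpmul2l; first by rewrite lee_fin.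
apply: le_trans hv; apply: ge0_subset_integral => //.
Qed.

(** The bound is scale invariant. A strip of width [t] near [p] has square mass below [k ^ 2], so
    some edge line in it has square integral at most [k ^ 2 / t]; over a length of order [t] the
    integral of [cn f] is then of order [k], however small [t] is. *)
Lemma vanish_L2 (f : C -> C) (O : set C) (sing : nat -> C) p (dl0 : R) (h : seq R -> \bar R) :
  0 < dl0 -> (forall z, O z -> cdif f z) ->
  (forall z, cn (z - p) < dl0 -> O z \/ exists k, z = sing k) ->
  lscs h -> (forall s, (0 <= h s)%E) ->
  (forall x y, O (x +i* y)%C -> h [:: x; y] = (sqmod (f (x +i* y)%C))%:E) ->
  (\int[mu]_x \int[mu]_y h [:: x; y] < +oo)%E -> vanish f p.
Proof.
move=> d00 fO cov hl h0 hf hI e dl X Y e0 dlp.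
pose h' l := h [:: l`_1; l`_0].
have hl' : lscs h'.
  by apply: lscs_comp hl => s t st; do 2?apply: sconv_cons; [exact: sconv_cst|exact: st|exact: st].
pose V x := (\int[mu]_y h [:: x; y])%E; pose U y := (\int[mu]_x h [:: x; y])%E.
have V0 x : (0 <= V x)%E by apply: integral_ge0.
have U0 y : (0 <= U y)%E by apply: integral_ge0.
have mV : measurable_fun [set: R] V by exact: (@iter_measurable R 1 h).
have mU : measurable_fun [set: R] U by exact: (@iter_measurable R 1 h' hl' (fun s => h0 _)).
have mh x : measurable_fun [set: R] (fun y => h [:: x; y]).
  by apply: (@iter_measurable R 0 (fun s => h (x :: s))) => //; exact: lscs_cons.
have mh' y : measurable_fun [set: R] (fun x => h [:: x; y]).
  by apply: (@iter_measurable R 0 (fun s => h' (y :: s)) (lscs_cons hl') (fun s => h0 _)).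
have IU : (\int[mu]_y U y < +oo)%E by rewrite -(lscs_tonelli hl h0).
pose k := e / 24; have k0 : 0 < k by rewrite divr_gt0.
have s0 : 0 < k ^+ 2 by rewrite exprn_gt0.
have [t1 t10 H1] := integral_near_small (Re p) mV V0 hI s0.
have [t2 t20 H2] := integral_near_small (Im p) mU U0 IU s0.
pose t := Num.min (Num.min t1 t2) (Num.min dl dl0) / 16.
have [t0 tt1 tt2 [tdl tdl0]] : [/\ 0 < t, 2 * t <= t1, 2 * t <= t2 & 2 * t < dl /\ 16 * t <= dl0].
  have m0 : 0 < Num.min (Num.min t1 t2) (Num.min dl dl0) by rewrite !lt_min t10 t20 dlp.
  have m1 : Num.min (Num.min t1 t2) (Num.min dl dl0) <= Num.min t1 t2 by rewrite ge_min lexx.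
  have m2 : Num.min (Num.min t1 t2) (Num.min dl dl0) <= Num.min dl dl0 by rewrite ge_min lexx orbT.
  have m3 : Num.min t1 t2 <= t1 by rewrite ge_min lexx.
  have m4 : Num.min t1 t2 <= t2 by rewrite ge_min lexx orbT.
  have m5 : Num.min dl dl0 <= dl by rewrite ge_min lexx.
  have m6 : Num.min dl dl0 <= dl0 by rewrite ge_min lexx orbT.
  rewrite /t; clear -m0 m1 m2 m3 m4 m5 m6; by split; [lra..|split; lra].
clearbody t.
have tn0 : t != 0 by rewrite gt_eqF.
pose M := k ^+ 2 / t; have M0 : 0 <= M by rewrite ltW// divr_gt0.
have Mt : M * t = k ^+ 2 by rewrite /M divfK.
(* Two sequences to be avoided are interleaved by parity into the single one that [pick_small]
   accepts. *)
have mix (A B : nat -> R) (x : R) :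
    (forall n, x != (if odd n then A n./2 else B n./2)) ->
    (forall n, x != A n) /\ (forall n, x != B n).
  move=> H; split=> n; first by have := H n.*2.+1; rewrite /= odd_double uphalf_double.
  by have := H n.*2; rewrite odd_double doubleK.
have pick (Q : R -> \bar R) c t' (Z W : nat -> R) : measurable_fun [set: R] Q -> (forall x, (0 <= Q x)%E) ->
    (forall l r, c - t' <= l -> l <= r -> r <= c + t' -> r <= c \/ c <= l ->
      (\int[mu]_(x in `]l, r[) Q x < (k ^+ 2)%:E)%E) -> 2 * t <= t' ->
    exists x1 x2, [/\ c - 2 * t < x1 < c - t, c + t < x2 < c + 2 * t,
      [/\ forall n, x1 != Z n, forall n, x1 != W n, forall n, x2 != Z n & forall n, x2 != W n] &
      (Q x1 <= M%:E)%E /\ (Q x2 <= M%:E)%E].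
  move=> mQ Q0 HQ tt'.
  have [||x1 [h1 h2 /mix[h3 h4] h5]] := @pick_small Q (c - 2 * t) (c - t) M
     (fun n => if odd n then Z n./2 else W n./2) mQ Q0 _ M0; first lra.
    rewrite (_ : M * _ = k ^+ 2); last by rewrite -Mt; ring.
    by apply: HQ; clear -tt' t0; [lra..|left; lra].
  have [||x2 [g1 g2 /mix[g3 g4] g5]] := @pick_small Q (c + t) (c + 2 * t) M
     (fun n => if odd n then Z n./2 else W n./2) mQ Q0 _ M0; first lra.
    rewrite (_ : M * _ = k ^+ 2); last by rewrite -Mt; ring.
    by apply: HQ; clear -tt' t0; [lra..|right; lra].
  by exists x1, x2; rewrite h1 h2 g1 g2.
have [x1 [x2 [/andP[a1 a2] /andP[a3 a4] [b1 b2 b3 b4] [V1 V2]]]] :=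
  pick V (Re p) t1 X (fun n => Re (sing n)) mV V0 H1 tt1.
have [y1 [y2 [/andP[c1 c2] /andP[c3 c4] [d1 d2 d3 d4] [U1 U2]]]] :=
  pick U (Im p) t2 Y (fun n => Im (sing n)) mU U0 H2 tt2.
have x12 : x1 <= x2 by clear -a2 a3 t0; lra.
have y12 : y1 <= y2 by clear -c2 c3 t0; lra.
have onO z : onb x1 x2 y1 y2 z -> O z.
  move=> bz; have zi : inr x1 x2 y1 y2 z by case/andP: bz.
  have /cov[//|[n zn]] : cn (z - p) < dl0.
    apply: (@le_lt_trans _ _ (2 * (2 * t))); last lra.
    by apply: cnB_box zi; clear -a1 a2 a3 a4 c1 c2 c3 c4; lra.
  case/andP: bz => _ /or4P[] /eqP E; exfalso; move: E; rewrite zn => E.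
  - by move: (b2 n); rewrite E eqxx.
  - by move: (b4 n); rewrite E eqxx.
  - by move: (d2 n); rewrite E eqxx.
  - by move: (d4 n); rewrite E eqxx.
have bd : bdif f x1 x2 y1 y2 by move=> z /onO; exact: fO.
exists x1, x2, y1, y2; split.
- by split; clear -a1 a2 a3 a4 c1 c2 c3 c4 t0 tdl; lra.
- by split; clear -a1 a2 a3 a4 c1 c2 c3 c4 t0 tdl; lra.
- by move=> n; split.
split=> //.
have [C1 C2 C3 C4] := bdif_ctn x12 y12 bd.
(* With this choice an edge of length at most [4 * t] costs [4 * k] plus [M / al = k], and four
   edges cost [20 * k], below [e] because [k = e / 24]. *)
pose al := k / t; have al0 : 0 < al by rewrite divr_gt0.
have Mal : M / al = k by rewrite /M /al; field; rewrite tn0 gt_eqF.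
have bnd (u : R) : u <= 4 * t -> u * al + M / al <= 5 * k.
  move=> ut; rewrite Mal; have : u * al <= 4 * t * al by rewrite ler_pM2r.
  by rewrite (_ : 4 * t * al = 4 * k); [lra|rewrite /al; field].
have S1 : \int[mu]_(s in `[x1, x2]) cn (f (s +i* y1)%C) <= 5 * k.
  apply: le_trans (bnd (x2 - x1) _); last by clear -a1 a4; lra.
  apply: (@amgm_side _ (fun x => h [:: x; y1])) => // s /andP[s1 s2].
  by apply: hf; apply: onO; rewrite /onb /inr /= s1 s2 lexx y12 eqxx !orbT.
have S2 : \int[mu]_(s in `[x1, x2]) cn (f (s +i* y2)%C) <= 5 * k.
  apply: le_trans (bnd (x2 - x1) _); last by clear -a1 a4; lra.
  apply: (@amgm_side _ (fun x => h [:: x; y2])) => // s /andP[s1 s2].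
  by apply: hf; apply: onO; rewrite /onb /inr /= s1 s2 lexx y12 eqxx !orbT.
have S3 : \int[mu]_(s in `[y1, y2]) cn (f (x1 +i* s)%C) <= 5 * k.
  apply: le_trans (bnd (y2 - y1) _); last by clear -c1 c4; lra.
  apply: (@amgm_side _ (fun y => h [:: x1; y])) => // s /andP[s1 s2].
  by apply: hf; apply: onO; rewrite /onb /inr /= s1 s2 lexx x12 eqxx.
have S4 : \int[mu]_(s in `[y1, y2]) cn (f (x2 +i* s)%C) <= 5 * k.
  apply: le_trans (bnd (y2 - y1) _); last by clear -c1 c4; lra.
  apply: (@amgm_side _ (fun y => h [:: x2; y])) => // s /andP[s1 s2].
  by apply: hf; apply: onO; rewrite /onb /inr /= s1 s2 lexx x12 eqxx orbT.
rewrite /per; have : 20 * k < e by rewrite /k; clear -e0; lra.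
clear -S1 S2 S3 S4; lra.
Qed.

End SquareIntegrable.

(** * Counting balls: null sets and slices *)

Section RealCoordinates.
Variable R : realType.
Local Notation C := R[i].
Implicit Types (s : seq R) (e : R).

(** A section of [ptC]: real parts at even places, imaginary parts at odd ones. The default 0 is
    never reached, as indices below [2 * n] halve to valid ordinals. *)
Definition rcs n (z : 'rV[C]_n) : seq R :=
  mkseq (fun i => let w := oapp (fun j : 'I_n => z 0 j) 0 (insub i./2) in
    if odd i then complex.Im w else complex.Re w) (2 * n).

Lemma size_rcs n (z : 'rV[C]_n) : size (rcs z) = (2 * n)%N.
Proof. by rewrite size_mkseq. Qed.

Lemma rcs_re n (z : 'rV[C]_n) (j : 'I_n) : (rcs z)`_(2 * j) = complex.Re (z 0 j).
Proof.
rewrite nth_mkseq ?ltn_pmul2l//; rewrite mul2n odd_double doubleK.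
by rewrite valK.
Qed.

Lemma rcs_im n (z : 'rV[C]_n) (j : 'I_n) : (rcs z)`_(2 * j).+1 = complex.Im (z 0 j).
Proof.
rewrite nth_mkseq ?ltn_pmul2l//; last by rewrite mul2n -doubleS -mul2n leq_pmul2l.
rewrite mul2n /= odd_double uphalf_double.
by rewrite valK.
Qed.

Lemma inboxP e (c s : seq R) : (forall i, (i < size c)%N -> `|s`_i - c`_i| < e) -> inbox e c s.
Proof.
elim: c s => [//|a c IH] s H /=; rewrite (H 0%N)//=; apply: IH => i ic.
by rewrite nth_behead; exact: (H i.+1).
Qed.

Lemma inbox_nth e (c s : seq R) i : inbox e c s -> (i < size c)%N -> `|s`_i - c`_i| < e.
Proof.
elim: c s i => [//|a c IH] s [|i] /= /andP[h1 h2] ic //.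
by rewrite -nth_behead; exact: IH.
Qed.

Lemma inbox_rcs n (z : 'rV[C]_n) e s : vn (z - ptC n s) < e -> inbox e (rcs z) s.
Proof.
move=> H; apply: inboxP => i; rewrite size_rcs => i2.
have i2n : (i./2 < n)%N by rewrite ltn_half_double -mul2n.
have := le_lt_trans (vn_coord (z - ptC n s) (Ordinal i2n)) H.
rewrite !mxE /= => h.
have -> : i = (odd i + 2 * i./2)%N by rewrite mul2n odd_double_half.
have h1 := le_lt_trans (Re_cn _) h; have h2 := le_lt_trans (Im_cn _) h.
move: h1 h2; case E : (z 0 _) => [a b] /= h1 h2.
case: (odd i) => /=.
  by rewrite add1n (rcs_im z (Ordinal i2n)) E /= distrC.
by rewrite add0n (rcs_re z (Ordinal i2n)) E /= distrC.
Qed.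

Lemma vn_inbox n (z : 'rV[C]_n) e s : inbox e (rcs z) s -> vn (ptC n s - z) <= n%:R * (2 * e).
Proof.
move=> H; rewrite mulrC mulr_natr -[X in _ *+ X]card_ord -sumr_const; apply: ler_sum => j _.
rewrite !mxE; have j2 : (2 * j < size (rcs z))%N by rewrite size_rcs ltn_pmul2l.
have j3 : ((2 * j).+1 < size (rcs z))%N by rewrite size_rcs mul2n -doubleS -mul2n leq_pmul2l.
have := inbox_nth H j2; have := inbox_nth H j3; rewrite rcs_re rcs_im.
by case: (z 0 j) => a b /=; rewrite /cn /= => h1 h2; lra.
Qed.

End RealCoordinates.

Section Counting.
Variable R : realType.
Local Notation C := R[i].
Local Open Scope ereal_scope.

Lemma iter_le_size n (f g : seq R -> \bar R) :
  (forall s, size s = n -> 0 <= f s) -> (forall s, size s = n -> f s <= g s) ->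
  iter_int n f <= iter_int n g.
Proof.
elim: n f g => [|n IH] f g f0 fg; first exact: fg.
have G0 m (h : seq R -> \bar R) : (forall s, size s = m -> 0 <= h s) -> 0 <= iter_int m h.
  elim: m h => [|m IHm] h h0; first exact: h0.
  by apply: integral_ge0 => x _; apply: IHm => s sm; apply: h0; rewrite /= sm.
apply: integral_mono => x; first by apply: G0 => s sn; apply: f0; rewrite /= sn.
by apply: IH => s sn; [apply: f0|apply: fg]; rewrite /= sn.
Qed.

Lemma limn_einf_le_cst (u : nat -> \bar R) (B : \bar R) : (forall k, u k <= B) -> limn_einf u <= B.
Proof.
by move=> uB; rewrite leNgt; apply/negP => /limn_einf_gt[N /(_ N (leqnn _))]; rewrite ltNge uB.
Qed.

(** If the limit inferior were infinite on the whole box, it would dominate the constant [K] there,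
    and Fatou would put [b + 1] below the bound [b]. A good point in every box replaces finiteness
    almost everywhere. *)
Lemma bounded_liminf_point N (H : nat -> seq R -> \bar R) (B : \bar R) (c : seq R) (e : R) :
  (forall k, lscs (H k)) -> (forall k s, 0 <= H k s) -> B < +oo ->
  (forall k, iter_int N (H k) <= B) -> size c = N -> (0 < e)%R ->
  exists s, [/\ size s = N, inbox e c s & limn_einf (fun k => H k s) < +oo].
Proof.
move=> Hl H0 Boo HB cN e0; apply: contrapT => no.
have B0 : 0 <= B by apply: le_trans (HB 0%N); exact: iter_ge0.
case: B Boo HB B0 => [b| |]// _ HB b0.
have v0 : (0 < (2 * e) ^+ N)%R by rewrite exprn_gt0// mulr_gt0.
pose K := ((b + 1) / (2 * e) ^+ N)%R.
have b1 : (0 <= b + 1)%R by move: b0; rewrite lee_fin; lra.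
have K0 : (0 <= K)%R by rewrite divr_ge0// ltW.
have : (K * (2 * e) ^+ N)%:E <= b%:E.
  have := iter_inbox c e0 K0; rewrite cN => <-.
  apply: (@le_trans _ _ (iter_int N (fun s => limn_einf (fun k => H k s)))).
    apply: iter_le_size => s sN; first by case: ifP.
    case: ifP => sb; last by apply: (@limn_einf_ge_cst _ _ _ 0%N) => k _.
    have [h|] := ltP (limn_einf (fun k => H k s)) +oo; first by case: no; exists s.
    by rewrite leye_eq => /eqP ->; exact: leey.
  apply: le_trans (iter_fatou _ Hl H0) _; exact: limn_einf_le_cst.
by rewrite lee_fin /K divfK ?gt_eqF//; lra.
Qed.

Definition boxes (K rho : R) (cs : seq (seq R)) s : \bar R :=
  (K * (count (fun c => inbox rho c s) cs)%:R)%:E.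

Lemma boxesE K rho cs s :
  boxes K rho cs s = \sum_(c <- cs) (if inbox rho c s then K%:E else 0).
Proof.
rewrite /boxes; elim: cs => [|c cs IH]; first by rewrite big_nil mulr0.
rewrite big_cons -IH /=; case: ifP => _; last by rewrite add0e.
by rewrite -EFinD natrD mulrDr mulr1.
Qed.

Lemma boxes_ge0 K rho cs s : (0 <= K)%R -> 0 <= boxes K rho cs s.
Proof. by move=> K0; rewrite lee_fin mulr_ge0. Qed.

Lemma lscs_boxes K rho cs : (0 <= K)%R -> lscs (boxes K rho cs).
Proof.
move=> K0; rewrite (_ : boxes K rho cs = fun s => \sum_(c <- cs) (if inbox rho c s then K%:E else 0)).
  by apply: lscs_sum => [c|c s]; [exact: lscs_inbox|case: ifP].
by apply/funext => s; rewrite boxesE.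
Qed.

Lemma iter_boxes N K rho cs : (0 < rho)%R -> (0 <= K)%R -> (forall c, c \in cs -> size c = N) ->
  iter_int N (boxes K rho cs) = (K * ((size cs)%:R * (2 * rho) ^+ N))%:E.
Proof.
move=> r0 K0 sz.
rewrite (iter_eq _ (boxesE K rho cs)) iter_sum; last first.
- by move=> c s; case: ifP.
- by move=> c; exact: lscs_inbox.
rewrite (eq_big_seq (fun=> (K * (2 * rho) ^+ N)%:E)); last first.
  by move=> c /sz <-; exact: iter_inbox.
elim: cs {sz} => [|c cs IH]; first by rewrite big_nil /= mul0r mulr0.
rewrite big_cons IH -EFinD /=; congr (_%:E); rewrite [((size cs).+1)%:R]mulrS; ring.
Qed.

(** Content zero in the full real dimension [2 * d], by finite covers with equal balls. *)
Definition nb d (X : set 'rV[C]_d) := forall dl : R, (0 < dl)%R -> exists (rho : R) (t : seq 'rV[C]_d),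
  [/\ (0 < rho)%R, ((size t)%:R * rho ^+ (2 * d) <= dl)%R &
   forall x, X x -> exists2 c, c \in t & (vn (x - c) <= rho)%R].

Lemma cb_nb n (X : set 'rV[C]_n.+1) : cb (2 * n) X -> nb X.
Proof.
move=> [A HA] dl d0.
have A0 : (0 <= A)%R.
  have [|t [h _]] := HA 1%R; first by rewrite ltr01 lexx.
  by apply: le_trans h; rewrite expr1n mulr1.
pose e : R := (Num.min 1 (dl / (A + 1)))%R.
have A1 : (0 < A + 1)%R by rewrite ltr_wpDl.
have e0 : (0 < e)%R by rewrite lt_min ltr01 divr_gt0.
have e1 : (e <= 1)%R by rewrite ge_min lexx.
have [|t [h1 h2]] := HA e; first by rewrite e0.
exists e, t; split=> //.
rewrite mulnS addnC exprD mulrA.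
apply: (@le_trans _ _ (A * e ^+ 2)%R); first by rewrite ler_wpM2r// exprn_ge0// ltW.
have : (e * (A + 1) <= dl)%R by rewrite -ler_pdivlMr// ge_min lexx orbT.
by clearbody e; nra.
Qed.

(** At stage [k] each of the first [k] sets is covered by boxes of total volume at most
    [(k + 1) ^ -2], counted with weight [k + 1]: the integral is at most [k / (k + 1)], while on
    each [Y i] the value is eventually at least [k + 1]. The factor [4 ^ (2 * d)] allows for boxes
    of side [4 * rho]. *)
Lemma null_majorant d (Y : nat -> set 'rV[C]_d) : (forall i, nb (Y i)) ->
  exists H : nat -> seq R -> \bar R, [/\ forall k, lscs (H k), forall k s, 0 <= H k s,
    forall k, iter_int (2 * d) (H k) <= 1 &
    forall s, (exists i, Y i (ptC d s)) -> limn_einf (fun k => H k s) = +oo].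
Proof.
move=> HY.
pose dl (k : nat) := ((k.+1%:R ^+ 2 * 4 ^+ (2 * d))^-1 : R)%R.
have dl0 k : (0 < dl k)%R by rewrite invr_gt0 mulr_gt0// exprn_gt0.
have /choice[rt Hrt] : forall ik : nat * nat, exists rt : R * seq 'rV[C]_d,
   [/\ (0 < rt.1)%R, ((size rt.2)%:R * rt.1 ^+ (2 * d) <= dl ik.2)%R &
   forall x, Y ik.1 x -> exists2 c, c \in rt.2 & (vn (x - c) <= rt.1)%R].
  by move=> [i k]; have [rho [t]] := HY i _ (dl0 k); exists (rho, t).
pose bx k i := boxes k.+1%:R (2 * (rt (i, k)).1)%R [seq rcs c | c <- (rt (i, k)).2].
have bx0 k i s : 0 <= bx k i s by exact: boxes_ge0.
have bxl k i : lscs (bx k i) by exact: lscs_boxes.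
exists (fun k s => \sum_(i <- iota 0 k) bx k i s); split.
- by move=> k; exact: lscs_sum.
- by move=> k s; apply: sume_ge0.
- move=> k; rewrite iter_sum//.
  apply: (@le_trans _ _ (\sum_(i <- iota 0 k) (k.+1%:R^-1)%:E)).
    apply: lee_sum => i _; have [r0 h _] := Hrt (i, k).
    rewrite iter_boxes//; first last.
    - by move=> _ /mapP[c _ ->]; rewrite size_rcs.
    - by rewrite mulr_gt0.
    rewrite lee_fin size_map; move: h r0; rewrite /dl /=.
    set u := (rt _).1; set m := size _ => h u0.
    rewrite (_ : 2 * (2 * u) = 4 * u)%R; last by ring.
    rewrite exprMn.
    have P0 : (0 < 4 ^+ (2 * d) :> R)%R by rewrite exprn_gt0.
    move: h; set q := (u ^+ _)%R; move: P0; set P := (4 ^+ _)%R => P0 h.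
    have k0 : (0 < k.+1%:R :> R)%R by [].
    move: h k0; set K := (k.+1%:R : R)%R => h k0; clearbody K P q.
    apply: (@le_trans _ _ (K * (P * (K ^+ 2 * P)^-1)))%R.
      rewrite (_ : K * (m%:R * (P * q)) = (K * P) * (m%:R * q))%R; last by ring.
      by rewrite [leRHS]mulrA ler_pM2l// mulr_gt0.
    by rewrite le_eqVlt; apply/orP; left; apply/eqP; field; rewrite !gt_eqF.
  rewrite big_const_seq count_predT size_iota.
  have -> : forall m, iter m (adde (k.+1%:R^-1)%:E) 0 = (m%:R / k.+1%:R : R)%:E.
    elim=> [|m IH]; first by rewrite mul0r.
    by rewrite iterS IH [in RHS]mulrS mulrDl mul1r EFinD.
  by rewrite lee_fin ler_pdivrMr// mul1r ler_nat.
- move=> s [i Yi]; apply/eqP; rewrite -leye_eq; apply: limn_einf_ge => a _.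
  exists (maxn i.+1 (Num.truncn a).+1) => k; rewrite geq_max => /andP[ik ak].
  have ii : i \in iota 0 k by rewrite mem_iota.
  rewrite (big_rem i ii) /=; apply: (@le_trans _ _ (bx k i s)); last first.
    by rewrite leeDl// sume_ge0.
  have [r0 _ /(_ _ Yi)[c ct cs]] := Hrt (i, k).
  rewrite /bx /boxes lee_fin count_map.
  have : (0 < count (preim (@rcs R d) (fun c => inbox (2 * (rt (i, k)).1) c s)) (rt (i, k)).2)%N.
    rewrite -has_count; apply/hasP; exists c => //=; apply: inbox_rcs.
    by move: cs r0; rewrite vn_sym /=; lra.
  move=> h; apply: (@le_trans _ _ (k.+1%:R)%R).
    apply: (le_trans (ltW (truncnS_gt a))); rewrite ler_nat; exact: leqW.
  by rewrite ler_peMr// ler1n.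
Qed.

Lemma null_no_interior d (Y : nat -> set 'rV[C]_d) (X : set 'rV[C]_d) z (e : R) :
  (forall i, nb (Y i)) -> X `<=` \bigcup_i Y i -> (0 < e)%R ->
  (forall w, (vn (w - z) < e)%R -> X w) -> False.
Proof.
move=> HY XY e0 Hz; have [H [h1 h2 h3 h4]] := null_majorant HY.
pose e' := (e / (2 * d%:R + 1) / 2)%R.
have D0 : (0 < 2 * d%:R + 1 :> R)%R by rewrite ltr_wpDl.
have e'0 : (0 < e')%R by rewrite !divr_gt0.
have [s [_ s2]] := bounded_liminf_point h1 h2 (ltry 1%R) h3 (size_rcs z) e'0.
rewrite h4; first by rewrite ltxx.
have [|i _ Yi] := XY (ptC d s); last by exists i.
apply: Hz; apply: le_lt_trans (vn_inbox s2) _.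
have : (e' * (2 * d%:R + 1) < e)%R.
  by rewrite /e' -mulrA [(2^-1 * _)%R]mulrC mulrA divfK ?gt_eqF//; lra.
by move: e'0; clearbody e'; lra.
Qed.

Lemma bounded_countable (T : choiceType) (X : set T) (M : nat) :
  (forall l : seq T, uniq l -> (forall x, x \in l -> X x) -> (size l <= M)%N) -> countable X.
Proof.
move=> H; apply: finite_set_countable; apply: contrapT => nf.
have E m : exists l : seq T, [/\ uniq l, size l = m & forall x, x \in l -> X x].
  elim: m => [|m [l [l1 l2 l3]]]; first by exists [::].
  have [x [Xx xl]] : exists x, X x /\ x \notin l.
    apply: contrapT => no; apply: nf; apply: (@sub_finite_set _ _ [set` l]) (finite_seq l).
    by move=> x Xx; apply: contrapT => /negP xl; apply: no; exists x.
  exists (x :: l); rewrite /= xl l1 l2; split=> // z; rewrite inE => /orP[/eqP ->//|].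
  exact: l3.
have [l [l1 l2 l3]] := E M.+1.
by have := H l l1 l3; rewrite l2 ltnn.
Qed.

(** Over a parameter [s] the balls whose projection reaches [s] are counted with weight [K i]. The
    exponent of the content is the real dimension of the parameter space, so these counts have
    bounded integral at every scale. Where their limit inferior is finite, each [Y i] meets the
    fibre in boundedly many points. [Phi] joins the counts so that the same [s] makes it finite. *)
Lemma countable_slice n d (Y : nat -> set 'rV[C]_d) (p : nat -> 'rV[C]_d -> 'rV[C]_n)
    (L : nat -> R) (Phi : seq R -> \bar R) (c : seq R) (e : R) :
  (forall i, cb (2 * n) (Y i)) ->
  (forall i, 0 < L i)%R ->
  (forall i x y, Y i x -> Y i y -> (vn (p i x - p i y) <= L i * vn (x - y))%R) ->
  lscs Phi -> (forall s, 0 <= Phi s) -> iter_int (2 * n) Phi < +oo ->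
  size c = (2 * n)%N -> (0 < e)%R ->
  exists s, [/\ size s = (2 * n)%N, inbox e c s, Phi s < +oo &
    countable [set x | exists i, Y i x /\ p i x = ptC n s]].
Proof.
move=> HY L0 HL Pl P0 Poo cn2 e0.
have {HY}/choice[A HA] := HY.
have /choice[t Ht] : forall ik : nat * nat, exists t : seq 'rV[C]_d,
    ((size t)%:R * ik.2.+1%:R^-1 ^+ (2 * n) <= A ik.1)%R /\
    forall x, Y ik.1 x -> exists2 c, c \in t & (vn (x - c) <= ik.2.+1%:R^-1)%R.
  move=> [i k]; apply: HA; rewrite invr_gt0 ltr0n /= invf_le1//.
  by rewrite ler1n.
(* Centres are replaced by points of [Y i], because [p i] is Lipschitz only there. *)
have /choice[y Hy] : forall ic : nat * nat * 'rV[C]_d, exists y : 'rV[C]_d,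
    (exists2 x, Y ic.1.1 x & (vn (x - ic.2) <= ic.1.2.+1%:R^-1)%R) ->
    Y ic.1.1 y /\ (vn (y - ic.2) <= ic.1.2.+1%:R^-1)%R.
  move=> [[i k] x0]; have [[x h1 h2]|no] := pselect (exists2 x, Y i x & (vn (x - x0) <= k.+1%:R^-1)%R).
    by exists x.
  by exists x0.
have A0 i : (0 <= A i)%R by apply: le_trans (Ht (i, 0%N)).1; rewrite mulr_ge0// exprn_ge0.
(* At radius [q] a box has half side [3 * L i * q], where 3 exceeds the distance [2 * q] lost by
   moving the centre. Its volume is [(6 * L i * q) ^ (2 * n)], so the [i]-th count has integral at
   most [2 ^ -(i + 1)]. *)
pose K i := ((2^-1) ^+ i.+1 / ((6 * L i) ^+ (2 * n) * (A i + 1)) : R)%R.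
have D0 i : (0 < (6 * L i) ^+ (2 * n) * (A i + 1))%R.
  by rewrite mulr_gt0 ?ltr_wpDl// exprn_gt0// mulr_gt0.
have K0 i : (0 < K i)%R by rewrite divr_gt0// exprn_gt0.
pose bx k i := boxes (K i) (3 * L i * k.+1%:R^-1) [seq rcs (p i (y (i, k, c))) | c <- t (i, k)].
have bx0 k i s : 0 <= bx k i s by apply: boxes_ge0; exact: ltW.
have bxl k i : lscs (bx k i) by apply: lscs_boxes; exact: ltW.
have sl k : lscs (fun s => \sum_(i <- iota 0 k) bx k i s) by exact: lscs_sum.
have s0 k s : 0 <= \sum_(i <- iota 0 k) bx k i s by exact: sume_ge0.
pose H k s := Phi s + \sum_(i <- iota 0 k) bx k i s.
have Hl k : lscs (H k) by exact: lscsD.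
have H0 k s : 0 <= H k s by exact: adde_ge0.
have HB k : iter_int (2 * n) (H k) <= iter_int (2 * n) Phi + 1.
  rewrite iterD//; apply: leeD => //; rewrite iter_sum//.
  apply: (@le_trans _ _ (\sum_(i <- iota 0 k) ((2^-1 : R) ^+ i.+1)%:E)).
    apply: lee_sum => i _; rewrite iter_boxes//; first last.
    - by move=> _ /mapP[z _ ->]; rewrite size_rcs.
    - exact: ltW.
    - by rewrite !mulr_gt0 ?invr_gt0.
    rewrite lee_fin size_map; have := (Ht (i, k)).1; rewrite /=.
    set m := size _; set q := (_^-1 : R)%R => h.
    rewrite (_ : 2 * (3 * L i * q) = 6 * L i * q)%R; last by ring.
    rewrite exprMn /K mulrAC ler_pdivrMr// ler_pM2l ?exprn_gt0//.
    rewrite mulrCA ler_pM2l ?exprn_gt0 ?mulr_gt0//.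
    by apply: le_trans h _; rewrite lerDl.
  have -> : \sum_(i <- iota 0 k) ((2^-1 : R) ^+ i.+1)%:E = (1 - 2^-1 ^+ k)%:E.
    elim: k => [|k IH]; first by rewrite big_nil expr0 subrr.
    rewrite -addn1 iotaD big_cat IH /= big_seq1 -EFinD add0n; congr (_%:E).
    by rewrite addn1 exprS; field.
  by rewrite lee_fin lerBlDr lerDl exprn_ge0.
have Boo : iter_int (2 * n) Phi + 1 < +oo by rewrite lte_add_pinfty// ltry.
have [s [sn sb sH]] := bounded_liminf_point Hl H0 Boo HB cn2 e0.
exists s; split=> //.
  rewrite ltey; apply: contraTneq sH => E; rewrite -leNgt; apply: (@limn_einf_ge_cst _ _ _ 0%N) => k _.
  by rewrite /H E; exact: leeDl.
have -> : [set x | exists i, Y i x /\ p i x = ptC n s] =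
    \bigcup_i [set x | Y i x /\ p i x = ptC n s].
  by apply/seteqP; split=> x [j]; [by exists j|by move=> _ h; exists j].
apply: bigcup_countable => // i _.
have [b [b0 Hb]] : exists b : R, (0 <= b)%R /\ limn_einf (fun k => H k s) < b%:E.
  have l0 : 0 <= limn_einf (fun k => H k s) by apply: (@limn_einf_ge_cst _ _ _ 0%N) => k _.
  case: (limn_einf _) l0 sH => [r| |]//; rewrite lee_fin => r0 _.
  by exists (r + 1)%R; rewrite lte_fin; split; lra.
apply: (@bounded_countable _ _ (Num.truncn (b / K i)).+1) => l ul lY.
rewrite leqNgt; apply/negP => Ml; move: Hb; apply/negP; rewrite -leNgt.
(* Finitely many distinct points are separated by some [dl]. Once the radius is below [dl / 2] no
   ball holds two of them, so the count is at least the length of [l]. *)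
have [dl dl0 Hdl] : exists2 dl : R, (0 < dl)%R &
    forall x x', x \in l -> x' \in l -> x != x' -> (dl <= vn (x - x'))%R.
  elim: l {ul lY Ml} => [|a l [dl dl0 IH]]; first by exists 1%R.
  have [dm dm0 Hm] : exists2 dm : R, (0 < dm)%R & forall x, x \in l -> a != x -> (dm <= vn (a - x))%R.
    elim: l {IH} => [|a' l [dm dm0 IH]]; first by exists 1%R.
    have [<-|aa] := eqVneq a a'.
      exists dm => // x; rewrite inE => /orP[/eqP ->|xl]; [by rewrite eqxx|exact: IH].
    exists (Num.min dm (vn (a - a'))) => [|x].
      by rewrite lt_min dm0 vn_gt0// subr_eq0.
    rewrite inE => /orP[/eqP ->|/IH h] ax; first by rewrite ge_min lexx orbT.
    by rewrite ge_min h.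
  exists (Num.min dl dm) => [|x x']; first by rewrite lt_min dl0.
  rewrite !inE => /orP[/eqP ->|xl] /orP[/eqP ->|xl'] xx.
  - by rewrite eqxx in xx.
  - by rewrite ge_min Hm ?orbT.
  - by rewrite vn_sym ge_min Hm ?orbT// eq_sym.
  - by rewrite ge_min IH.
apply: (@limn_einf_ge_cst _ _ _ (maxn i.+1 (Num.truncn (2 / dl)%R).+1)) => k.
rewrite geq_max => /andP[ik kd].
have q0 : (0 < k.+1%:R^-1 :> R)%R by rewrite invr_gt0.
have qd : (2 * k.+1%:R^-1 < dl)%R.
  rewrite ltr_pdivrMr// -ltr_pdivrMl// mulrC.
  by apply: lt_le_trans (truncnS_gt _) _; rewrite ler_nat ltnW.
have /choice[g Hg] : forall x, exists c, Y i x -> c \in t (i, k) /\ (vn (x - c) <= k.+1%:R^-1)%R.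
  move=> x; have [h|h] := pselect (Y i x); last by exists 0%R.
  by have [z h1 h2] := (Ht (i, k)).2 x h; exists z.
have ii : i \in iota 0 k by rewrite mem_iota.
rewrite /H (big_rem i ii) /=; apply: (@le_trans _ _ (bx k i s)); last first.
  by rewrite addeCA leeDl// adde_ge0// sume_ge0.
rewrite /bx /boxes lee_fin count_map -ler_pdivrMl//.
set P := preim _ _.
have lP : (size l <= count P (t (i, k)))%N.
  rewrite -size_filter -(size_map g l); apply: uniq_leq_size.
    rewrite map_inj_in_uniq// => x x' xl xl' gg; apply: contrapT => /eqP xx.
    have := Hdl _ _ xl xl' xx; have [_ h1] := Hg _ (lY _ xl).1; have [_ h2] := Hg _ (lY _ xl').1.
    have := vn_dist x (g x) x'; rewrite {2}gg (vn_sym (g x')); move: qd h1 h2.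
    by move: (k.+1%:R^-1)%R => q; lra.
  move=> _ /mapP[x xl ->]; have [Yx px] := lY x xl; have [gt gx] := Hg x Yx.
  rewrite mem_filter gt andbT /P /=; apply: inbox_rcs; rewrite -px.
  have [|Yy yg] := Hy (i, k, g x); first by exists x.
  apply: le_lt_trans (HL _ _ _ Yy Yx) _.
  rewrite [(3 * _)%R]mulrC -mulrA ltr_pM2l//.
  have := vn_dist (y (i, k, g x)) (g x) x; rewrite (vn_sym (g x)); move: yg gx q0 => /=.
  by move: (k.+1%:R^-1)%R => q; lra.
rewrite mulrC; apply: (le_trans (ltW (truncnS_gt _))); rewrite ler_nat.
by apply: leq_trans lP; exact: ltnW.
Qed.

End Counting.

(** * Removal of thin sets *)

Section LscSquare.
Variables (R : realType) (d : nat).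
Local Notation C := R[i].
Local Notation V := 'rV[R[i]]_d.

(** Extension by zero makes this lower semicontinuous for [g] continuous on the open set [O],
    however [g] behaves near the boundary. *)
Definition sqon (O : set V) (g : V -> C) z : \bar R :=
  if `[< O z >] then (sqmod (g z))%:E else 0%E.

Lemma sqon_ge0 O g z : (0 <= sqon O g z)%E.
Proof. by rewrite /sqon; case: ifP => // _; rewrite lee_fin sqmod_ge0. Qed.

Definition vcv (x : nat -> V) y := forall e : R, 0 < e ->
  exists N : nat, forall k, (N <= k)%N -> vn (x k - y) < e.

Lemma sqmod_lb (u v : C) : sqmod u - 2 * cn u * cn (v - u) <= sqmod v.
Proof.
case: u v => [x y] [x' y']; rewrite /sqmod /cn /=.
have := ler_norm (- (x * (x' - x))); have := ler_norm (- (y * (y' - y))).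
rewrite !normrN !normrM; move: (normr_ge0 x) (normr_ge0 y) (normr_ge0 (x' - x)) (normr_ge0 (y' - y)).
move: `|x| `|y| `|x' - x| `|y' - y| => A B D E A0 B0 D0 E0 h1 h2.
have := sqr_ge0 (x' - x); have := sqr_ge0 (y' - y).
have := mulr_ge0 A0 E0; have := mulr_ge0 B0 D0; nra.
Qed.

Lemma lscs_sqon O g (P : seq R -> V) : vopn O -> (forall z, O z -> cnt vn g z) ->
  (forall s t, sconv s t -> vcv (fun k => P (s k)) (P t)) -> lscs (fun s => sqon O g (P s)).
Proof.
move=> oO cg cP s t a st; rewrite {1}/sqon; case: asboolP => [Ot|_ a0]; last first.
  by exists 0%N => k _; apply: lt_le_trans a0 (sqon_ge0 _ _ _).
rewrite lte_fin => ag.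
have [r1 r10 H1] := oO _ Ot.
have c0 := cn_ge0 (g (P t)).
pose e := (sqmod (g (P t)) - a) / (2 * cn (g (P t)) + 1).
have e0 : 0 < e by rewrite divr_gt0 ?subr_gt0// ltr_wpDl// mulr_ge0.
have [r2 r20 H2] := cg _ Ot e e0.
have m0 : 0 < Num.min r1 r2 by rewrite lt_min r10.
have [N HN] := cP _ _ st _ m0; exists N => k /HN; rewrite lt_min => /andP[h1 h2].
rewrite /sqon; case: asboolP => [_|]; last by move=> /(_ (H1 _ h1)).
rewrite lte_fin; apply: lt_le_trans (sqmod_lb (g (P t)) _).
have D0 : 0 < 2 * cn (g (P t)) + 1 by rewrite ltr_wpDl// mulr_ge0.
have := H2 _ h2; rewrite /e ltr_pdivlMr//.
have := cn_ge0 (g (P (s k)) - g (P t)); move: (cn (g (P (s k)) - _)) => u u0 h.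
by clear -u0 h; lra.
Qed.

Lemma ptC_cv s t : sconv s t -> vcv (fun k => ptC d (s k)) (ptC d t : V).
Proof.
move=> st e e0; pose e' := e / (2 * d%:R + 1).
have D0 : 0 < 2 * d%:R + 1 :> R by rewrite ltr_wpDl.
have e'0 : 0 < e' by rewrite divr_gt0.
have /choice[N HN] : forall i, exists N : nat, forall k, (N <= k)%N -> `|(s k)`_i - t`_i| < e'.
  by move=> i; exact: st.
exists (\max_(i < (2 * d).+1) N i) => k Nk.
have H i : (i <= 2 * d)%N -> `|(s k)`_i - t`_i| < e'.
  move=> id; apply: HN; apply: leq_trans Nk.
  by apply: (@leq_bigmax_cond _ _ (fun i : 'I_(2 * d).+1 => N i) (Ordinal (id : (i < (2 * d).+1)%N))).
apply: (@le_lt_trans _ _ (\sum_(j < d) 2 * e')).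
  apply: ler_sum => j _; rewrite !mxE /cn /=.
  have h1 := H (2 * j)%N; have h2 := H (2 * j).+1.
  rewrite mulr2n mulrDl !mul1r; apply: lerD; apply: ltW.
    by apply: h1; rewrite leq_pmul2l// ltnW.
  by apply: h2; rewrite ltn_pmul2l.
rewrite sumr_const card_ord -mulr_natr.
have : e' * (2 * d%:R + 1) = e by rewrite divfK ?gt_eqF.
by move=> <-; clear -e'0; lra.
Qed.

Lemma iter_eq_size m (f g : seq R -> \bar R) : (forall s, size s = m -> f s = g s) ->
  iter_int m f = iter_int m g.
Proof.
elim: m f g => [|m IH] f g fg; first exact: fg.
by apply: eq_integral => x _; apply: IH => s sm; apply: fg; rewrite /= sm.
Qed.

Lemma ptC_translate (w : V) s : size s = (2 * d)%N -> ptC d (translate (rcs w) s) = ptC d s + w :> V.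
Proof.
move=> sd; apply/rowP => j; rewrite !mxE /translate !(nth_mkseq _ (fun i => s`_i + (rcs w)`_i)) ?sd ?ltn_pmul2l//; last first.
  by rewrite mul2n -doubleS -mul2n leq_pmul2l.
by rewrite rcs_re rcs_im; case: (w 0 j).
Qed.

End LscSquare.

(** * Parallel complex lines and the integral over them *)

Section Slices.
Variables (R : realType) (n : nat).
Local Notation C := R[i].
Local Notation V := 'rV[R[i]]_n.+1.
Local Notation U := 'rV[R[i]]_n.
Local Notation mu := (@lebesgue_measure R).
Implicit Types (p z : V) (a w : U) (t : C).

Definition emb w : V := \row_j oapp (fun i => w 0 i) 0 (unlift ord0 j).
Definition dir a : V := delta_mx 0 ord0 + emb a.
(** The name of the line of direction [dir a] through [z]: points are written
    [p + t *: dir a + emb w], where [t] is the difference of first coordinates and [w] is the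
    slope. *)
Definition slope a p z : U :=
  \row_i (z 0 (lift ord0 i) - p 0 (lift ord0 i) - (z 0 ord0 - p 0 ord0) * a 0 i).

Lemma emb0 w : emb w 0 ord0 = 0. Proof. by rewrite mxE unlift_none. Qed.
Lemma embS w i : emb w 0 (lift ord0 i) = w 0 i. Proof. by rewrite mxE liftK. Qed.

Lemma rowP0 z z' : z 0 ord0 = z' 0 ord0 ->
  (forall i, z 0 (lift ord0 i) = z' 0 (lift ord0 i)) -> z = z'.
Proof.
by move=> h0 hS; apply/rowP => j; case: (unliftP ord0 j) => [i|] ->; [exact: hS|exact: h0].
Qed.

Lemma lift_eq0 (i : 'I_n) : (lift ord0 i == ord0) = false.
Proof. by rewrite eq_sym (negbTE (neq_lift _ _)). Qed.

Lemma embD w w' : emb (w + w') = emb w + emb w'.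
Proof. by apply: rowP0 => [|i]; rewrite !mxE ?unlift_none ?liftK /= ?addr0 ?mxE. Qed.

Lemma embZ t w : emb (t *: w) = t *: emb w.
Proof. by apply: rowP0 => [|i]; rewrite !mxE ?unlift_none ?liftK /= ?mulr0 ?mxE. Qed.

Lemma embB w w' : emb (w - w') = emb w - emb w'.
Proof. by rewrite embD -scaleN1r embZ scaleN1r. Qed.

Lemma vn_emb w : vn (emb w) = vn w.
Proof.
rewrite /vn big_ord_recl emb0 cn0 add0r; apply: eq_bigr => i _; by rewrite embS.
Qed.

Lemma dir0 a : dir a 0 ord0 = 1.
Proof. by rewrite mxE emb0 mxE !eqxx addr0. Qed.

Lemma dirS a i : dir a 0 (lift ord0 i) = a 0 i.
Proof. by rewrite mxE embS mxE lift_eq0 andbF add0r. Qed.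

Lemma slopeK a p z : p + (z 0 ord0 - p 0 ord0) *: dir a + emb (slope a p z) = z.
Proof.
apply: rowP0 => [|i].
  by rewrite mxE emb0 addr0 2!mxE dir0; ring.
by rewrite mxE embS 2!mxE dirS mxE; ring.
Qed.

Lemma slope_line a p t w : slope a p (p + t *: dir a + emb w) = w.
Proof.
apply/rowP => i; rewrite !mxE unlift_none !liftK lift_eq0 !eqxx andbF /=; ring.
Qed.

Lemma line0 a p t w : (p + t *: dir a + emb w) 0 ord0 = p 0 ord0 + t.
Proof. by rewrite mxE emb0 2!mxE dir0; ring. Qed.

Lemma slope_lip a p z z' : vn (slope a p z - slope a p z') <= (1 + vn a) * vn (z - z').
Proof.
have E : slope a p z - slope a p z' =
    \row_i ((z - z') 0 (lift ord0 i)) - ((z - z') 0 ord0) *: a.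
  by apply/rowP => i; rewrite !mxE; ring.
rewrite E; apply: le_trans (vnD _ _) _; rewrite vnN mulrDl mul1r; apply: lerD.
  rewrite /vn [leRHS]big_ord_recl; apply: ler_wpDl; first exact: cn_ge0.
  by apply: ler_sum => i _; rewrite !mxE.
apply: le_trans (vnZ _ _) _; rewrite mulrC ler_wpM2l ?vn_ge0//; exact: vn_coord.
Qed.

Lemma ptC_cons2 x y (s : seq R) :
  ptC n.+1 [:: x, y & s] = (x +i* y)%C *: delta_mx 0 ord0 + emb (ptC n s) :> V.
Proof.
apply: rowP0 => [|i].
  by rewrite !mxE unlift_none !eqxx /= mulr1 addr0.
have E : (2 * lift ord0 i)%N = (2 * i).+2 by rewrite lift0 mulnS.
by rewrite [LHS]mxE E /= !mxE liftK lift_eq0 andbF mulr0 add0r /= mxE.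
Qed.

Section Integral.
Variables (O : set V) (g : V -> C) (p : V) (a : U).
Hypotheses (oO : vopn O) (cg : forall z, O z -> cnt vn g z).

Lemma sqon_line_cv (s : nat -> seq R) (t : seq R) : sconv s t ->
  vcv (fun k => p + (ptC n.+1 (s k) + (ptC n.+1 (s k) : V) 0 ord0 *: emb a))
      (p + (ptC n.+1 t + (ptC n.+1 t : V) 0 ord0 *: emb a)).
Proof.
move=> st e e0; have D0 : 0 < 1 + vn (emb a) by rewrite ltr_wpDr ?vn_ge0.
have [|N HN] := @ptC_cv R n.+1 _ _ st (e / (1 + vn (emb a))); first by rewrite divr_gt0.
exists N => k /HN; rewrite ltr_pdivlMr// => h; apply: le_lt_trans h.
move: (ptC _ _ : V) (ptC _ _ : V) => z z'.
rewrite [p + _]addrC addrKA opprD addrACA -scalerBl.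
apply: le_trans (vnD _ _) _; rewrite mulrDr mulr1 lerD2l.
apply: le_trans (vnZ _ _) _; rewrite ler_wpM2r ?vn_ge0//.
by have := vn_coord (z' - z) ord0; rewrite !mxE.
Qed.

Definition slice_int (s : seq R) : \bar R :=
  (\int[mu]_x \int[mu]_y sqon O g (p + (x +i* y)%C *: dir a + emb (ptC n s)))%E.

Let F l := sqon O g (p + (ptC n.+1 l + (ptC n.+1 l : V) 0 ord0 *: emb a)).

Let FE x y s : F [:: x, y & s] = sqon O g (p + (x +i* y)%C *: dir a + emb (ptC n s)).
Proof.
rewrite /F; congr (sqon O g _); rewrite {2}ptC_cons2 mxE emb0 addr0 2!mxE !eqxx mulr1.
by rewrite ptC_cons2 /dir scalerDr -!addrA; congr (_ + (_ + _)); rewrite addrC.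
Qed.

Let lF : lscs F.
Proof. by apply: lscs_sqon => // s t; exact: sqon_line_cv. Qed.

Let F0 s : (0 <= F s)%E. Proof. exact: sqon_ge0. Qed.

Lemma slice_int_ge0 s : (0 <= slice_int s)%E.
Proof. by apply: integral_ge0 => x _; apply: integral_ge0 => y _; exact: sqon_ge0. Qed.

Lemma lscs_slice_int : lscs slice_int.
Proof.
have -> : slice_int = fun s => iter_int 2 (fun t : seq R => F [:: t`_0, t`_1 & s]).
  by apply/funext => s; apply: eq_integral => x _; apply: eq_integral => y _; rewrite /= FE.
apply: (@iter_lsc R 2 (fun t s : seq R => F [:: s`_0, s`_1 & t])); [|move=> t s; exact: F0|].
  move=> t; apply: lscs_comp lF => u v uv.
  by apply: sconv_cons; [apply: sconv_cons; [exact: sconv_cst|]|]; exact: uv.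
move=> u t s ut; apply: (lscs_liminf lF).
by apply: sconv_cons; [apply: sconv_cons => //|]; move=> e; exact: real_cst.
Qed.

Lemma lscs_line (s : seq R) :
  lscs (fun l => sqon O g (p + (l`_0 +i* l`_1)%C *: dir a + emb (ptC n s))).
Proof.
have -> : (fun l => sqon O g (p + (l`_0 +i* l`_1)%C *: dir a + emb (ptC n s))) =
    fun l : seq R => F [:: l`_0, l`_1 & s].
  by apply/funext => l; rewrite FE.
apply: lscs_comp lF => u v uv.
by apply: sconv_cons; [apply: sconv_cons; [exact: sconv_cst|]|]; exact: uv.
Qed.

(** The change of variables is a translation by [p] and a shear. For a fixed position on the line
    the shear is a translation of the remaining variables, so translation invariance and exchange of
    integrals suffice. *)
Lemma iter_slice_int :
  iter_int (2 * n) slice_int = iter_int (2 * n.+1) (fun s => sqon O g (ptC n.+1 s)).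
Proof.
have l1 : lscs (fun s => sqon O g (ptC n.+1 s)) by apply: lscs_sqon => // s t; exact: ptC_cv.
rewrite -(@iter_translate _ _ (rcs p) _ l1 (fun s => sqon_ge0 _ _ _)).
transitivity (iter_int (2 * n).+2 F).
  rewrite (iter_swap2 (2 * n) lF F0); apply: iter_eq => s; rewrite /slice_int.
  apply: eq_integral => x _; apply: eq_integral => y _; by rewrite FE.
rewrite mulnS; apply: eq_integral => x _; apply: eq_integral => y _.
have l2 : lscs (fun s => sqon O g (ptC n.+1 [:: x, y & s] + p)).
  apply: lscs_sqon => // s t st e e0.
  have [|N HN] := @ptC_cv R n.+1 (fun k => [:: x, y & s k]) [:: x, y & t] _ e e0.
    by apply: sconv_cons; [apply: sconv_cons => //|]; move=> e'; exact: real_cst.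
  exists N => k /HN; move: (ptC _ _ : V) (ptC _ _ : V) => z z'.
  by rewrite opprD addrACA subrr addr0.
transitivity (iter_int (2 * n) (fun s => sqon O g (ptC n.+1 [:: x, y & s] + p))).
  rewrite -(@iter_translate _ _ (rcs ((x +i* y)%C *: a)) _ l2 (fun s => sqon_ge0 _ _ _)).
  apply: iter_eq_size => s sn; rewrite FE; congr (sqon O g _).
  rewrite ptC_cons2 ptC_translate// embD embZ /dir scalerDr.
  by rewrite [RHS]addrC -!addrA; congr (_ + (_ + _)); rewrite addrC.
apply/esym/iter_eq_size => s sn.
by rewrite ptC_translate// mulnS /= sn.
Qed.

End Integral.
End Slices.

(** * A direction meeting the thin set countably often *)

Section Direction.
Variables (R : realType) (n : nat).
Local Notation C := R[i].
Local Notation V := 'rV[R[i]]_n.+1.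
Local Notation U := 'rV[R[i]]_n.

Lemma countable_enum (T : set C) : countable T ->
  exists sing : nat -> C, forall t, T t -> exists k, t = sing k.
Proof.
move=> /countable_injP[f injf].
have /choice[sing Hs] : forall k, exists t, (exists2 t', T t' & f t' = k) -> T t /\ f t = k.
  move=> k; have [[t' T' fk]|no] := pselect (exists2 t', T t' & f t' = k); first by exists t'.
  by exists 0.
exists sing => t Tt; exists (f t); have [|T1 f1] := Hs (f t); first by exists t.
by apply: injf; rewrite ?inE.
Qed.

(** Central projection from [p]: the parameter [a] for which [dir a] points from [p] to [z], and 0
    by convention if the first coordinates agree. *)
Definition tilt (p z : V) : U := (z 0 ord0 - p 0 ord0)^-1 *: slope 0 p z.

(** Inverses are bounded by [2 * M]. This enters once for the difference of slopes and twice for the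
    difference of inverses, where the slope itself costs a further [M]. *)
Lemma tilt_lip (p : V) (M : R) (x y : V) : 1 <= M -> 1 <= M * cn (x 0 ord0 - p 0 ord0) ->
  1 <= M * cn (y 0 ord0 - p 0 ord0) -> vn (y - p) <= M ->
  vn (tilt p x - tilt p y) <= (2 * M + 4 * M ^+ 3) * vn (x - y).
Proof.
move=> M1 xM yM yp; rewrite /tilt.
set u := x 0 ord0 - _; set v := y 0 ord0 - _.
have M0 : 0 < M by lra.
have inv t : 1 <= M * cn t -> t != 0 /\ cn t^-1 <= 2 * M.
  move=> tM; have t0 : 0 < cn t by rewrite -(pmulr_rgt0 _ M0); apply: lt_le_trans tM.
  have tn : t != 0 by apply: contraTneq t0 => ->; rewrite cn0 ltxx.
  split=> //; apply: le_trans (cnV tn) _.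
  by rewrite ler_pdivrMr// -mulrA ler_peMr.
have [u0 uM] := inv _ xM; have [v0 vM] := inv _ yM.
have E : u^-1 *: slope 0 p x - v^-1 *: slope 0 p y =
    u^-1 *: (slope 0 p x - slope 0 p y) + (u^-1 * (v - u) * v^-1) *: slope 0 p y.
  rewrite mulrBr mulrBl mulVf// mul1r -mulrA mulfV// mulr1 scalerBr scalerBl.
  by rewrite [RHS]addrA subrK.
rewrite E; apply: le_trans (vnD _ _) _; rewrite mulrDl; apply: lerD.
  apply: le_trans (vnZ _ _) _; apply: ler_pM => //; try exact: cn_ge0; try exact: vn_ge0.
  by have := slope_lip 0 p x y; rewrite vn0 addr0 mul1r.
apply: le_trans (vnZ _ _) _.
have sy : vn (slope 0 p y) <= M.
  have sp : slope 0 p p = 0 :> U by apply/rowP => i; rewrite !mxE !subrr mul0r subr0.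
  have := slope_lip 0 p y p; rewrite sp subr0 vn0 addr0 mul1r => h; exact: le_trans h yp.
have vu : cn (v - u) <= vn (x - y).
  rewrite cn_sym (_ : u - v = (x - y) 0 ord0); first exact: vn_coord.
  by rewrite !mxE /u /v; ring.
have c1 : cn (u^-1 * (v - u) * v^-1) <= 2 * M * vn (x - y) * (2 * M).
  apply: le_trans (cnM _ _) _; apply: ler_pM => //; try exact: cn_ge0.
  by apply: le_trans (cnM _ _) _; apply: ler_pM => //; exact: cn_ge0.
rewrite (_ : 4 * M ^+ 3 * _ = 2 * M * vn (x - y) * (2 * M) * M); last by ring.
by apply: ler_pM => //; [exact: cn_ge0|exact: vn_ge0].
Qed.

(** The fibres of [tilt] are the lines through [p], so [countable_slice] applies on the pieces [Y'],
    on which [tilt] is Lipschitz. The index encodes a piece of [X] together with the bound [M]; the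
    parameter 0, that is [p] itself, is added separately. *)
Lemma countable_direction (X : set V) p : sc (2 * n) X ->
  exists a : U, countable [set t : C | X (p + t *: dir a)].
Proof.
move=> [Y [Yc XY]].
pose dec k := odflt (0%N, 0%N) (unpickle k : option (nat * nat)).
pose M k : R := (dec k).2.+1%:R.
pose Y' k := [set x | [/\ Y (dec k).1 x, 1 <= M k * cn (x 0 ord0 - p 0 ord0) & vn (x - p) <= M k]].
have M1 k : 1 <= M k by rewrite ler1n.
have L0 k : 0 < 2 * M k + 4 * M k ^+ 3.
  have := M1 k; move: (M k) => m m1; have : 0 <= m ^+ 3 by rewrite exprn_ge0//; lra.
  lra.
have c1 k : cb (2 * n) (Y' k) by apply: cb_sub (Yc (dec k).1) => x [].
have c2 k x y : Y' k x -> Y' k y ->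
    vn (tilt p x - tilt p y) <= (2 * M k + 4 * M k ^+ 3) * vn (x - y).
  by move=> [_ h1 h2] [_ h3 h4]; exact: tilt_lip.
have c3 : (iter_int (2 * n) (fun=> 0 : \bar R) < +oo)%E by rewrite iter_cst0 ltry.
have [s [_ _ _ cs]] := @countable_slice R n n.+1 Y' (fun _ => tilt p) _ (fun=> 0%E)
    (nseq (2 * n) 0) 1 c1 L0 c2 (@lscs_cst R 0%E) (fun=> lexx _) c3 (size_nseq _ _) ltr01.
pose a : U := ptC n s.
exists a; set F := [set x | _] in cs.
have cF : countable ((fun x : V => x 0 ord0 - p 0 ord0) @` F `|` [set 0]).
  rewrite -bigcup2E; apply: bigcup_countable => // -[|[|k]] _ /=; [|exact: countable1|exact: countable0].
  exact: card_le_trans (card_image_le _ _) cs.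
apply: sub_countable cF; apply: subset_card_le => t Xt.
have [->|t0] := eqVneq t 0; first by right.
left; have x0 : (p + t *: dir a) 0 ord0 - p 0 ord0 = t by rewrite mxE mxE dir0 mulr1 addrAC subrr add0r.
exists (p + t *: dir a) => //; have [i _ Yi] := XY _ Xt.
have ct : 0 < cn t := cn_gt0 t0.
pose m := maxn (Num.truncn (cn t)^-1) (Num.truncn (vn (t *: dir a))).
exists (pickle (i, m)); rewrite /Y' /M /dec pickleK /= x0; split.
  split=> //.
    rewrite -ler_pdivrMr// mul1r; apply: (le_trans (ltW (truncnS_gt _))).
    by rewrite ler_nat ltnS leq_maxl.
  rewrite addrAC subrr add0r; apply: (le_trans (ltW (truncnS_gt _))).
  by rewrite ler_nat ltnS leq_maxr.
have E : slope 0 p (p + t *: dir a) = t *: a.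
  clearbody a; apply/rowP => j; rewrite [RHS]mxE mxE x0 [X in _ * X]mxE mulr0 subr0 mxE.
  by rewrite addrAC subrr add0r mxE dirS.
by rewrite /tilt x0 E scalerA mulVf// scale1r.
Qed.

End Direction.

(** * Extension across a thin set *)

Section LocalExtension.
Variables (R : realType) (n : nat).
Local Notation C := R[i].
Local Notation V := 'rV[R[i]]_n.+1.
Local Notation U := 'rV[R[i]]_n.

Lemma vn_scale_le (t : C) (v : V) (B A : R) : cn t <= B -> vn v <= A -> vn (t *: v) <= B * A.
Proof. by move=> tB vA; apply: le_trans (vnZ _ _) _; rewrite ler_pM ?cn_ge0 ?vn_ge0. Qed.

(** For [u = dir a] the inner map slides [w] along its line to the point with parameter [t]; it is
    affine with linear part [w - w 0 ord0 *: u]. *)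
Lemma dif_transport (g : V -> C) (p u z : V) (t : C) :
  dif vn g (z + (t - (z 0 ord0 - p 0 ord0)) *: u) ->
  dif vn (fun w => g (w + (t - (w 0 ord0 - p 0 ord0)) *: u)) z.
Proof.
move=> [L HL]; exists (fun w : V => L (w - w 0 ord0 *: u)).
pose A (w : V) : V := w + (t - (w 0 ord0 - p 0 ord0)) *: u.
have AB w w' : A w - A w' = (w - w') - (w - w') 0 ord0 *: u.
  rewrite /A [- (w' + _)]opprD addrACA -scalerBl; congr (_ + _); rewrite -scaleNr; congr (_ *: _).
  by rewrite !mxE; ring.
have := @isd_aff R V V vn vn A (1 + vn u) g z L (@vn_ge0 _ _).
have -> : (fun w => L (A w - A 0)) = fun w : V => L (w - w 0 ord0 *: u).
  by apply/funext => w; rewrite AB subr0.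
apply => //.
- by rewrite ltW// ltr_wpDr ?vn_ge0.
- move=> w w' a; rewrite !AB subr0 addrK scalerBr; congr (_ - _).
  by rewrite mxE scalerA.
- by move=> w w'; rewrite !AB subr0.
- move=> w; rewrite AB subr0; apply: le_trans (vnD _ _) _; rewrite vnN mulrDl mul1r lerD2l.
  rewrite mulrC; apply: le_trans (vnZ _ _) _; rewrite ler_wpM2r ?vn_ge0//; exact: vn_coord.
Qed.

Lemma jc_transport S (g : V -> C) (p u z : V) (s : C) :
  cnt vn g (z + (s - (z 0 ord0 - p 0 ord0)) *: u) ->
  jc S setT (fun w => vn (w - z)) (fun s w => g (w + (s - (w 0 ord0 - p 0 ord0)) *: u)) s z.
Proof.
move=> H; apply: (@jc_aff R n.+1 S n.+1 (fun s w => w + (s - (w 0 ord0 - p 0 ord0)) *: u) (1 + vn u) g) => //.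
  by rewrite ltr_wpDr ?vn_ge0.
move=> s' w'.
have -> : w' + (s' - (w' 0 ord0 - p 0 ord0)) *: u - (z + (s - (z 0 ord0 - p 0 ord0)) *: u) =
    (w' - z) + ((s' - s) - (w' - z) 0 ord0) *: u.
  by rewrite [- (z + _)]opprD addrACA -scalerBl; congr (_ + _ *: _); rewrite !mxE; ring.
apply: le_trans (vnD _ _) _; rewrite mulrDl mul1r; apply: lerD.
  by rewrite lerDr cn_ge0.
rewrite [leRHS]mulrC; apply: vn_scale_le => //.
by apply: le_trans (cnB _ _) _; rewrite lerD2l vn_coord.
Qed.

Lemma cnt_coord0 (p z : V) : cnt vn (fun w : V => w 0 ord0 - p 0 ord0) z.
Proof.
move=> e e0; exists e => // w wz; apply: le_lt_trans wz.
by rewrite (_ : _ - _ = (w - z) 0 ord0) ?vn_coord// !mxE; ring.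
Qed.

Lemma dif_coord0 (p z : V) : dif vn (fun w : V => w 0 ord0 - p 0 ord0) z.
Proof.
exists (fun w : V => w 0 ord0); split.
- by move=> a u v; rewrite !mxE.
- by exists 1; split=> // u; rewrite mul1r vn_coord.
- move=> e e0; exists 1 => // w _; rewrite (_ : _ - _ - _ = 0).
    by rewrite cn0 mulr_ge0 ?vn_ge0// ltW.
  by rewrite !mxE; ring.
Qed.

(** On the line through [z] the candidate is the integral of [g] against the Cauchy kernel, divided
    by the integral of the kernel alone. Numerator and denominator depend holomorphically on [z];
    equality with [g] is checked on suitable nearby lines and passes to the limit. *)
Lemma local_extension (D O : set V) (g : V -> C) p : vopn D -> hol O g ->
  sc (2 * n) (D `\` O) ->
  (iter_int (2 * n.+1) (fun s => sqon O g (ptC n.+1 s)) < +oo)%E ->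
  D p -> exists (rho : R) (G : V -> C), 0 < rho /\
  forall z, vn (z - p) < rho -> [/\ D z, dif vn G z & O z -> G z = g z].
Proof.
move=> oD gO sX fin; have oO := gO.1.
have cg z : O z -> cnt vn g z by move=> Oz; apply: dif_vcnt; exact: gO.2.
move=> Dp; have [a cT] := countable_direction p sX.
have [sing0 Hs0] := countable_enum cT.
set u := dir a in cT Hs0.
have [R0 R00 HR0] := oD _ Dp.
have u0 : 0 <= vn u := vn_ge0 u.
pose r0 := R0 / (8 * (vn u + 1)).
have u8 : 0 < 8 * (vn u + 1) by rewrite mulr_gt0// ltr_wpDl.
have r00 : 0 < r0 by rewrite divr_gt0.
have r0E : 8 * r0 * (vn u + 1) = R0 by rewrite /r0; field; rewrite gt_eqF// ltr_wpDl.
clearbody r0.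
(* A point on the boundary of the square has a real or imaginary part of absolute value [r], so
   avoiding these numbers for all exceptional parameters clears the boundary. *)
have [|r /andP[rl rr] rX] := @avoid_countable R (r0 / 2) r0
    (fun k => if odd k then `|complex.Re (sing0 k./2)| else `|complex.Im (sing0 k./2)|); first lra.
have r0' : 0 < r by lra.
(* Points of the square have norm up to [2 * r]; the remaining [r] leaves a disc around each
   exceptional parameter for [vanish_L2]. *)
have inD t v : cn t <= 3 * r -> vn v <= r -> D (p + t *: u + v).
  move=> tr vr; apply: HR0; rewrite -[p + _ + v]addrA addrAC subrr add0r.
  apply: le_lt_trans (vnD _ _) _; have := vn_scale_le tr (lexx (vn u)).
  have : 0 < (r0 - r) * (vn u + 1) by rewrite mulr_gt0 ?subr_gt0// ltr_wpDl.
  clear -r0E u0 r0' vr; nra.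
have bO t : sqb r t -> O (p + t *: u).
  move=> bt; apply: contrapT => nO.
  have [|k tk] := Hs0 t.
    split=> //; rewrite -[p + _]addr0; apply: inD; last by rewrite vn0 ltW.
    by apply: le_trans (sq_cn (sqb_sq bt)) _; clear -r0'; lra.
  have h1 := rX k.*2.+1; have h2 := rX k.*2.
  rewrite /= odd_double uphalf_double /= in h1; rewrite odd_double doubleK in h2.
  case/andP: bt => _ /or4P[] /eqP E; move: h1 h2; rewrite -tk E ?normrN (ger0_norm (ltW r0')) eqxx => //.
have [dl dl0 tube] : exists2 dl : R, 0 < dl & forall t v, sqb r t -> vn v < dl -> O (p + t *: u + v).
  (* The indicator of the open set [O] is jointly continuous where it equals 1, so [tube_sq] turns
     it into a uniform neighbourhood of the boundary of the square. *)
  pose phi (s : C) (w : V) : C := if `[< O (p + s *: u + w) >] then 1 else 0.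
  have h1 : forall s, sqb r s -> jc (sqb r) setT vn phi s 0.
    move=> s /bO Os e e0; have [r1 r10 H1] := oO _ Os.
    exists (r1 / (vn u + 1)) => [|s' w _ _ ss ww]; first by rewrite divr_gt0// ltr_wpDl.
    rewrite /phi addr0 !ifT ?subrr ?cn0//; apply/asboolP => //; apply: H1.
    rewrite -[p + _ + w]addrA [- (p + _)]opprD addrACA subrr add0r addrAC -scalerBl.
    apply: le_lt_trans (vnD _ _) _; have := vn_scale_le (ltW ss) (lexx (vn u)).
    have : r1 / (vn u + 1) * (vn u + 1) = r1 by rewrite divfK// gt_eqF// ltr_wpDl.
    by move: (r1 / _) ww => q ww; clear -ww; lra.
  have [||||dl dl0 H] := tube_sq _ h1 (w0 := 0) _ _ (e := 1 / 2); rewrite ?vn0//; first lra.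
  exists dl => // t v bt vd; have := H t v bt Logic.I vd; rewrite /phi addr0.
  case: asboolP => // _; rewrite ifT; last exact/asboolP/bO.
  by rewrite sub0r cnN cn1; lra.
pose m := Num.min dl r.
have m0 : 0 < m by rewrite lt_min dl0.
pose rho := Num.min (r / 2) (m / (1 + vn u)).
have u1 : 0 < 1 + vn u by rewrite ltr_wpDr.
have rho0 : 0 < rho by rewrite lt_min !divr_gt0.
pose q (z : V) : C := z 0 ord0 - p 0 ord0.
have qr z : vn (z - p) < rho -> cn (q z) < r / 2.
  move=> zp; apply: le_lt_trans (_ : vn (z - p) < _).
    by have := vn_coord (z - p) ord0; rewrite !mxE.
  by apply: lt_le_trans zp _; rewrite ge_min lexx.
have qs z : vn (z - p) < rho -> sq (r / 2) (q z) by move=> /qr/ltW/cn_sq.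
have vz z : vn (z - p) < rho -> vn (z - p - q z *: u) < m.
  move=> zp; apply: (@le_lt_trans _ _ ((1 + vn u) * vn (z - p))).
    apply: le_trans (vnD _ _) _; rewrite vnN mulrDl mul1r lerD2l mulrC.
    by apply: vn_scale_le => //; have := vn_coord (z - p) ord0; rewrite !mxE.
  rewrite mulrC -ltr_pdivlMr//; apply: lt_le_trans zp _.
  by rewrite ge_min lexx orbT.
have zE z t : z + (t - q z) *: u = p + t *: u + (z - p - q z *: u).
  by rewrite scalerBl; apply/rowP => j; rewrite !mxE; ring.
have inO z t : vn (z - p) < rho -> sqb r t -> O (z + (t - q z) *: u).
  move=> /vz h bt; rewrite zE; apply: tube => //; apply: lt_le_trans h _.
  by rewrite ge_min lexx.
pose num (t : C) z := g (z + (t - q z) *: u).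
pose psi (t : C) z := (t - q z)^-1.
pose phi (t : C) z := num t z / (t - q z).
have tq z t : vn (z - p) < rho -> sqb r t -> t - q z != 0.
  by move=> /qs h bt; rewrite subr_eq0; exact: sqb_neq h bt.
have dq z t : dif vn (fun w => t - q w) z.
  by apply: (difB (@vn_ge0 _ _)); [exact: (dif_cst (@vn_ge0 R n.+1))|exact: dif_coord0].
have Dnum z t : vn (z - p) < rho -> sqb r t -> dif vn (num t) z.
  by move=> zp bt; apply: dif_transport; apply: gO.2; exact: inO.
have Dpsi z t : vn (z - p) < rho -> sqb r t -> dif vn (psi t) z.
  by move=> zp bt; apply: (difV (@vn_ge0 _ _)); [exact: tq|exact: dq].
have Jpsi z t : vn (z - p) < rho -> sqb r t ->
    jc (sqb r) setT (fun w => vn (w - z)) psi t z.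
  move=> zp bt; apply: (@jc_comp R n.+1 (sqb r) (fun x => x^-1) (fun t w => t - q w)).
    have /dif_cnt := cdif_inv (tq z t zp bt); exact.
  apply: jcB; first by apply: (@jc_cntl R n.+1 (sqb r) id) => e e0; exists e.
  by apply: jc_cntr; exact: cnt_coord0.
have Ub : vopn [set z : V | vn (z - p) < rho] := @vopn_ball _ _ p rho.
have DG z : vn (z - p) < rho -> dif vn (fun z => sint (phi^~ z) r / sint (psi^~ z) r) z.
  move=> zp; apply: (dif_div (@vn_ge0 _ _)).
  - by have := W_neq0 r0' (qs z zp).
  - apply: (hol_sint r0' Ub) zp => [t w bt wp|t w bt wp].
      by apply: (difM (@vn_ge0 _ _)); [exact: Dnum|exact: Dpsi].
    apply: jcM; last exact: Jpsi.
    by apply: jc_transport; apply: cg; exact: inO.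
  - by apply: (hol_sint r0' Ub) zp => t w bt wp; [exact: Dpsi|exact: Jpsi].
pose G z := sint (phi^~ z) r / sint (psi^~ z) r.
exists rho, G; split=> // z zp; split=> [||Oz]; [|exact: DG|].
  have := inD (q z) (z - p - q z *: u) _ _; rewrite -zE subrr scale0r addr0; apply.
    by apply: ltW; apply: lt_le_trans (qr z zp) _; clear -r0'; lra.
  by apply: ltW; apply: lt_le_trans (vz z zp) _; rewrite ge_min lexx orbT.
(* If the two functions differ at [z], they differ near [z]. One nearby point of equality is thus
   enough, and it is sought on a parallel line that meets the exceptional set countably often and
   has a finite square integral. *)
apply: contrapT => /eqP nG.
have eta0 : 0 < cn (G z - g z) by rewrite cn_gt0// subr_eq0.
have cH : cnt vn (fun w => G w - g w) z.
  by apply: dif_vcnt; apply: (difB (@vn_ge0 _ _)); [exact: DG|exact: gO.2].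
have [d1 d10 H1] := cH _ eta0; have [d2 d20 H2] := oO _ Oz.
pose d3 := Num.min (Num.min d1 d2) (rho - vn (z - p)).
have d30 : 0 < d3 by rewrite !lt_min d10 d20 subr_gt0.
have [Y [Yc XY]] := sX.
have e0 : 0 < d3 / (2 * n%:R + 1) by rewrite divr_gt0// ltr_wpDl.
have L0 (k : nat) : 0 < 1 + vn a by rewrite ltr_wpDr ?vn_ge0.
have fin' : (iter_int (2 * n) (slice_int O g p a) < +oo)%E by rewrite iter_slice_int.
have [s [sn sb sfin cs]] := @countable_slice R n n.+1 Y (fun _ => slope a p) (fun=> 1 + vn a)
  (slice_int O g p a) (rcs (slope a p z)) _ Yc L0 (fun _ x y _ _ => @slope_lip _ _ a p x y)
  (@lscs_slice_int R n O g p a oO cg) (@slice_int_ge0 R n O g p a) fin' (size_rcs _) e0.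
pose w : U := ptC n s.
have Ez : p + q z *: u + emb (slope a p z) = z by exact: slopeK.
(* Only the line is shifted; the parameter [q z] is kept, so the kernel is the same for [z] and
   [z']. *)
pose z' := p + q z *: u + emb w.
have zz' : vn (z' - z) < d3.
  have -> : z' - z = emb (w - slope a p z).
    rewrite -[X in z' - X]Ez embB /z'; move: (emb _) (emb _) (_ *: u) => A B E.
    by apply/rowP => j; rewrite !mxE; ring.
  rewrite vn_emb; apply: le_lt_trans (vn_inbox sb) _.
  have N0 : 0 < 2 * n%:R + 1 :> R by rewrite ltr_wpDl.
  have : d3 / (2 * n%:R + 1) * (2 * n%:R + 1) = d3 by rewrite divfK ?gt_eqF.
  by move: (d3 / _) e0 => f f0 <-; clear -f0; lra.
move: zz'; rewrite !lt_min => /andP[/andP[zd1 zd2] zd3].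
have z'p : vn (z' - p) < rho by have := vn_dist z' z p; clear -zd3; lra.
have Oz' : O z' := H2 _ zd2.
have qz' : q z' = q z by rewrite /q /z' line0 addrC addKr.
suff Gg : G z' = g z'.
  by have := H1 _ zd1; rewrite Gg subrr sub0r cnN ltxx.
have wz' : emb w = z' - p - q z' *: u by rewrite qz' -addrA -opprD /z' addrC addKr.
have vw : vn (emb w) <= r.
  by rewrite wz'; apply: ltW; apply: lt_le_trans (vz _ z'p) _; rewrite ge_min lexx orbT.
pose b := p + emb w.
have lE t : p + t *: u + emb w = b + t *: u by rewrite addrAC.
pose f t := g (b + t *: u).
pose O' := [set t : C | O (b + t *: u)].
have cS : countable ((fun x : V => x 0 ord0 - p 0 ord0) @` [set x | exists i, Y i x /\ slope a p x = w]).
  exact: card_le_trans (card_image_le _ _) cs.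
have [sing Hsing] := countable_enum cS.
have cov t : cn t <= 3 * r -> O' t \/ exists k, t = sing k.
  move=> tr; have [Ot|nO] := pselect (O' t); [by left|right].
  apply: Hsing; exists (p + t *: u + emb w); last by rewrite line0 addrAC subrr add0r.
  have [|i _ Yi] := XY (p + t *: u + emb w); last by exists i; split=> //; exact: slope_line.
  by split; [exact: inD|rewrite lE].
have fO t : O' t -> cdif f t by move=> Ot; apply: cdif_line; exact: gO.2.
have oO' : opn O' := @opn_line R n.+1 O b u oO.
have sq3 t : sq r t -> cn t <= 3 * r.
  by move=> /sq_cn h; apply: le_trans h _; clear -r0'; lra.
have bO' t : sqb r t -> O' t.
  move=> bt; rewrite /O' /= -lE wz'; apply: tube => //.
  by apply: lt_le_trans (vz _ z'p) _; rewrite ge_min lexx.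
have Oq : O' (q z) by rewrite /O' /= -lE.
have vs k : sq r (sing k) -> O' (sing k) \/ vanish f (sing k).
  move=> sk; right.
  pose h l := sqon O g (p + (l`_0 +i* l`_1)%C *: u + emb w).
  apply: (@vanish_L2 R f O' sing (sing k) r h) => //.
  - move=> t tk; apply: cov; have := cnD (t - sing k) (sing k); rewrite subrK.
    by have := sq_cn sk; clear -tk; lra.
  - exact: lscs_line.
  - by move=> l; exact: sqon_ge0.
  - by move=> x y Ot; rewrite /h /sqon lE ifT//; exact/asboolP.
have key := cauchy_formula r0' (qs z zp) oO' fO (fun t ts => cov t (sq3 t ts)) bO' vs Oq.
have phiE t : phi t z' = f t / (t - q z).
  rewrite /phi /num zE qz' -[z' - p - _](_ : emb w = _); last by rewrite wz' qz'.
  by rewrite lE.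
have psiE t : psi t z' = (t - q z)^-1 by rewrite /psi qz'.
rewrite /G (_ : phi^~ z' = fun t => f t / (t - q z)); last by apply/funext.
rewrite (_ : psi^~ z' = fun t => (t - q z)^-1); last by apply/funext.
rewrite key -/(W r (q z)) mulfK ?W_neq0 ?qs//.
by rewrite /f -lE.
Qed.

(** Local extensions agree where they overlap because they are continuous and [O] is dense in [D], a
    thin set having no interior. *)
Lemma removal (D O : set V) (g : V -> C) : vopn D -> hol O g -> O `<=` D ->
  sc (2 * n) (D `\` O) ->
  (iter_int (2 * n.+1) (fun s => sqon O g (ptC n.+1 s)) < +oo)%E ->
  exists G : V -> C, [/\ hol D G, forall z, O z -> G z = g z &
    (iter_int (2 * n.+1) (fun s => sqon D G (ptC n.+1 s)) < +oo)%E].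
Proof.
move=> oD gO OD sX fin; have [Y [Yc XY]] := sX.
have Yn k : nb (Y k) by exact: cb_nb.
have /choice[rG HrG] : forall p, exists rG : R * (V -> C), D p -> 0 < rG.1 /\
    forall z, vn (z - p) < rG.1 -> [/\ D z, dif vn rG.2 z & O z -> rG.2 z = g z].
  move=> p; have [Dp|nD] := pselect (D p); last by exists (0, fun=> 0).
  by have [rho [G H]] := local_extension oD gO sX fin Dp; exists (rho, G).
(* At each point the local extension centred there is used; [agree] shows that near any [p] this is
   the single function chosen at [p]. *)
pose G z := (rG z).2 z.
have z0 z : D z -> vn (z - z) < (rG z).1.
  by move=> /HrG[r0 _]; apply: le_lt_trans (subrr_vn z) r0.
have GO z : O z -> G z = g z.
  by move=> Oz; have Dz := OD _ Oz; have [_ /(_ _ (z0 z Dz))[_ _]] := HrG z Dz; exact.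
have dense z (e : R) : D z -> 0 < e -> exists w, vn (w - z) < e /\ O w.
  move=> Dz e0; apply: contrapT => no; have [r r0 Hr] := oD _ Dz.
  apply: (@null_no_interior R n.+1 Y (D `\` O) z (Num.min e r)) => //.
    by rewrite lt_min e0.
  move=> w; rewrite lt_min => /andP[h1 h2]; split; first exact: Hr.
  by move=> Ow; apply: no; exists w.
have agree p z : D p -> vn (z - p) < (rG p).1 -> (rG p).2 z = G z.
  move=> Dp zp; have [_ Hp] := HrG p Dp; have [Dz dz _] := Hp z zp.
  have [_ Hz] := HrG z Dz; have [_ dz' _] := Hz z (z0 z Dz).
  apply: contrapT => /eqP ne.
  have e0 : 0 < cn ((rG p).2 z - (rG z).2 z) by rewrite cn_gt0// subr_eq0.
  have /dif_cnt/(_ _ e0)[d1 d10 H1] : dif vn (fun w => (rG p).2 w - (rG z).2 w) z.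
    exact: (difB (@vn_ge0 _ _)).
  have [r0 _] := HrG z Dz.
  have m0 : 0 < Num.min d1 (Num.min ((rG p).1 - vn (z - p)) (rG z).1).
    by rewrite !lt_min d10 subr_gt0 zp r0.
  have [w [wz Ow]] := dense z _ Dz m0.
  move: wz; rewrite !lt_min => /and3P[w1 w2 w3].
  have wp : vn (w - p) < (rG p).1 by have := vn_dist w z p; clear -w2; lra.
  have [_ _ /(_ Ow) E1] := Hp w wp; have [_ _ /(_ Ow) E2] := Hz w w3.
  by have := H1 _ w1; rewrite E1 E2 subrr sub0r cnN ltxx.
exists G; split=> //.
  split=> // z Dz; have [r0 Hz] := HrG z Dz; have [_ dz _] := Hz z (z0 z Dz).
  by apply: dif_ext dz => //; exists (rG z).1 => // w wz; exact: agree.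
(* The majorants have integral at most 1 and infinite limit inferior on the exceptional set. Added
   to the square of [g] they dominate the square of [G] everywhere, so Fatou bounds its integral by
   that of [g] plus 1. *)
have [H [h1 h2 h3 h4]] := null_majorant Yn.
have lO : lscs (fun s => sqon O g (ptC n.+1 s)).
  apply: lscs_sqon gO.1 _ _ => [z /gO.2/dif_vcnt//|s t]; exact: ptC_cv.
have lH k : lscs (fun s => sqon O g (ptC n.+1 s) + H k s)%E.
  by apply: lscsD => // s; exact: sqon_ge0.
have pH k s : (0 <= sqon O g (ptC n.+1 s) + H k s)%E by rewrite adde_ge0 ?sqon_ge0.
apply: (@le_lt_trans _ _ (iter_int (2 * n.+1) (fun s => sqon O g (ptC n.+1 s)) + 1)%E); last first.
  by rewrite lte_add_pinfty// ltry.
apply: (@le_trans _ _ (iter_int (2 * n.+1)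
    (fun s => limn_einf (fun k => sqon O g (ptC n.+1 s) + H k s)%E))).
  apply: iter_le => s; first exact: sqon_ge0.
  set z : V := ptC _ _; have [Oz|nO] := pselect (O z).
    apply: (@limn_einf_ge_cst _ _ _ 0%N) => k _.
    rewrite (_ : sqon D G z = sqon O g z) ?leeDl// /sqon !ifT; [by rewrite GO|exact/asboolP..|].
    by apply/asboolP; exact: OD.
  have [Dz|nD] := pselect (D z); last first.
    apply: (@limn_einf_ge_cst _ _ _ 0%N) => k _; rewrite {1}/sqon ifF; first by rewrite adde_ge0 ?sqon_ge0.
    by apply/negbTE/negP => /asboolP.
  have [|i _ Yi] := XY z; first by split.
  have /eqP := h4 s (ex_intro _ i Yi); rewrite -leye_eq => Hoo.
  apply: le_trans (leey _) (le_trans Hoo _).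
  by apply: le_limn_einf => k; rewrite leeDr// sqon_ge0.
apply: le_trans (iter_fatou _ lH pH) _; apply: limn_einf_le_cst => k.
by rewrite iterD// => [|s]; [exact: leeD|exact: sqon_ge0].
Qed.

End LocalExtension.

(** * Thin images and preimages, critical values *)

Section Maps.
Variables (R : realType) (n : nat).
Local Notation C := R[i].
Local Notation V := 'rV[R[i]]_n.+1.
Implicit Types (w x y z u : V) (X Z K : set V).

Lemma vn_mulmx (M : 'M[C]_n.+1) : exists2 A : R, 0 < A & forall u, vn (u *m M) <= A * vn u.
Proof.
pose B := \sum_i \sum_j cn (M i j).
have B0 : 0 <= B by apply: sumr_ge0 => i _; apply: sumr_ge0 => j _; exact: cn_ge0.
exists (B + 1) => [|u]; first by rewrite ltr_wpDl.
apply: (@le_trans _ _ (B * vn u)); last by rewrite ler_wpM2r ?vn_ge0// lerDl.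
rewrite mulr_suml; apply: (@le_trans _ _ (\sum_j \sum_i cn (M i j) * vn u)); last first.
  by rewrite exchange_big; apply: ler_sum => i _; rewrite mulr_suml.
apply: ler_sum => j _; rewrite mxE; apply: le_trans (cn_sum _ _) _.
apply: ler_sum => i _; apply: le_trans (cnM _ _) _.
by rewrite mulrC ler_wpM2l ?cn_ge0 ?vn_coord.
Qed.

(** Prepending a zero coordinate makes [X] a Lipschitz graph in one dimension more, to which
    [cb_graph] applies; [slope 0 0] projects back. *)
Lemma bounded_cb m (X : set 'rV[C]_m) (B : R) : 0 <= B ->
  (forall a, X a -> vn a <= B) -> cb (2 * m) X.
Proof.
move=> B0 XB.
have c1 : cb (2 * m) (@emb R m @` X).
  apply: (@cb_graph R m _ ord0 B 0 B0 (lexx _)) => [_ [x Xx <-]|_ _ [x _ <-] [y _ <-]].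
    by rewrite vn_emb; exact: XB.
  by rewrite !emb0 subrr cn0 mul0r.
have := cb_lip (p := slope 0 0) (L := 1 + vn (0 : 'rV[C]_m)) (fun a b _ _ => slope_lip 0 0 a b) c1.
apply: cb_sub => x Xx; exists (emb x); first by exists x.
by apply/rowP => i; rewrite mxE embS emb0 !mxE; ring.
Qed.

Variables (W : set V) (F : V -> V).
Hypothesis FW : forall j, hol W (fun z => F z 0 j).

(** Vectors are rows, so row [i] is the derivative in direction [i] and the differential acts as
    [u *m jac w]. *)
Definition jac z : 'M[C]_n.+1 := \matrix_(i, j) Dv (fun z => F z 0 j) z (delta_mx 0 i).

Lemma hol_det_jac : hol W (fun z => \det (jac z)).
Proof.
have [oW _] := FW ord0; split=> // z Wz.
rewrite /determinant; apply: (dif_sum (@vn_ge0 _ _)) => s.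
apply: (dif_scale (@vn_ge0 _ _)); apply: (dif_prod (@vn_ge0 _ _)) => i.
have [_ H] := hol_Dv (delta_mx 0 i) (FW (perm.fun_of_perm s i)).
by apply: dif_ext (H z Wz); [exists 1 => // w _; rewrite mxE|rewrite mxE].
Qed.

Lemma Dv_jac w u j : W w -> Dv (fun z => F z 0 j) w u = (u *m jac w) 0 j.
Proof.
move=> Ww; have [_ /(_ w Ww)/DvP/isd_sum ->] := FW j.
by rewrite mxE; apply: eq_bigr => i _; rewrite mxE.
Qed.

Lemma vn_le_coord (B : R) u : (forall j, cn (u 0 j) <= B / n.+1%:R) -> vn u <= B.
Proof.
move=> H; apply: (@le_trans _ _ (\sum_(j < n.+1) B / n.+1%:R)); first by apply: ler_sum => j _.
by rewrite sumr_const card_ord -[X in X <= _]mulr_natr divfK// pnatr_eq0.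
Qed.

Lemma entryBB x y z j : (x - y - z) 0 j = x 0 j - y 0 j - z 0 j.
Proof. by rewrite !mxE. Qed.

Lemma strict_dif_map w (e : R) : W w -> 0 < e -> exists2 dl : R, 0 < dl &
  (forall x, vn (x - w) < dl -> W x) /\
  forall x y, vn (x - w) < dl -> vn (y - w) < dl ->
    vn (F x - F y - (x - y) *m jac w) <= e * vn (x - y).
Proof.
move=> Ww e0; have e'0 : 0 < e / n.+1%:R by rewrite divr_gt0.
have /choice[dl Hdl] : forall j, exists dl : R, 0 < dl /\
    ((forall x, vn (x - w) < dl -> W x) /\
     forall x y, vn (x - w) < dl -> vn (y - w) < dl ->
    cn (F x 0 j - F y 0 j - Dv (fun z => F z 0 j) w (x - y)) <= e / n.+1%:R * vn (x - y)).
  by move=> j; have [dl dl0 H] := strict_dif (FW j) Ww e'0; exists dl.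
have [m m0 Hm] := fin_min (fun j => (Hdl j).1).
exists m => //; split=> [x xm|x y xm ym].
  by have [_ [H _]] := Hdl ord0; apply: H; exact: lt_le_trans (Hm _).
apply: vn_le_coord => j; have [_ [_ H]] := Hdl j.
have := H x y (lt_le_trans xm (Hm _)) (lt_le_trans ym (Hm _)).
by rewrite Dv_jac// entryBB mulrAC.
Qed.

Lemma map_lip w : W w -> exists dl A : R, [/\ 0 < dl, 0 < A, forall x, vn (x - w) < dl -> W x &
  forall x y, vn (x - w) < dl -> vn (y - w) < dl -> vn (F x - F y) <= A * vn (x - y)].
Proof.
move=> Ww; have [dl dl0 [H1 H2]] := strict_dif_map Ww ltr01.
have [A A0 HA] := vn_mulmx (jac w).
exists dl, (1 + A); split=> //; first by rewrite addr_gt0.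
move=> x y xd yd; rewrite -[F x - F y](subrK ((x - y) *m jac w)).
by apply: le_trans (vnD _ _) _; rewrite mulrDl; apply: lerD; [exact: H2|exact: HA].
Qed.

(** Strict differentiability with error [1 / (2 * B)], where [B] bounds the inverse Jacobian, leaves
    half of [vn v] to be estimated by the difference of the values. *)
Lemma map_injective w : W w -> \det (jac w) != 0 -> exists dl A : R, [/\ 0 < dl, 0 < A &
  forall x y, vn (x - w) < dl -> vn (y - w) < dl -> vn (x - y) <= A * vn (F x - F y)].
Proof.
move=> Ww J0; have [B B0 HB] := vn_mulmx (invmx (jac w)).
have [|dl dl0 [_ H]] := @strict_dif_map w (1 / (2 * B)) Ww; first by rewrite divr_gt0// mulr_gt0.
exists dl, (2 * B); split=> //; first by rewrite mulr_gt0.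
move=> x y xd yd; have := H x y xd yd; set v := x - y; set D := F x - F y => h.
have h1 : vn v <= B * vn (v *m jac w).
  by have := HB (v *m jac w); rewrite mulmxK// unitmxE unitfE.
have h2 : vn (v *m jac w) <= vn D + 1 / (2 * B) * vn v.
  have := vnD D (v *m jac w - D); rewrite addrC subrK (vn_sym (_ *m _)).
  by move=> h2; apply: le_trans h2 _; rewrite lerD2l.
have : vn v <= B * (vn D + 1 / (2 * B) * vn v) by apply: le_trans h1 _; rewrite ler_pM2l.
rewrite mulrDr (_ : B * (1 / (2 * B) * vn v) = vn v / 2); first lra.
by field; rewrite gt_eqF.
Qed.

Lemma image_sc k X : X `<=` W -> sc k X -> sc k (F @` X).
Proof.
move=> XW [Y [Yc XY]].
have [||x Xx|Z [Zc XZ]] := @lindelof R n.+1 (fun Z => sc k (F @` Z)) X.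
- by rewrite image_set0; exact: sc0.
- by move=> A B AB; apply: sc_sub; exact: image_subset.
- have [dl [A [dl0 A0 _ H]]] := map_lip (XW _ Xx); exists dl => //.
  exists (fun i => F @` (Y i `&` (X `&` [set y | vn (y - x) < dl]))); split.
    move=> i; apply: (cb_lip (L := A)); last by apply: cb_sub (Yc i) => y [].
    by move=> y y' [_ [_ h1]] [_ [_ h2]]; exact: H.
  move=> _ [y [Xy yd] <-]; have [i _ Yi] := XY _ Xy.
  by exists i => //; exists y.
- apply: (@sc_sub _ _ _ _ (\bigcup_i F @` Z i)); last exact: sc_bigcup.
  by move=> _ [x Xx <-]; have [i _ Zi] := XZ _ Xx; exists i => //; exists x.
Qed.

(** Away from the critical set the preimage is locally the image of part of [K] under the Lipschitz
    inverse supplied by [map_injective]. *)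
Lemma preimage_sc k X K : X `<=` W -> sc k [set z | X z /\ \det (jac z) = 0] ->
  sc k K -> sc k [set z | X z /\ K (F z)].
Proof.
move=> XW sJ [Y [Yc KY]].
pose N := [set z | [/\ X z, K (F z) & \det (jac z) != 0]].
apply: (@sc_sub _ _ _ _ ([set z | X z /\ \det (jac z) = 0] `|` N)).
  by move=> z [Xz Kz]; have [J0|J0] := eqVneq (\det (jac z)) 0; [left|right].
apply: sc_setU => //; apply: sc_local => x [Xx _ J0].
have [dl [A [dl0 A0 H]]] := map_injective (XW _ Xx) J0; exists dl => //.
pose p y := xget 0 [set z | vn (z - x) < dl /\ F z = y].
have pF z : vn (z - x) < dl -> vn (p (F z) - x) < dl /\ F (p (F z)) = F z.
  by move=> zd; exact: (@xgetI _ 0 [set z' | vn (z' - x) < dl /\ F z' = F z] z (conj zd erefl)).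
exists (fun i => p @` (Y i `&` F @` [set z | vn (z - x) < dl])); split.
  move=> i; apply: (cb_lip (L := A)); last by apply: cb_sub (Yc i) => y [].
  move=> _ _ [_ [z zd <-]] [_ [z' zd' <-]].
  have [h1 h2] := pF z zd; have [h3 h4] := pF z' zd'.
  by have := H _ _ h1 h3; rewrite h2 h4.
move=> z [[Xz Kz _] zd]; have [i _ Yi] := KY _ Kz; exists i => //.
have [h1 h2] := pF z zd; exists (F z); first by split=> //; exists z.
apply/eqP; rewrite -subr_eq0; apply/eqP; apply: vn_eq0; apply/eqP; rewrite eq_le vn_ge0 andbT.
by have := H _ _ h1 zd; rewrite h2 => h; apply: le_trans h _; rewrite pmulr_rle0 ?subrr_vn.
Qed.

Lemma size_flatten_le (T T' : Type) (t : seq T) (f : T -> seq T') (S : R) :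
  (forall c, (size (f c))%:R <= S) -> (size (flatten [seq f c | c <- t]))%:R <= (size t)%:R * S.
Proof.
move=> fS; elim: t => [|c t IH] /=; first by rewrite mul0r.
by rewrite size_cat natrD [(size t).+1%:R]mulrS mulrDl mul1r lerD.
Qed.

Lemma quad_map x : W x -> exists rho A : R, [/\ 0 < rho, 0 < A &
  forall w z, vn (w - x) < rho -> vn (z - x) < rho ->
    vn (F z - F w - (z - w) *m jac w) <= A * vn (z - w) ^+ 2].
Proof.
move=> Wx; have [K [K0 HK]] := @dv_quad R n.+1.
have [oW _] := FW ord0; have [r0 r00 HU] := oW x Wx.
have /choice[r1 Hr1] : forall j, exists r1 : R, 0 < r1 /\
    forall w, vn (w - x) < r1 -> cn (F w 0 j - F x 0 j) < 1.
  by move=> j; have [_ /(_ x Wx)/dif_cnt/(_ _ ltr01)[r1 r10 H]] := FW j; exists r1.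
have [m m0 Hm] := fin_min (fun j => (Hr1 j).1).
pose rho := Num.min r0 m / 2.
have rho0 : 0 < rho by rewrite divr_gt0// lt_min r00.
have [rs rm] : 2 * rho <= r0 /\ 2 * rho <= m.
  have m1 : Num.min r0 m <= r0 by rewrite ge_min lexx.
  have m2 : Num.min r0 m <= m by rewrite ge_min lexx orbT.
  by rewrite /rho; split; lra.
clearbody rho.
pose A := K * 2 / rho ^+ 2.
have A0 : 0 < A by rewrite !mulr_gt0// invr_gt0 exprn_gt0.
exists (rho / 8), (n.+1%:R * A); split; [by rewrite divr_gt0|by rewrite mulr_gt0|].
move=> w z wx zx; have Ww : W w by apply: HU; lra.
have zw : vn (z - w) <= rho / 4 by have := vn_dist z x w; rewrite (vn_sym x w); lra.
apply: vn_le_coord => j; rewrite entryBB -Dv_jac//.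
have [_ dj] := FW j.
have [|_ Hq] := HK (fun z => F z 0 j) W w rho 2 _ rho0 (FW j) _ (DvP (dj w Ww)).
  move=> v vy; have vx := vn_dist v w x; split; first by apply: HU; lra.
  have := cnB (F v 0 j - F x 0 j) (F w 0 j - F x 0 j); rewrite opprB addrA subrK.
  have [_ Hj] := Hr1 j; have mj := Hm j.
  have : cn (F v 0 j - F x 0 j) < 1 by apply: Hj; lra.
  have : cn (F w 0 j - F x 0 j) < 1 by apply: Hj; lra.
  by lra.
have := Hq _ zw; rewrite (_ : w + (z - w) = z) => [h|]; last by rewrite addrC subrK.
apply: le_trans h _.
rewrite -/A; clearbody A; move: (vn (z - w) ^+ 2) => q.
have : n.+1%:R != 0 :> R by rewrite pnatr_eq0.
by move: (n.+1%:R : R) => N N0; rewrite le_eqVlt; apply/orP; left; apply/eqP; field.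
Qed.

(* A null vector of the Jacobian, normalized at its largest entry [j]: up to the error
   terms the image is a 2-Lipschitz graph over the coordinates other than [j]. *)
Lemma singular_image w : \det (jac w) = 0 -> exists j : 'I_n.+1, forall (u u' x y : V),
  cn (x 0 j - y 0 j) <= 2 * (\sum_(i < n) cn (x 0 (lift j i) - y 0 (lift j i))) +
    2 * (vn (x - u *m jac w) + vn (y - u' *m jac w)).
Proof.
move=> J0; have /det0P[v v0 vJ] : \det (jac w)^T == 0 by rewrite det_tr J0.
have [j Hj] : exists j, forall i, cn (v 0 i) <= cn (v 0 j).
  by exists [arg max_(j > ord0) cn (v 0 j)]%O; case: arg_maxP => //= j _ H i; exact: H.
have vj0 : v 0 j != 0.
  apply: contraNneq v0 => vj; apply/eqP/rowP => i; rewrite mxE; apply: cn_eq0.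
  by apply/eqP; rewrite eq_le cn_ge0 andbT; have := Hj i; rewrite vj cn0.
exists j => u u' x y.
pose q := (u - u') *m jac w; pose d := x - u *m jac w - (y - u' *m jac w).
have qd k : x 0 k - y 0 k = (q + d) 0 k.
  rewrite /q /d mulmxBl; move: (u *m _) (u' *m _) => a b; rewrite !mxE; ring.
have dE : vn d <= vn (x - u *m jac w) + vn (y - u' *m jac w).
  by apply: le_trans (vnD _ _) _; rewrite vnN.
rewrite qd; under eq_bigr do rewrite qd.
have qv : \sum_i q 0 i * v 0 i = 0.
  have : (q *m v^T) 0 0 = 0.
    by rewrite /q -mulmxA -[jac w]trmxK -trmx_mul vJ trmx0 mulmx0 mxE.
  by rewrite mxE => E; rewrite -[RHS]E; apply: eq_bigr => i _; rewrite [v^T _ _]mxE.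
pose a i := v 0 (lift j i) / v 0 j.
have a2 i : cn (a i) <= 2.
  apply: le_trans (cnM _ _) _; have c0 := cn_gt0 vj0.
  apply: (@le_trans _ _ (cn (v 0 j) * (2 / cn (v 0 j)))).
    by apply: ler_pM => //; rewrite ?cn_ge0//; exact: cnV.
  by rewrite mulrCA divff ?mulr1// gt_eqF.
have qj : q 0 j = - \sum_(i < n) a i * q 0 (lift j i).
  move: qv; rewrite (bigD1_ord j)//= => /eqP; rewrite addr_eq0 => /eqP E.
  apply: (mulIf vj0); rewrite E mulNr mulr_suml; congr (- _); apply: eq_bigr => i _.
  by rewrite /a mulrAC divfK// mulrC.
have S i : cn (a i * q 0 (lift j i)) <= 2 * cn ((q + d) 0 (lift j i)) + 2 * cn (d 0 (lift j i)).
  apply: le_trans (cnM _ _) _; rewrite -mulrDr; apply: ler_pM; rewrite ?cn_ge0//.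
  by have := cnB ((q + d) 0 (lift j i)) (d 0 (lift j i)); rewrite [(q + d) _ _]mxE addrK.
rewrite mxE qj; apply: le_trans (cnD _ _) _; rewrite cnN.
apply: (@le_trans _ _ (\sum_(i < n) (2 * cn ((q + d) 0 (lift j i)) + 2 * cn (d 0 (lift j i))) + cn (d 0 j))).
  by rewrite lerD2r; apply: le_trans (cn_sum _ _) _; apply: ler_sum => i _; exact: S.
rewrite big_split /= -!mulr_sumr -addrA lerD2l.
have : vn d = cn (d 0 j) + \sum_(i < n) cn (d 0 (lift j i)) by rewrite /vn (bigD1_ord j).
by have := cn_ge0 (d 0 j); lra.
Qed.

Lemma nb_set0 : nb (set0 : set V).
Proof. by move=> dl d0; exists 1, [::]; rewrite ltr01 mul0r ltW. Qed.

Lemma nb_sub X Z : X `<=` Z -> nb Z -> nb X.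
Proof. by move=> XZ HZ dl /HZ[rho [t [h1 h2 h3]]]; exists rho, t; split=> // x /XZ/h3. Qed.

(** A ball of radius [e] around a critical point maps into a slab of size [e] and thickness [e ^ 2],
    covered by about [e ^ (-2n)] balls of radius of order [e ^ 2]. About [e ^ (-2n-2)] such balls
    are needed, so the total volume is of order [e ^ (-4n-2) * e ^ (4n+4) = e ^ 2]. *)
Lemma sard X : X `<=` W -> (forall z, X z -> \det (jac z) = 0) ->
  exists Y : nat -> set V, (forall i, nb (Y i)) /\ F @` X `<=` \bigcup_i Y i.
Proof.
move=> XW XJ.
have [||x Xx|Z [Zc XZ]] := @lindelof R n.+1 (fun Z => nb (F @` Z)) X; last first.
- exists (fun i => F @` Z i); split=> // _ [x Xx <-].
  by have [i _ Zi] := XZ _ Xx; exists i => //; exists x.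
- have [r1 [A [r10 A0 HA]]] := quad_map (XW _ Xx).
  have [r2 [L [r20 L0 _ HL]]] := map_lip (XW _ Xx).
  exists (Num.min r1 r2) => [|dl dl0]; first by rewrite lt_min r10.
  set B := X `&` _.
  have BE z : B z -> [/\ X z, vn (z - x) < r1 & vn (z - x) < r2].
    by move=> [Xz]; rewrite /= lt_min => /andP[].
  have [cA HcA] : cb (2 * n.+1) B.
    apply: (@bounded_cb n.+1 B (r1 + vn x)); first by rewrite addr_ge0 ?vn_ge0 ?ltW.
    move=> z /BE[_ zr _]; have := vnD (z - x) x; rewrite subrK; lra.
  pose D : R := (1 + 2) * (2 * n%:R) + 1.
  have D1 : 1 <= D by rewrite lerDr !mulr_ge0// addr_ge0.
  pose H : R := L / (4 * A) + 2.
  have H0 : 0 < H by rewrite ltr_wpDl// divr_ge0 ?mulr_ge0// ltW.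
  pose G : R := D * (16 * A).
  have G0 : 0 < G by rewrite !mulr_gt0//; lra.
  pose T : R := cA * H ^+ (2 * n) * G ^+ (2 * n.+1).
  have cA0 : 0 <= cA.
    have [|t [h _]] := HcA 1; first by rewrite ltr01 lexx.
    by apply: le_trans h; rewrite expr1n mulr1.
  have T0 : 0 <= T by rewrite !mulr_ge0// exprn_ge0 ?ltW.
  pose e : R := Num.min 1 (dl / (T + 1)).
  have e0 : 0 < e by rewrite lt_min ltr01 divr_gt0// ltr_wpDl.
  have e1 : e <= 1 by rewrite ge_min lexx.
  have eT : e * (T + 1) <= dl by rewrite -ler_pdivlMr ?ltr_wpDl// ge_min lexx orbT.
  clearbody e.
  have [|t [ht1 ht2]] := HcA e; first by rewrite e0.
  have He : 0 <= H / e by rewrite divr_ge0 ?(ltW H0) ?(ltW e0).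
  have eta0 : 0 < 16 * A * e ^+ 2 by rewrite !mulr_gt0// exprn_gt0.
  have /choice[tc Htc] : forall c, exists tc : seq V, (size tc)%:R <= (H / e) ^+ (2 * n) /\
      forall z, B z -> vn (z - c) <= e -> exists2 y, y \in tc & vn (F z - y) <= G * e ^+ 2.
    move=> c; have [[w Bw wc]|no] := pselect (exists2 w, B w & vn (w - c) <= e); last first.
      exists [::]; split; first by rewrite exprn_ge0.
      by move=> z Bz zc; case: no; exists z.
    have [Xw w1 w2] := BE w Bw; have [j Hj] := singular_image (XJ w Xw).
    pose X' := [set F z - F w | z in [set z | B z /\ vn (z - w) <= 2 * e]].
    have err z : B z -> vn (z - w) <= 2 * e -> vn (F z - F w - (z - w) *m jac w) <= 4 * A * e ^+ 2.
      move=> /BE[_ z1 _] zw; apply: le_trans (HA _ _ w1 z1) _.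
      rewrite (_ : 4 * A * e ^+ 2 = A * (2 * e) ^+ 2); last by ring.
      by rewrite ler_pM2l// lerXn2r// nnegrE ?vn_ge0// mulr_ge0// ltW.
    (* The additive error consists of two remainders of [4 * A * e ^ 2], doubled in
       [singular_image]. *)
    have [|||||tt [tt1 tt2]] := @graph_cover R n X' j (2 * L * e) 2 (16 * A * e ^+ 2).
    - by rewrite !mulr_ge0// ltW.
    - by [].
    - by [].
    - move=> _ [z [Bz zw] <-]; have [_ _ z2] := BE z Bz.
      by apply: le_trans (HL _ _ z2 w2) _; rewrite (mulrC 2) -mulrA ler_pM2l.
    - move=> _ _ [z [Bz zw] <-] [z' [Bz' zw'] <-].
      apply: le_trans (Hj (z - w) (z' - w) _ _) _; rewrite lerD2l.
      have := lerD (err z Bz zw) (err z' Bz' zw'); move: (_ + vn _) (e ^+ 2) => a E h.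
      by rewrite -[leRHS](_ : 2 * (4 * A * E + 4 * A * E) = _) ?ler_pM2l//; ring.
    exists [seq F w + y | y <- tt]; split.
      rewrite size_map; apply: le_trans tt1 _; apply: lerXn2r.
      - by rewrite nnegrE addr_ge0// divr_ge0 ?mulr_ge0 ?ltW.
      - by rewrite nnegrE.
      rewrite /H [leRHS]mulrDl; apply: lerD.
        by rewrite le_eqVlt; apply/orP; left; apply/eqP; field; rewrite !gt_eqF.
      by rewrite ler_pdivlMr// ler_piMr.
    move=> z Bz zc; have zw : vn (z - w) <= 2 * e.
      by have := vn_dist z c w; rewrite (vn_sym c w); lra.
    have [|y yt yz] := tt2 (F z - F w); first by exists z.
    exists (F w + y); first exact: map_f.
    by rewrite opprD addrA; apply: le_trans yz _; rewrite -/D /G mulrA.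
  exists (G * e ^+ 2), (flatten [seq tc c | c <- t]); split.
  - by rewrite mulr_gt0// exprn_gt0.
  - apply: (@le_trans _ _ ((size t)%:R * (H / e) ^+ (2 * n) * (G * e ^+ 2) ^+ (2 * n.+1))).
      rewrite ler_wpM2r//; first by rewrite exprn_ge0// mulr_ge0 ?exprn_ge0 ?ltW.
      by apply: size_flatten_le => c; have [] := Htc c.
    have -> : (size t)%:R * (H / e) ^+ (2 * n) * (G * e ^+ 2) ^+ (2 * n.+1) =
        (size t)%:R * e ^+ (2 * n.+1) * (H ^+ (2 * n) * G ^+ (2 * n.+1) * e ^+ 2).
      have -> : e ^+ (2 * n.+1) = e ^+ (2 * n) * e ^+ 2 by rewrite mulnS addnC exprD.
      rewrite [(H / e) ^+ _]exprMn exprVn [(G * _) ^+ _]exprMn.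
      have -> : (e ^+ 2) ^+ (2 * n.+1) = (e ^+ (2 * n) * e ^+ 2) ^+ 2.
        by rewrite -exprD -!exprM mulnS addnC mulnC.
      have : e ^+ (2 * n) != 0 by rewrite expf_neq0// gt_eqF.
      by move: (e ^+ (2 * n)) => E E0; field.
    apply: (@le_trans _ _ (T * e ^+ 2)).
      have -> : T * e ^+ 2 = cA * (H ^+ (2 * n) * G ^+ (2 * n.+1) * e ^+ 2) by rewrite /T !mulrA.
      apply: ler_wpM2r ht1; apply: mulr_ge0; last exact: sqr_ge0.
      by apply: mulr_ge0; apply: exprn_ge0; exact: ltW.
    apply: (@le_trans _ _ (T * e)).
      by rewrite expr2 mulrA ler_piMr// mulr_ge0// ltW.
    by apply: le_trans eT; rewrite mulrDr mulr1 mulrC lerDl ltW.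
  - move=> _ [z Bz <-]; have [c ct zc] := ht2 z Bz; have [_ /(_ z Bz zc)[y yt yz]] := Htc c.
    by exists y => //; apply/flattenP; exists (tc c) => //; exact: map_f.
- by move=> A B AB; apply: nb_sub; exact: image_subset.
- by rewrite image_set0; exact: nb_set0.
Qed.

End Maps.

(** * Topology and differentiability of [Cd] *)

Section Bridge.
Variable R : realType.
Local Notation C := R[i].
Local Notation Re := (@complex.Re R).

Lemma gt0_real (e : C) : 0 < e -> 0 < Re e /\ e = (Re e)%:C%C.
Proof. by case: e => a b; rewrite ltcE /= => /andP[/eqP -> a0]. Qed.

Lemma cn_norm_lt (u e : C) : 0 < e -> cn u < Re e -> `|u| < e.
Proof.
move=> /gt0_real[e0 ->]; rewrite normc_def ltcR /= => ue.
apply: le_lt_trans ue; rewrite -(ger0_norm (cn_ge0 u)) -sqrtr_sqr ler_wsqrtr//.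
exact: sqmod_cn.
Qed.

Lemma norm_cn_le (u e : C) : `|u| <= e -> cn u <= 2 * Re e.
Proof.
rewrite normc_def; case: e => a b; rewrite lecE /= => /andP[_ h].
apply: le_trans (_ : 2 * Num.sqrt (sqmod u) <= _); last by rewrite ler_pM2l.
have s0 : 0 <= Num.sqrt (sqmod u) by exact: sqrtr_ge0.
have sE := sqr_sqrtr (sqmod_ge0 u).
rewrite leNgt; apply/negP => lt; have := cn_sqmod u; rewrite -sE.
by move: lt s0; move: (Num.sqrt _) (cn u) => s c lt s0; nra.
Qed.

Lemma cn_le_norm (u : C) (b : R) : cn u <= b -> `|u| <= b%:C%C.
Proof.
rewrite normc_def lecR => ub; apply: le_trans ub.
by rewrite -(ger0_norm (cn_ge0 u)) -sqrtr_sqr ler_wsqrtr// sqmod_cn.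
Qed.

Lemma norm_coord d (h : Cd R d) j : `|(h : 'rV[C]_d) 0 j| <= `|h|.
Proof.
rewrite [leRHS]/Num.norm /= mx_normE -[leLHS]nngE num_le.
by have := le_bigmax (0%:nng : {nonneg C}) (fun i : 'I_1 * 'I_d => `|(h : 'rV_d) i.1 i.2|%:nng) (0, j).
Qed.

Variable d : nat.
Implicit Types (z w : Cd R d).

Lemma nbhs_vn z (A : set (Cd R d)) :
  nbhs z A <-> exists2 r : R, 0 < r & forall w : 'rV[C]_d, vn (w - (z : 'rV[C]_d)) < r -> A w.
Proof.
split=> [/nbhs_ballP[e /= e0 eA]|[r r0 rA]].
  have [e'0 eE] := gt0_real e0; exists (Re e) => // w wz; apply: eA; split=> // i j.
  rewrite -ball_normE /= (ord1 i); apply: cn_norm_lt => //; apply: le_lt_trans wz.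
  by rewrite cn_sym; have := vn_coord (w - (z : 'rV_d)) j; rewrite !mxE.
apply/nbhs_ballP; pose e := r / (2 * d%:R + 1).
have D0 : 0 < 2 * d%:R + 1 :> R by rewrite ltr_wpDl.
have e0 : 0 < e by rewrite divr_gt0.
exists (e%:C%C); first by rewrite /= ltcR.
move=> w [_ H]; apply: rA; apply: (@le_lt_trans _ _ (\sum_(j < d) 2 * e)).
  apply: ler_sum => j _; have := H 0 j; rewrite -ball_normE /= => /ltW/norm_cn_le /=.
  by rewrite cn_sym !mxE.
rewrite sumr_const card_ord -mulr_natr.
have : e * (2 * d%:R + 1) = r by rewrite divfK ?gt_eqF.
by move=> <-; clear -e0; lra.
Qed.

Lemma open_vopn (U : set (Cd R d)) : open U <-> vopn (U : set 'rV[C]_d).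
Proof.
rewrite openE; split=> [oU z /oU/nbhs_vn[r r0 H]|oU z /oU[r r0 H]]; first by exists r.
by apply/nbhs_vn; exists r.
Qed.

Lemma norm_le_vn (h : Cd R d) : `|h| <= (vn (h : 'rV[C]_d))%:C%C.
Proof.
have v0 : 0 <= (vn (h : 'rV[C]_d))%:C%C by rewrite lecR vn_ge0.
rewrite [leLHS]/Num.norm /= mx_normE.
have -> : (vn (h : 'rV[C]_d))%:C%C = (NngNum v0)%:num by [].
rewrite num_le; apply/bigmax_leP; split=> [|[i j] _]; rewrite -num_le /=.
  exact: v0.
by rewrite (ord1 i); apply: cn_le_norm; exact: vn_coord.
Qed.

Lemma Re_norm_le_vn (h : Cd R d) : Re `|h| <= vn (h : 'rV[C]_d).
Proof. by have := norm_le_vn h; rewrite lecE => /andP[]. Qed.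

(** The contraction [p] is the identity for scalar functions and a coordinate for maps into row
    vectors, so one proof covers both. *)
Lemma differentiable_dif (W : normedModType C) (p : W -> C) (f : Cd R d -> W) z :
  (forall (a : C) u v, p (a *: u + v) = a * p u + p v) -> (forall x, `|p x| <= `|x|) ->
  differentiable f z -> dif (V := 'rV[C]_d) vn (fun w => p (f w)) z.
Proof.
move=> pl pn /diff_locallyP[dc /eqaddoP H].
have [k k0 Hk] := linear_lipschitz dc.
have [k'0 kE] := gt0_real k0.
have Rn0 (x : W) : 0 <= Re `|x|.
  by have := normr_ge0 x; rewrite lecE => /andP[].
have pD x y : p (x - y) = p x - p y.
  by rewrite addrC -scaleN1r pl mulN1r addrC.
have h0 (x : Cd R d) : 0 <= Re `|x| by have := normr_ge0 x; rewrite lecE => /andP[].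
have ReM (b : R) (x : Cd R d) : 0 <= b -> Re (b%:C%C * `|x|) <= b * vn (x : 'rV[C]_d).
  move=> b0; have := Re_norm_le_vn x; case: `|x| => a c /= xv.
  by rewrite mul0r subr0 ler_wpM2l.
exists (fun u => p ('d f z u)); split.
- by move=> a u v; rewrite linearP pl.
- exists (2 * Re k); split=> [|u]; first by rewrite mulr_ge0// ltW.
  have := norm_cn_le (le_trans (pn _) (Hk u)); rewrite kE => h; apply: le_trans h _.
  by rewrite -mulrA ler_pM2l//; apply: ReM; exact: ltW.
- move=> e e0; have e2 : 0 < (e / 2)%:C%C :> C by rewrite ltcR divr_gt0.
  have /nbhs_vn[r r0 Hr] := H _ e2; exists r => // w wz.
  have := Hr (w - z); rewrite subr0 => /(_ wz) /= h.
  have := norm_cn_le (le_trans (pn _) h).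
  have -> : (f \o shift z - (cst (f z) + 'd f z)) (w - z) = f w - f z - 'd f z (w - z).
    by rewrite -[LHS]/(f (w - z + z) - (f z + 'd f z (w - z))) subrK opprD addrA.
  rewrite !pD => h'; apply: le_trans h' _.
  have e20 : 0 <= e / 2 by rewrite divr_ge0// ltW.
  have h2 : Re ((e / 2)%:C%C * `|w - z|) <= e / 2 * vn (w - (z : 'rV[C]_d)) := ReM _ (w - z) e20.
  move: h2; move: (Re _) (vn _) => a b; clear; lra.
Qed.

Lemma cnt_continuous (f : Cd R d -> Cs R) z : cnt (V := 'rV[C]_d) vn f z -> {for z, continuous f}.
Proof.
move=> cf A /nbhs_ballP[e /= e0 eA]; have [e'0 _] := gt0_real e0.
have [r r0 Hr] := cf _ e'0; apply/nbhs_vn; exists r => // w /Hr h; apply: eA.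
by rewrite -ball_normE /=; apply: cn_norm_lt => //; rewrite cn_sym.
Qed.

Lemma dif_differentiable (f : Cd R d -> Cs R) z : dif (V := 'rV[C]_d) vn f z -> differentiable f z.
Proof.
move=> [L [lin [K [K0 bnd]] o]].
have Ll : linear (L : Cd R d -> Cs R) by move=> a u v; rewrite lin.
pose LM := GRing.isLinear.Build _ _ _ _ _ Ll.
pose Lh : {linear Cd R d -> Cs R} := HB.pack (L : Cd R d -> Cs R) LM.
have LB u v : L (u - v) = L u - L v.
  by rewrite addrC -scaleN1r lin mulN1r addrC.
have Lc : continuous Lh.
  move=> x; apply: cnt_continuous => e e0; exists (e / (K + 1)).
    by rewrite divr_gt0// ltr_wpDl.
  move=> w; rewrite ltr_pdivlMr ?ltr_wpDl// => wx; rewrite /= -LB.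
  apply: le_lt_trans (bnd _) _; apply: le_lt_trans wx.
  by rewrite mulrC ler_wpM2l ?vn_ge0// lerDl.
have ex : f \o shift z = cst (f z) + Lh +o_ 0 id.
  apply/eqaddoP => e e0; have [e'0 eE] := gt0_real e0.
  have D0 : 0 < 2 * d%:R + 1 :> R by rewrite ltr_wpDl.
  have [r r0 Hr] := o (Re e / (2 * d%:R + 1)) (divr_gt0 e'0 D0).
  apply/nbhs_vn; exists r => // h; rewrite subr0 => hr.
  have := Hr (h + z); rewrite addrK => /(_ hr) H.
  have -> : (f \o shift z - (cst (f z) + Lh)) h = f (h + z) - f z - L h.
    by rewrite /= /shift /= -addrA -opprD.
  have [n0 nE] : 0 <= Re `|h| /\ `|h| = (Re `|h|)%:C%C.
    have := normr_ge0 (h : Cd R d); case: `|_| => a b; rewrite lecE /= => /andP[/eqP -> ->].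
    by [].
  rewrite nE eE -rmorphM /=; apply: cn_le_norm; apply: le_trans H _.
  rewrite -mulrA ler_pM2l// ler_pdivrMl//.
  apply: (@le_trans _ _ (\sum_(j < d) 2 * Re `|h|)).
    by apply: ler_sum => j _; apply: norm_cn_le; exact: norm_coord.
  by rewrite sumr_const card_ord -mulr_natr; clear -n0; lra.
by apply/diff_locallyP; rewrite (diff_unique Lc ex).
Qed.

Lemma hol_holo_on (U : set (Cd R d)) (f : Cd R d -> Cs R) :
  holo_on U f <-> hol (U : set 'rV[C]_d) f.
Proof.
split=> -[oU fU]; split; first by apply/open_vopn.
- by move=> z /fU; apply: (@differentiable_dif (Cs R) id).
- by apply/open_vopn.
- by move=> z /fU; exact: dif_differentiable.
Qed.

Lemma holo_on_coord m (U : set (Cd R d)) (F : Cd R d -> Cd R m) (j : 'I_m) :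
  holo_on U F -> hol (U : set 'rV[C]_d) (fun z => (F z : 'rV[C]_m) 0 j).
Proof.
move=> [oU FU]; split; first by apply/open_vopn.
move=> z /FU; apply: (differentiable_dif (p := fun v : Cd R m => (v : 'rV[C]_m) 0 j)).
  by move=> a u v; rewrite !mxE.
by move=> x; exact: (norm_coord x j).
Qed.

End Bridge.

(** * Compactness of closed subsets of the closure of a bounded set *)

Section Topology.
Variables (R : realType) (d : nat).
Local Notation C := R[i].
Implicit Types (z w : Cd R d) (A : set (Cd R d)).

Lemma compact_square (b : R) :
  compact [set z : (C : numFieldType) | `|complex.Re z| <= b /\ `|complex.Im z| <= b].
Proof.
pose g (p : R * R) : (C : numFieldType) := (p.1 +i* p.2)%C.
have gc : continuous g.
  move=> p A /nbhs_ballP[e /= e0 eA]; have [e'0 _] := gt0_real e0.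
  apply/nbhs_ballP; exists (complex.Re e / 2); first by rewrite /= divr_gt0.
  move=> q [q1 q2]; apply: eA; rewrite -ball_normE /=; apply: cn_norm_lt => //.
  move: q1 q2; rewrite -!ball_normE /= /cn /= => q1 q2.
  by rewrite [ltRHS]splitr ltrD.
have -> : [set z : (C : numFieldType) | `|complex.Re z| <= b /\ `|complex.Im z| <= b] =
    g @` (`[- b, b]%classic `*` `[- b, b]%classic).
  apply/seteqP; split=> [[x y] /= [h1 h2]|_ [[x y] [/= h1 h2] <-]].
    by exists (x, y) => //; split; rewrite /= in_itv /= -ler_norml.
  by move: h1 h2; rewrite !in_itv /= -!ler_norml.
apply: continuous_compact; first exact: continuous_subspaceT.
by apply: compact_setX; exact: segment_compact.
Qed.

Lemma bounded_closure_compact A B : bounded_set A -> closed B -> B `<=` closure A -> compact B.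
Proof.
move=> [M [Mr HM]] cB BA.
pose b := complex.Re (M + 1).
pose Q : set (Cd R d) := [set v : 'rV[C]_d | forall j, `|complex.Re (v ord0 j)| <= 2 * b /\
   `|complex.Im (v ord0 j)| <= 2 * b].
have Qc : compact Q.
  exact: (@rV_compact (C : numFieldType) d (fun=> [set z : C | `|complex.Re z| <= 2 * b /\ `|complex.Im z| <= 2 * b])
    (fun=> @compact_square (2 * b))).
have AQ : A `<=` Q.
  move=> z Az j.
  have : `|z| <= M + 1 by apply: (HM (M + 1)) => //; rewrite ltrDl.
  move=> /(le_trans (norm_coord z j))/norm_cn_le; rewrite -/b => h.
  by split; apply: le_trans h; [exact: Re_cn|exact: Im_cn].
apply: (subclosed_compact cB Qc); apply: subset_trans BA _.
rewrite (closure_id Q).1; first exact: closure_subset.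
exact: compact_closed (@norm_hausdorff _ _) Qc.
Qed.

Lemma closure_vn A z : closure A z -> forall r : R, 0 < r ->
  exists2 w : Cd R d, A w & vn (w - z : 'rV[C]_d) < r.
Proof.
move=> cz r r0; have [|w [Aw wr]] := cz [set w : Cd R d | vn (w - z : 'rV[C]_d) < r].
  by apply/nbhs_vn; exists r.
by exists w.
Qed.

End Topology.

(** * The identity theorem and thinness of the closure of a good zero variety *)

Section Identity.
Variables (R : realType) (n : nat).
Local Notation C := R[i].
Local Notation V := 'rV[R[i]]_n.+1.
Implicit Types (Om : set (Cd R n.+1)).

(** The set of flat points is open by its definition and relatively closed by [flat_spread]. *)
Lemma flat_connected Om (f : V -> C) z : connected Om -> hol (Om : set V) f ->
  Om z -> flat f z -> forall w, Om w -> flat f w.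
Proof.
move=> cO fO Omz fz; have [oO _] := fO.
pose B : set (Cd R n.+1) := [set w | Om w /\ flat f w].
suff BE : B = Om by move=> w; rewrite -BE => -[].
apply: cO; first by exists z.
- exists B; last by apply/seteqP; split=> w; [case=> h1 h2; split|case].
  apply/open_vopn => w [Ow [e e0 He]]; have [r r0 Hr] := oO _ Ow.
  exists (Num.min r (e / 2)); first by rewrite lt_min r0 divr_gt0.
  move=> v; rewrite lt_min => /andP[v1 v2]; split; first exact: Hr.
  exists (e / 2) => [|u uv]; first by rewrite divr_gt0.
  by apply: He; have := vn_dist u v w; clear -uv v2; lra.
- exists (closure B); first exact: closed_closure.
  apply/seteqP; split=> w; first by move=> Bw; split; [case: Bw|exact: subset_closure].
  move=> [Ow cw]; split=> //; have [r r0 Hr] := oO _ Ow.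
  have r130 : 0 < r / 130 by rewrite divr_gt0.
  have [p [_ fp] pw] := closure_vn cw r130.
  exact: flat_spread fO r0 Hr pw fp.
Qed.

Lemma good_zero_sc Om E : open Om -> connected Om -> good_zero_variety Om E ->
  sc (2 * n) (closure E : set V).
Proof.
move=> oO cO [[f [fO [[z0 [w0 [Oz0 [Ow0 fzw]]]] EE]]] good].
have fh : hol (Om : set V) f by apply/hol_holo_on.
have EO : closure E `<=` closure Om by apply: closure_subset; rewrite EE => z [].
apply: sc_local => x Ex; have [r [r0 [h [hh hE]]]] := good x (EO _ Ex).
have hol_h : hol (eball x r : set V) h by apply/hol_holo_on.
have xx : eball x r x.
  rewrite /eball /= big1 ?exprn_gt0// => j _.
  by rewrite /sqmod subrr /= expr0n addr0.
have [oB _] := hol_h; have [r1 r10 H1] := oB _ xx.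
have nf : ~ flat h x.
  move=> [e e0 He]; have m0 : 0 < Num.min r1 e by rewrite lt_min r10.
  have [y Oy] := closure_vn (EO _ Ex) m0; rewrite lt_min => /andP[y1 y2].
  have fy : flat f y.
    have [oOm _] := fh; have [r2 r20 H2] := oOm _ Oy.
    exists (Num.min r2 (Num.min r1 e - vn (y - x : V))).
      by rewrite lt_min r20 subr_gt0 lt_min y1.
    move=> v; rewrite lt_min => /andP[v1 v2].
    have : vn (v - x : V) < Num.min r1 e.
      by have := vn_dist v y x; move: v2; move: (Num.min r1 e) => m; clear; lra.
    rewrite lt_min => /andP[v3 v4]; have Ov := H2 _ v1.
    have : (eball x r `&` closure E) v.
      by rewrite hE; split; [exact: H1|split; [exact: subset_closure|exact: He]].
    move=> [_ cEv]; apply: contrapT => /eqP fv.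
    have [_ fd] := fh; have c0 := cn_gt0 fv.
    have /dif_cnt/(_ _ c0)[dl dl0 Hdl] := fd _ Ov.
    have [u Eu uv] := closure_vn cEv dl0.
    move: Eu; rewrite EE => -[_ fu].
    by have := Hdl _ uv; rewrite fu sub0r cnN ltxx.
  have fz t : Om t -> f t = 0.
    move=> Ot; have [e' e'0 He'] := flat_connected cO fh Oy fy Ot.
    by apply: He'; apply: le_lt_trans (subrr_vn _) e'0.
  by apply: fzw; rewrite !fz.
pose rr := r1 / 130.
have rr0 : 0 < rr by rewrite divr_gt0.
exists rr => //.
apply: (@sc_sub _ _ _ _ [set z : V | vn (z - x : V) < rr /\ h z = 0]).
  move=> z [cz zr]; split=> //.
  have : (eball x r `&` closure E) z.
    split=> //; apply: H1; apply: lt_trans zr _.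
    by rewrite /rr ltr_pdivrMr// ltr_pMr// ltr1n.
  by rewrite hE => -[_ [_ ->]].
apply: (@zero_sc R n [set z : V | vn (z - x : V) < rr]).
  apply: (hol_sub _ _ hol_h); first exact: vopn_ball.
  move=> z zr; apply: H1; apply: lt_trans zr _.
  by rewrite /rr ltr_pdivrMr// ltr_pMr// ltr1n.
move=> z zr fz; apply: nf; exact: flat_spread hol_h r10 H1 zr fz.
Qed.

Lemma removable_of_sc (D K : set (Cd R n.+1)) : open D -> closed K ->
  sc (2 * n) (K `&` D : set V) -> L2a_removable D (K `&` D).
Proof.
move=> oD cK sK; split; first by exists K.
move=> g [gO gfin]; have gh : hol (D `\` (K `&` D) : set V) g by apply/hol_holo_on.
have [|||G [Gh Gg Gfin]] := @removal R n D (D `\` (K `&` D)) g _ gh _ _ gfin.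
- by apply/open_vopn.
- by move=> z [].
- by apply: sc_sub sK => z [Dz nz]; apply: contrapT => nk; apply: nz.
- exists G; split; last exact: Gg.
  by split; [apply/hol_holo_on|exact: Gfin].
Qed.

End Identity.

Theorem theorem1p3 (R : realType) (d : nat) (Om E : set (Cd R d))
  (F : Cd R d -> Cd R d) :
  domain Om -> bounded_set Om ->
  good_zero_variety Om E ->
  holo_on_closure Om F ->
  interior (F @` Om) !=set0 ->
  L2a_removable Om [set z | Om z /\ (F @` closure E) (F z)] /\
  (forall D : set (Cd R d), domain D -> F @` Om `<=` D ->
     L2a_removable D (F @` closure E `&` D)).
Proof.
case: d Om E F => [|n] Om E F [oO [cO _]] bO gE [W [OW FW]] [y0 y0F].
  (* In dimension zero [Cd] has a single point, so no function takes two values. *)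
  have [[f [_ [[z [w [_ [_ fzw]]]] _]]] _] := gE; exfalso; apply: fzw.
  by congr f; apply/rowP; case.
have Fh j : hol (W : set 'rV[R[i]]_n.+1) (fun z => (F z : 'rV_n.+1) 0 j).
  exact: holo_on_coord.
have OmW : Om `<=` W by apply: subset_trans OW; exact: subset_closure.
have sE := good_zero_sc oO cO gE.
have EO : closure E `<=` closure Om.
  by apply: closure_subset; case: gE => [[f [_ [_ ->]]] _] z [].
have EW : closure E `<=` W by apply: subset_trans OW.
pose J := fun z : 'rV[R[i]]_n.+1 => \det (jac F z).
have sK : sc (2 * n) (F @` closure E : set 'rV[R[i]]_n.+1) by exact: (image_sc Fh EW sE).
have cK : closed (F @` closure E).
  apply: compact_closed; first exact: norm_hausdorff.
  apply: continuous_compact.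
    apply: continuous_in_subspaceT => z /set_mem/EW Wz.
    by apply: differentiable_continuous; exact: FW.2.
  exact: (bounded_closure_compact bO (@closed_closure _ E) EO).
have hJ : hol (Om : set 'rV[R[i]]_n.+1) J.
  by apply: hol_sub (hol_det_jac Fh) => //; exact/open_vopn.
(* A flat point of [J] would make every point of [Om] critical; then [sard] would make the image of
   [Om] null, against its interior point. *)
have nfJ z : Om z -> ~ flat J z.
  move=> Oz fz; have J0 w : Om w -> J w = 0.
    move=> Ow; have [e e0 He] := flat_connected cO hJ Oz fz Ow.
    by apply: He; apply: le_lt_trans (subrr_vn _) e0.
  have [Y [Yn FY]] := sard Fh OmW J0.
  have /nbhs_vn[r r0 Hr] := y0F.
  exact: (null_no_interior Yn FY r0 Hr).
have sP : sc (2 * n) [set z : 'rV[R[i]]_n.+1 | Om z /\ (F @` closure E) (F z)].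
  exact: (preimage_sc Fh OmW (zero_sc hJ nfJ) sK).
split=> [|D [oD _] _]; last first.
  by apply: removable_of_sc => //; apply: sc_sub sK => z [].
(* The preimage is closed only relative to [Om]. It is the trace of its own closure, since [F] is
   continuous on [Om] and the image of [closure E] is closed. *)
have SE : [set z | Om z /\ (F @` closure E) (F z)] =
    closure [set z | Om z /\ (F @` closure E) (F z)] `&` Om.
  apply/seteqP; split=> z.
    by move=> h; split; [exact: subset_closure|case: h].
  move=> [cz Oz]; split=> //; apply: cK => A /(differentiable_continuous (FW.2 _ (OmW _ Oz))) nA.
  by have [w [[_ Kw] Aw]] := cz _ nA; exists (F w).
rewrite SE; apply: removable_of_sc => //; first exact: closed_closure.
by rewrite -SE.
Qed.
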